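(* Fix $\rho\in\mathbb{N}$, a multi-index $\iota\in\mathbb{N}_0^D$, and $Q\in\mathbb{N}$ with $Q\geq |\iota|_1+\rho$, and let $y\in\mathcal{C}^{Q+1}_b(\mathbb{R}^D)$. Let $c_{\mathrm{cube}},c_{1,\mathrm{trunc}},c_{2,\mathrm{trunc}}>0$ be arbitrary, and let $c_{2,\mathrm{paths}}>0$ and $$c_{1,\mathrm{paths}}>c^*_{\mathrm{paths}}(Q,D):=\frac23+\frac83\sum_{\mathbf j\in\mathbb{N}_0^D,\ |\mathbf j|_1\le Q}\ \prod_{d=1}^D(2j_d+1).$$ For $\Delta>0$ compute $\hat z$ by Algorithm 1 (described in the context) with input $y,Q,\Delta,\iota$, the constants $c_{\mathrm{cube}},c_{1,\mathrm{trunc}},c_{2,\mathrm{trunc}}$, and $$\gamma_{\mathrm{cube}}=\frac{\rho+|\iota|_1}{2(Q+1)},\quad \gamma_{1,\mathrm{trunc}}=\rho,\quad \gamma_{2,\mathrm{trunc}}=1.5(|\iota|_1+\rho),\quad L=L_\Delta=\lceil \rho\, c_{1,\mathrm{paths}}\log(c_{2,\mathrm{paths}}\Delta^{-1})\rceil,$$ $$\tau\in\Big(0,\ 1-\big(c^*_{\mathrm{paths}}(Q,D)/c_{1,\mathrm{paths}}\big)^{1/2}\Big).$$ Then there are constants $C>0$ and $\Delta_0>0$ (depending on all constants of the setting, including $D,Q,|\iota|_1,\tau$, the constants in the standing assumptions, and the $\mathcal{C}^{Q+1}_b$-norm of $y$, but not on $\Delta$) such that for every $\Delta\le\Delta_0$,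 $$E\Big[\int_{\mathbb{R}^D}\big|E[\mathcal{H}_{\iota,\Delta}(\xi)\,y(X_2)\mid X_1=x]-\hat z(x)\big|^2\,\mu_1(dx)\Big]\le C\log(\Delta^{-1})^{D/2}\Delta^{\rho},$$ where the outer expectation is over the random samples used in Algorithm 1.
   Context: Standing setting. $D\in\mathbb{N}$. $X_1$ is an $\mathbb{R}^D$-valued random variable with law $\mu_1$ having a Lebesgue density $f$ satisfying $f(x)\le \frac{C_{1,f}}{(2\pi C_{2,f})^{D/2}}\exp\{-|x|_2^2/(2C_{2,f})\}$ for all $x$, for constants $C_{1,f},C_{2,f}>0$. $b:\mathbb{R}^D\to\mathbb{R}^D$ and $\sigma:\mathbb{R}^D\to\mathbb{R}^{D\times D}$ are measurable with $\sup_u(|b(u)|_2+\|\sigma(u)\|_2)\le C_{b,\sigma}<\infty$ ($\|\cdot\|_2$ the spectral norm). $\xi$ is a $D$-dimensional standard normal vector independent of $X_1$, and $X_2=X_1+b(X_1)\Delta+\sigma(X_1)\sqrt\Delta\,\xi$. $\mathcal{C}^{Q}_b(\mathbb{R}^D)$ denotes bounded $Q$-times continuously differentiable functions with bounded derivatives. Hermite polynomials: $\mathcal{H}_q(x)=(-1)^qe^{x^2/2}\frac{d^q}{dx^q}e^{-x^2/2}$; for $\iota\in\mathbb{N}_0^D$, $|\iota|_1=\sum_d\iota_d$ and $\mathcal{H}_{\iota,\Delta}(x)=\Delta^{-|\iota|_1/2}\prod_{d=1}^D\mathcal{H}_{\iota_d}(x_d)$. For $x\in\mathbb{R}^D$,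 $r>0$, $[x]_r$ is the componentwise truncation $[x_d]_r=\max(\min(x_d,r),-r)$. $\chi^2_D(\alpha)$ is the $(1-\alpha)$-quantile of the $\chi^2$ distribution with $D$ degrees of freedom. Algorithm 1 (input $y$, $L,Q\in\mathbb{N}$, $\Delta>0$, $\iota$, $\tau\in(0,1)$, $\gamma_{\mathrm{cube}}\in(0,1/2)$, $c_{\mathrm{cube}},c_{1,\mathrm{trunc}},c_{2,\mathrm{trunc}},\gamma_{1,\mathrm{trunc}},\gamma_{2,\mathrm{trunc}}>0$). Step 1: $h=c_{\mathrm{cube}}\Delta^{\gamma_{\mathrm{cube}}}$, $r_1=\sqrt{C_{2,f}\chi^2_D(c_{1,\mathrm{trunc}}\Delta^{\gamma_{1,\mathrm{trunc}}})}$; for $\mathbf i\in\mathbb{Z}^D$, $\Gamma_{\mathbf i}=\prod_{d}(hi_d,h(i_d+1)]$ with center $a_{\mathbf i}$; $I=\{\mathbf i:\Gamma_{\mathbf i}\cap\{|x|_2\le r_1\}\neq\emptyset\}$. Step 2: $\mathcal{L}_q$ is the Legendre polynomial of degree $q$ normalized by $\mathcal{L}_q(1)=1$; $p_{\mathbf j}(x)=\prod_{d=1}^D\sqrt{2j_d+1}\,\mathcal{L}_{j_d}(x_d)$; $K=\binom{D+Q}{D}$; for $\mathbf i\in I$, $\eta_{\mathbf i,1},\dots,\eta_{\mathbf i,K}$ is a fixed ordering of $x\mapsto p_{\mathbf j}((x-a_{\mathbf i})/(h/2))$, $|\mathbf j|_1\le Q$. Step 3: for each $\mathbf i\in I$ draw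 samples $(U_{\mathbf i,l},\xi_{\mathbf i,l})_{l=1}^L$, all mutually independent (also across $\mathbf i$), $U_{\mathbf i,l}$ uniform on $\Gamma_{\mathbf i}$, $\xi_{\mathbf i,l}$ $D$-dim standard normal. Let $r_2=\sqrt{2\log(c_{2,\mathrm{trunc}}\Delta^{-\gamma_{2,\mathrm{trunc}}}\log(\Delta^{-1}))}$, $X_{\mathbf i,l}=U_{\mathbf i,l}+b(U_{\mathbf i,l})\Delta+\sigma(U_{\mathbf i,l})\sqrt\Delta[\xi_{\mathbf i,l}]_{r_2}$, and the $L\times K$ matrix $A_{\mathbf i}=(\eta_{\mathbf i,k}(X_{\mathbf i,l}))_{l,k}$. Step 4: let $s_K$ be the smallest of the $K$ singular values of $A_{\mathbf i}$. If $s_K^2\ge\tau L$, set $\alpha_{L,\mathbf i}=A_{\mathbf i}^{+}(y(X_{\mathbf i,1}),\dots,y(X_{\mathbf i,L}))^\top$ ($A^+$ the Moore–Penrose pseudoinverse, i.e. the least-squares coefficient vector); otherwise $\alpha_{L,\mathbf i}=0\in\mathbb{R}^K$. Step 5: output $\hat z(x)=\sum_{\mathbf i\in I}\mathbf 1_{\Gamma_{\mathbf i}}(x)\sum_{k=1}^K\alpha_{L,\mathbf i,k}\,E\big[\eta_{\mathbf i,k}(x+b(x)\Delta+\sigma(x)\sqrt\Delta[\xi]_{r_2})\mathcal{H}_{\iota,\Delta}([\xi]_{r_2})\big]$, the expectation taken only over a standard normal $\xi$ independent of the samples. *)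

(* Defs.v *)
From HB Require Import structures.
From mathcomp Require Import all_boot all_order all_algebra.
From mathcomp Require Import all_classical all_reals all_analysis.

Set Implicit Arguments.
Unset Strict Implicit.
Unset Printing Implicit Defensive.

Import Order.TTheory GRing.Theory Num.Theory.
Import numFieldTopology.Exports numFieldNormedType.Exports.
Local Open Scope classical_set_scope.
Local Open Scope ring_scope.

Section Defs.
Context {R : realType}.

(* (iterated integral = integral w.r.t. the product measure, by         *)
(* Tonelli/Fubini, for the nonnegative/integrable integrands used.)     *)
Fixpoint iint (ds : seq (R -> R)) (F : seq R -> \bar R) : \bar R :=
  match ds with
  | [::] => F [::]
  | d :: ds' => (\int[lebesgue_measure]_x ((d x)%:E * iint ds' (fun v => F (x :: v))))%E
  end.

Fixpoint iblocks (bs : seq (seq (R -> R))) (F : seq (seq R) -> \bar R) : \bar R :=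
  match bs with
  | [::] => F [::]
  | b :: bs' => iint b (fun v => iblocks bs' (fun vs => F (v :: vs)))
  end.

Definition vec_of_seq (D : nat) (v : seq R) : 'cV[R]_D := \col_(i < D) nth 0 v i.

Definition lebD (D : nat) (F : 'cV[R]_D -> \bar R) : \bar R :=
  iint (nseq D (fun=> 1)) (fun v => F (vec_of_seq D v)).

Definition gaussE (D : nat) (F : 'cV[R]_D -> R) : R :=
  fine (iint (nseq D (normal_pdf 0 1)) (fun v => (F (vec_of_seq D v))%:E)).

Definition unif_pdf (a b : R) (x : R) : R := if a < x <= b then (b - a)^-1 else 0.

Definition norm2 (D : nat) (x : 'cV[R]_D) : R := Num.sqrt (\sum_(i < D) x i 0 ^+ 2).

Definition spec_norm (D : nat) (A : 'M[R]_D) : R :=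
  sup [set norm2 (A *m v) | v in [set v : 'cV[R]_D | norm2 v = 1]].

Definition borel_measurable (S T : topologicalType) (g : S -> T) : Prop :=
  forall B : set T, <<s open >> B -> <<s open >> (g @^-1` B).

Definition unitv (D : nat) (i : 'I_D) : 'cV[R]_D := delta_mx i 0.

Definition partial (D : nat) (i : 'I_D) (g : 'cV[R]_D -> R) : 'cV[R]_D -> R :=
  fun x => derive g x (unitv i).

Fixpoint CbM (D : nat) (k : nat) (M : R) (g : 'cV[R]_D -> R) : Prop :=
  match k with
  | 0 => continuous g /\ (forall x, `|g x| <= M)
  | k'.+1 => continuous g /\ (forall x, `|g x| <= M) /\
             forall i : 'I_D, (forall x, derivable g x (unitv i)) /\ CbM k' M (partial i g)
  end.

Definition hermite (q : nat) (x : R) : R :=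
  (-1) ^+ q * expR (x ^+ 2 / 2) * derive1n q (fun t : R => expR (- (t ^+ 2) / 2)) x.

Definition mi_norm (D : nat) (iota : 'I_D -> nat) : nat := (\sum_(d < D) iota d)%N.

Definition hermite_mi (D : nat) (iota : 'I_D -> nat) (Delta : R) (x : 'cV[R]_D) : R :=
  powR Delta (- ((mi_norm iota)%:R / 2)) * \prod_(d < D) hermite (iota d) (x d 0).

(* Legendre polynomial of degree q (Rodrigues' formula), L_q(1) = 1 *)
Definition legendre (q : nat) : {poly R} :=
  ((2 ^ q * q`!)%:R)^-1 *: (('X ^+ 2 - 1) ^+ q)^`(q).

Definition pj (D : nat) (j : 'I_D -> nat) (x : 'cV[R]_D) : R :=
  \prod_(d < D) (Num.sqrt ((2 * j d + 1)%:R) * (legendre (j d)).[x d 0]).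

Definition mis (D Q : nat) : seq {ffun 'I_D -> 'I_Q.+1} :=
  [seq j : {ffun 'I_D -> 'I_Q.+1} <- enum {ffun 'I_D -> 'I_Q.+1} | (\sum_(d < D) (j d : nat) <= Q)%N].

Definition nK (D Q : nat) : nat := size (mis D Q).

Definition jnth (D Q : nat) (k : nat) : 'I_D -> nat :=
  fun d => (nth [ffun=> ord0] (mis D Q) k d : nat).

Definition cstar (D Q : nat) : R :=
  2 / 3 + 8 / 3 * \sum_(j <- mis D Q) \prod_(d < D) ((2 * (j d : nat) + 1)%:R : R).

Definition chi2q (D : nat) (alpha : R) : R :=
  inf [set q : R | 1 - alpha <= gaussE (fun z : 'cV[R]_D => ((norm2 z ^+ 2 <= q)%R : bool)%:R)].

Definition cube (D : nat) (h : R) (i : 'I_D -> int) : set 'cV[R]_D :=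
  [set x | forall d, h * (i d)%:~R < x d 0 <= h * ((i d)%:~R + 1)].

Definition cube_center (D : nat) (h : R) (i : 'I_D -> int) : 'cV[R]_D :=
  \col_d (h * ((i d)%:~R + 1 / 2)).

Definition truncv (D : nat) (r : R) (x : 'cV[R]_D) : 'cV[R]_D :=
  \col_d Num.max (Num.min (x d 0) r) (- r).

(* the set I: cubes meeting the ball {|x|_2 <= r1}, enumerated as a list
   (every such i satisfies |i_d| <= truncn(r1/h) + 1, so the box below
   contains all of I, each element once). *)
Definition Iseq (D : nat) (h r1 : R) : seq ('I_D -> int) :=
  let M := (Num.truncn (r1 / h)).+1 in
  [seq i <- [seq (fun d => (k d : nat)%:Z - M%:Z) | k : {ffun 'I_D -> 'I_(M.*2.+1)} <- enum {ffun 'I_D -> 'I_(M.*2.+1)}]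
     | `[< cube h i `&` [set x | norm2 x <= r1] !=set0 >] ].

(* s_K^2 = smallest eigenvalue of A^T A (singular values of A are the
   square roots of the eigenvalues of A^T A) *)
Definition smin_sq (L K : nat) (A : 'M[R]_(L, K)) : R :=
  inf [set a : R | eigenvalue (A^T *m A) a].

(* Moore-Penrose pseudoinverse: the unique B with the Penrose equations *)
Definition mp_pinv (L K : nat) (A : 'M[R]_(L, K)) : 'M[R]_(K, L) :=
  xget 0 [set B : 'M[R]_(K, L) | [/\ A *m B *m A = A, B *m A *m B = B,
                                   (A *m B)^T = A *m B & (B *m A)^T = B *m A]].

Definition euler (D : nat) (b : 'cV[R]_D -> 'cV[R]_D) (sigma : 'cV[R]_D -> 'M[R]_D)
  (Delta : R) (u z : 'cV[R]_D) : 'cV[R]_D :=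
  u + Delta *: b u + Num.sqrt Delta *: (sigma u *m z).

Section Algorithm.
Variables (D : nat) (y : 'cV[R]_D -> R) (b : 'cV[R]_D -> 'cV[R]_D)
  (sigma : 'cV[R]_D -> 'M[R]_D) (C2f : R)
  (L Q : nat) (Delta : R) (iota : 'I_D -> nat) (tau : R)
  (gcube ccube c1t c2t g1t g2t : R).

Definition alg_h : R := ccube * powR Delta gcube.
Definition alg_r1 : R := Num.sqrt (C2f * chi2q D (c1t * powR Delta g1t)).
Definition alg_r2 : R := Num.sqrt (2 * ln (c2t * powR Delta (- g2t) * ln (Delta^-1))).
Definition alg_I : seq ('I_D -> int) := Iseq D alg_h alg_r1.

Definition alg_eta (i : 'I_D -> int) (k : nat) (x : 'cV[R]_D) : R :=
  pj (@jnth D Q k) ((alg_h / 2)^-1 *: (x - cube_center alg_h i)).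

(* A block of 2D reals encodes one sample: U = first D coordinates,
   xi = last D coordinates. *)
Definition blk_U (w : seq R) : 'cV[R]_D := \col_(d < D) nth 0 w d.
Definition blk_xi (w : seq R) : 'cV[R]_D := \col_(d < D) nth 0 w (D + d).

Definition blk_dens (i : 'I_D -> int) : seq (R -> R) :=
  [seq unif_pdf (alg_h * (i d)%:~R) (alg_h * ((i d)%:~R + 1)) | d <- enum 'I_D]
  ++ nseq D (normal_pdf 0 1).

(* all the sample blocks: for the k-th cube of alg_I and l < L, block k*L+l *)
Definition alg_blocks : seq (seq (R -> R)) :=
  flatten [seq nseq L (blk_dens i) | i <- alg_I].

Section GivenSamples.
Variable smp : nat -> nat -> seq R. (* smp k l = block of sample l of cube k *)

Definition alg_i (k : nat) : 'I_D -> int := nth (fun=> 0) alg_I k.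

Definition alg_X (k l : nat) : 'cV[R]_D :=
  euler b sigma Delta (blk_U (smp k l)) (truncv alg_r2 (blk_xi (smp k l))).

Definition alg_A (k : nat) : 'M[R]_(L, nK D Q) :=
  \matrix_(l < L, kk < nK D Q) alg_eta (alg_i k) kk (alg_X k l).

Definition alg_alpha (k : nat) : 'cV[R]_(nK D Q) :=
  if tau * L%:R <= smin_sq (alg_A k)
  then mp_pinv (alg_A k) *m (\col_(l < L) y (alg_X k l))
  else 0.

Definition alg_zhat (x : 'cV[R]_D) : R :=
  \sum_(k < size alg_I) \1_(cube alg_h (alg_i k)) x *
     \sum_(kk < nK D Q) alg_alpha k kk 0 *
        gaussE (fun z : 'cV[R]_D =>
          alg_eta (alg_i k) kk (euler b sigma Delta x (truncv alg_r2 z))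
          * hermite_mi iota Delta (truncv alg_r2 z)).
End GivenSamples.

Definition target (x : 'cV[R]_D) : R :=
  gaussE (fun z : 'cV[R]_D => hermite_mi iota Delta z * y (euler b sigma Delta x z)).

Definition alg_mse (f : 'cV[R]_D -> R) : \bar R :=
  iblocks alg_blocks (fun vs =>
    lebD (fun x => ((target x - alg_zhat (fun k l => nth [::] vs (k * L + l)) x) ^+ 2
                     * f x)%:E)).

End Algorithm.
End Defs.

(* Main.v *)
(* The squared error at x is split according to where x lies and to how the samples of its
   cube turned out.  In a cube whose empirical design matrix has smallest squared singular value
   at least tau L, the error is deterministic: the Taylor polynomial of degree Q of y is
   accurate to h^(Q+1) near the cube, least squares inherits this accuracy, and multiplying by
   the Hermite weight costs Delta^(-|iota|/2), which leaves Delta^(rho/2).  The truncation of xi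
   costs a factor exp(-r2^2/6), of order Delta^((|iota|+rho)/2).  Elsewhere zhat vanishes, and
   the target is bounded uniformly in Delta, because hermite_mi is orthogonal to the Taylor
   polynomial of y of degree less than |iota|.  It remains to see that the other places have
   mass O(Delta^rho): outside the ball of radius r1 this is the choice of the chi-square
   quantile; for the cubes with a bad design matrix it is the Chernoff bound
     E exp(-s sum_l (v . eta(U_l))^2) <= exp(-L (s - s^2 m / 2)),
     m = sup |eta|^2 = sum_j prod_d (2 j_d + 1),
   over a finite net of unit vectors v; it uses the points U_l instead of X_l, since
   X_l - U_l = o(h).

   The integral of a nonnegative function is monotone without measurability assumptions, so only
   the majorants have to be measurable. *)
Require Import Defs.
From HB Require Import structures.
From mathcomp Require Import all_boot all_order all_algebra.
From mathcomp Require Import all_classical all_reals all_analysis.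
From mathcomp Require Import measurable_realfun.
From mathcomp Require Import ring lra zify.
From Stdlib Require List.
Import Order.TTheory GRing.Theory Num.Theory.
Import numFieldTopology.Exports numFieldNormedType.Exports.
Local Open Scope classical_set_scope.
Local Open Scope ring_scope.

Set Implicit Arguments.
Unset Strict Implicit.
Unset Printing Implicit Defensive.

(** Every cube has the same bound for its failure probability, and the Gaussian masses of the cubes
    add up to at most 1; so the number of cubes, which grows as Delta tends to 0, never enters. The
    net is fixed before Delta: its mesh depends only on the gap between tau and tau' = tau + (1 -
    tau)/8, so its size is a constant. Minimising s tau' - s + s^2 m / 2 over s gives the failure
    bound exp(-L (1 - tau')^2 / (2 m)) for one net vector. The hypothesis on tau says c1p (1 -
    tau)^2 > 2/3 + 8/3 m, and the surplus over 2 m pays for replacing tau by tau'. The rate 1/6 in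
    exp(-r2^2/6) is a matter of integrability. The normal density decays at rate 1/2 and all
    integrands are kept below rate 1/4; the Hermite factor takes 1/16 of this and the tail 1/6.
    Since r2^2 is twice a logarithm, exp(-r2^2/6) is the power -1/3 of its argument, and the
    exponent 3/2 (|iota| + rho) of gamma_2 becomes (|iota| + rho)/2. *)

(** * Iterated integrals over a list of weights: measurability, monotonicity, limits *)

Section IteratedIntegrals.
Context {R : realType}.
Local Notation mu := (@lebesgue_measure R).
Implicit Types (ds : seq (R -> R)) (F G : seq R -> \bar R) (d g : R -> R).

(* The coordinates are given as measurable functions on an arbitrary space, so
   that no product sigma-algebra on sequences is needed. *)
Definition seq_measurable (n : nat) (F : seq R -> \bar R) : Prop :=
  forall dX (X : measurableType dX) (c : nat -> X -> R),
    (forall i, measurable_fun setT (c i)) ->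
    measurable_fun setT (fun x => F (mkseq (c^~ x) n)).

(** The total mass is left open, so that the constant weight 1 of [lebD] is covered as well. *)
Definition density d : Prop := measurable_fun setT d /\ forall x, 0 <= d x.

Lemma mkseq_consE (T : Type) (c : nat -> T) (n : nat) :
  mkseq c n.+1 = c 0%N :: mkseq (fun i => c i.+1) n.
Proof. by rewrite /mkseq /= -(addn0 1%N) iotaDl -map_comp. Qed.

Lemma seq_measurable_cons n F x :
  seq_measurable n.+1 F -> seq_measurable n (fun v => F (x :: v)).
Proof.
move=> mF dX X c mc.
have := mF _ X (fun i => if i is j.+1 then c j else cst x) _.
rewrite (_ : (fun t => F _) = fun t => F (x :: mkseq (c^~ t) n)); first apply.
  by case=> [|i] //; exact: measurable_cst.
by apply/funext => t; rewrite mkseq_consE.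
Qed.

Lemma seq_measurable1 F : seq_measurable 1 F ->
  measurable_fun setT (fun x : R => F [:: x]).
Proof.
by move=> mF; exact: (mF _ _ (fun=> @id (measurableTypeR R))).
Qed.

Lemma seq_measurable_app n m F v : size v = n ->
  seq_measurable (n + m) F -> seq_measurable m (fun w => F (v ++ w)).
Proof.
elim: v n F => [|x v IH] n F <- //= mF; apply: (IH (size v) (fun w => F (x :: w))) => //.
exact: seq_measurable_cons.
Qed.

Lemma seq_measurable_eq n F G : (forall v, size v = n -> F v = G v) ->
  seq_measurable n F -> seq_measurable n G.
Proof.
move=> FG mF dX X c mc; have := mF _ _ _ mc.
by congr measurable_fun; apply/funext => x; rewrite FG// size_mkseq.
Qed.

(** Tonelli's theorem gives this for nonnegative integrands. A signed [H] follows without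
    integrability, because its integral is by definition the difference of the integrals of its two
    parts. *)
Lemma measurable_param_integral dX (X : measurableType dX)
  (H : X * R -> \bar R) : measurable_fun setT H ->
  measurable_fun setT (fun x => \int[mu]_y H (x, y))%E.
Proof.
move=> mH.
have -> : (fun x => \int[mu]_y H (x, y))%E =
  (fun x => \int[mu]_y (H^\+ (x, y)) - \int[mu]_y (H^\- (x, y)))%E.
  apply/funext => x; rewrite integralE; congr (_ - _)%E; apply: eq_integral => y _.
    by rewrite !funeposE.
  by rewrite !funenegE.
apply: emeasurable_funB.
- apply: (@measurable_fun_fubini_tonelli_F _ _ X (measurableTypeR R) R mu (H^\+)%E).
    exact: measurable_funepos.
  exact: funepos_ge0.
- apply: (@measurable_fun_fubini_tonelli_F _ _ X (measurableTypeR R) R mu (H^\-)%E).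
    exact: measurable_funeneg.
  exact: funeneg_ge0.
Qed.

(** Each integration adds a variable, carried by the space [X * R] with the second projection as new
    coordinate. The induction can use this space because [seq_measurable] quantifies over all of
    them. *)
Lemma seq_measurable_iint n ds F : List.Forall density ds ->
  seq_measurable (n + size ds) F ->
  seq_measurable n (fun v => iint ds (fun w => F (v ++ w))).
Proof.
elim: ds n F => [|d ds IH] n F /=.
  by move=> _; rewrite addn0; apply: seq_measurable_eq => v _; rewrite cats0.
move=> /List.Forall_cons_iff[[md d0] Hds]; rewrite -addSnnS => /(IH _ _ Hds) mI.
move=> dX X c mc.
pose c' := fun i (p : X * R) => if (i < n)%N then c i p.1 else p.2.
have mc' i : measurable_fun setT (c' i).
  rewrite /c'; case: (i < n)%N; last exact: measurable_snd.
  exact: (measurableT_comp (mc i) measurable_fst).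
have mH := mI _ _ c' mc'.
have mdH : measurable_fun setT (fun p : X * R => (d p.2)%:E *
    iint ds (fun w => F (mkseq (c'^~ p) n.+1 ++ w)))%E.
  apply: emeasurable_funM => //.
  apply/measurable_EFinP; exact: (measurableT_comp md measurable_snd).
have := measurable_param_integral mdH.
congr measurable_fun; apply/funext => x; apply: eq_integral => y _.
congr (_ * _)%E; congr (iint ds _); apply/funext => w.
rewrite (mkseqS (c'^~ (x, y)) n) cat_rcons; congr (F (_ ++ _ :: _)); last by rewrite /c' ltnn.
by apply/eq_in_map => i; rewrite mem_iota add0n /c' => /andP[_ ->].
Qed.

Lemma seq_measurable_iint1 d ds F : List.Forall density ds ->
  seq_measurable (size ds).+1 F ->
  measurable_fun setT (fun x => iint ds (fun w => F (x :: w))).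
Proof.
move=> Hds mF.
exact: (seq_measurable1 (@seq_measurable_iint 1 ds F Hds mF)).
Qed.

Lemma iint_ge0 ds F : List.Forall density ds ->
  (forall v, size v = size ds -> 0 <= F v)%E -> (0 <= iint ds F)%E.
Proof.
elim: ds F => [|d ds IH] F /= Hds F0; first exact: F0.
move: Hds => /List.Forall_cons_iff[[md d0] Hds].
apply: integral_ge0 => x _; rewrite mule_ge0 ?lee_fin//.
by apply: IH => // v sv; rewrite F0//= sv.
Qed.

Lemma eq_iint ds F G : (forall v, size v = size ds -> F v = G v) ->
  iint ds F = iint ds G.
Proof.
elim: ds F G => [|d ds IH] F G FG /=; first exact: FG.
apply: eq_integral => x _; congr (_ * _)%E.
by apply: IH => v sv; rewrite FG//= sv.
Qed.

(** The integral of a nonnegative function is a supremum over the simple functions below it, and a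
    larger function has more of them. *)
Lemma ge0_le_integralW (F G : R -> \bar R) :
  (forall x, 0 <= F x)%E -> (forall x, F x <= G x)%E ->
  (\int[mu]_x F x <= \int[mu]_x G x)%E.
Proof.
move=> F0 FG; have G0 x : (0 <= G x)%E by exact: le_trans (F0 x) (FG x).
rewrite !ge0_integralTE//; apply: ge_ereal_sup => _ [h hF <-].
by apply: ereal_sup_ubound; exists h => // x; exact: le_trans (hF x) (FG x).
Qed.

(** Where one of the weights vanishes, both integrands are multiplied by 0. Through this lemma the
    fact that a sample lies in its cube enters the estimates. *)
Lemma le_iint_supp ds F G : List.Forall density ds ->
  (forall v, size v = size ds -> 0 <= F v)%E ->
  (forall v, size v = size ds -> all2 (fun d x => d x != 0) ds v ->
     (F v <= G v)%E) ->
  (iint ds F <= iint ds G)%E.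
Proof.
elim: ds F G => [|d ds IH] F G /= Hds F0 FG; first exact: FG.
move: Hds => /List.Forall_cons_iff[[md d0] Hds].
apply: ge0_le_integralW => x.
  by rewrite mule_ge0 ?lee_fin//; apply: iint_ge0 => // v sv; rewrite F0//= sv.
have [->|dx] := eqVneq (d x) 0; first by rewrite !mul0e.
rewrite lee_wpmul2l ?lee_fin//; apply: IH => // v sv; first by rewrite F0//= sv.
by move=> dv; apply: FG => /=; rewrite ?sv// dx.
Qed.

Lemma le_iint ds F G : List.Forall density ds ->
  (forall v, size v = size ds -> 0 <= F v)%E ->
  (forall v, size v = size ds -> F v <= G v)%E ->
  (iint ds F <= iint ds G)%E.
Proof. by move=> Hds F0 FG; apply: le_iint_supp => // v sv _; exact: FG. Qed.

Lemma iint_cat ds1 ds2 F :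
  iint (ds1 ++ ds2) F = iint ds1 (fun v => iint ds2 (fun w => F (v ++ w))).
Proof.
elim: ds1 F => //= d ds1 IH F; apply: eq_integral => x _.
by rewrite IH.
Qed.

Lemma measurable_iint_cons d ds F : List.Forall density (d :: ds) ->
  seq_measurable (size ds).+1 F ->
  measurable_fun setT (fun x => (d x)%:E * iint ds (fun w => F (x :: w)))%E.
Proof.
move=> /List.Forall_cons_iff[[md d0] Hds] mF; apply: emeasurable_funM.
  exact/measurable_EFinP.
exact: seq_measurable_iint1.
Qed.

Lemma iintZ ds F (k : R) : List.Forall density ds -> 0 <= k ->
  seq_measurable (size ds) F ->
  (forall v, size v = size ds -> 0 <= F v)%E ->
  iint ds (fun v => k%:E * F v)%E = (k%:E * iint ds F)%E.
Proof.
elim: ds F => [|d ds IH] F //= Hds' k0 mF F0.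
have [[md d0] Hds] := (List.Forall_cons_iff _ _ _).1 Hds'.
have Fx x v : size v = size ds -> (0 <= F (x :: v))%E by move=> sv; rewrite F0//= sv.
rewrite -ge0_integralZl//; last 2 first.
- exact: measurable_iint_cons.
- by move=> x _; rewrite mule_ge0 ?lee_fin// iint_ge0//; exact: Fx.
apply: eq_integral => x _; rewrite (IH (fun v => F (x :: v)))//.
- by rewrite muleCA.
- exact: seq_measurable_cons.
- exact: Fx.
Qed.

(** Monotone convergence, one coordinate at a time. It serves to show that the distribution function
    behind [chi2q] is right-continuous and tends to 1. *)
Lemma iint_mono_cvg ds (F : nat -> seq R -> \bar R) G : List.Forall density ds ->
  (forall n, seq_measurable (size ds) (F n)) ->
  (forall n v, size v = size ds -> 0 <= F n v)%E ->
  (forall v, size v = size ds -> {homo F^~ v : m n / (m <= n)%N >-> (m <= n)%E}) ->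
  (forall v, size v = size ds -> F n v @[n --> \oo] --> G v) ->
  iint ds (F n) @[n --> \oo] --> iint ds G.
Proof.
elim: ds F G => [|d ds IH] F G /= Hds' mF F0 Fnd FG; first exact: FG.
have [[md d0] Hds] := (List.Forall_cons_iff _ _ _).1 Hds'.
have Fx n x v : size v = size ds -> (0 <= F n (x :: v))%E.
  by move=> sv; rewrite F0//= sv.
have IHx x : iint ds (fun w => F n (x :: w)) @[n --> \oo] -->
     iint ds (fun w => G (x :: w)).
  apply: (IH (fun n w => F n (x :: w)) (fun w => G (x :: w))) => //.
  - by move=> n; exact: seq_measurable_cons.
  - by move=> n; exact: Fx.
  - by move=> v sv; apply: Fnd => /=; rewrite sv.
  - by move=> v sv; apply: FG => /=; rewrite sv.
rewrite (_ : integral mu setT _ = (\int[mu]_x (limn (fun n => (d x)%:E *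
    iint ds (fun w => F n (x :: w)))))%E); last first.
  apply: eq_integral => x _; apply/esym/cvg_lim => //.
  by apply: cvgeZl.
apply: cvg_monotone_convergence => //.
- by move=> n; exact: measurable_iint_cons.
- by move=> n x _; rewrite mule_ge0 ?lee_fin// iint_ge0//; exact: Fx.
- move=> x _ m n mn; rewrite lee_wpmul2l ?lee_fin//.
  apply: le_iint => //; first exact: Fx.
  by move=> v sv; apply: Fnd => //=; rewrite sv.
Qed.

End IteratedIntegrals.

(** * Measurability of real functions of finitely many coordinates *)

Section RealSeqMeasurable.
Context {R : realType}.
Implicit Types (f g : seq R -> R).

Definition rseq_measurable (n : nat) (f : seq R -> R) : Prop :=
  forall dX (X : measurableType dX) (c : nat -> X -> R),
    (forall i, measurable_fun setT (c i)) ->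
    measurable_fun setT (fun x => f (mkseq (c^~ x) n)).

Lemma rseq_measurable_EFin n f : rseq_measurable n f ->
  seq_measurable n (fun v => (f v)%:E).
Proof. by move=> mf dX X c mc; apply/measurable_EFinP; exact: mf. Qed.

Lemma rseq_measurable_cst n (k : R) : rseq_measurable n (fun=> k).
Proof. by move=> dX X c mc; exact: measurable_cst. Qed.

Lemma rseq_measurable_nth n i : rseq_measurable n (fun v => nth 0 v i).
Proof.
move=> dX X c mc; have [ni|ni] := ltnP i n.
  rewrite (_ : (fun _ => _) = c i); first exact: mc.
  by apply/funext => x; rewrite nth_mkseq.
rewrite (_ : (fun _ => _) = cst 0); first exact: measurable_cst.
by apply/funext => x; rewrite nth_default ?size_mkseq.
Qed.

Lemma rseq_measurableD n f g : rseq_measurable n f -> rseq_measurable n g ->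
  rseq_measurable n (fun v => f v + g v).
Proof. by move=> mf mg dX X c mc; apply: measurable_funD; [exact: mf|exact: mg]. Qed.

Lemma rseq_measurableM n f g : rseq_measurable n f -> rseq_measurable n g ->
  rseq_measurable n (fun v => f v * g v).
Proof. by move=> mf mg dX X c mc; apply: measurable_funM; [exact: mf|exact: mg]. Qed.

Lemma rseq_measurable_sum n (I : Type) (s : seq I) (f : I -> seq R -> R) :
  (forall i, rseq_measurable n (f i)) ->
  rseq_measurable n (fun v => \sum_(i <- s) f i v).
Proof.
move=> mf; elim: s => [|i s IH].
  have -> : (fun v => \sum_(i <- [::]) f i v) = cst 0 by apply/funext => v; rewrite big_nil.
  exact: rseq_measurable_cst.
have -> : (fun v => \sum_(j <- i :: s) f j v) = (fun v => f i v + \sum_(j <- s) f j v).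
  by apply/funext => v; rewrite big_cons.
by apply: rseq_measurableD.
Qed.

Lemma rseq_measurable_prod n (I : Type) (s : seq I) (f : I -> seq R -> R) :
  (forall i, rseq_measurable n (f i)) ->
  rseq_measurable n (fun v => \prod_(i <- s) f i v).
Proof.
move=> mf; elim: s => [|i s IH].
  have -> : (fun v => \prod_(i <- [::]) f i v) = cst 1 by apply/funext => v; rewrite big_nil.
  exact: rseq_measurable_cst.
have -> : (fun v => \prod_(j <- i :: s) f j v) = (fun v => f i v * \prod_(j <- s) f j v).
  by apply/funext => v; rewrite big_cons.
by apply: rseq_measurableM.
Qed.

Lemma rseq_measurable_comp n (h : R -> R) f : measurable_fun setT h ->
  rseq_measurable n f -> rseq_measurable n (fun v => h (f v)).
Proof.
by move=> mh mf dX X c mc; apply: (measurableT_comp mh); exact: mf.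
Qed.

Lemma rseq_measurable_le n f g : rseq_measurable n f -> rseq_measurable n g ->
  rseq_measurable n (fun v => ((f v <= g v)%R : bool)%:R).
Proof.
move=> mf mg dX X c mc.
rewrite (_ : (fun _ => _) = (fun x => if f (mkseq (c^~ x) n) <= g (mkseq (c^~ x) n) then 1 else 0)).
  apply: measurable_fun_ifT => //=; apply: measurable_fun_ler; [exact: mf|exact: mg].
by apply/funext => x; case: ifP.
Qed.

Lemma rseq_measurable_cons n f x : rseq_measurable n.+1 f ->
  rseq_measurable n (fun v => f (x :: v)).
Proof.
move=> mf; have mF : seq_measurable n.+1 (fun v => (f v)%:E) by exact: rseq_measurable_EFin.
by move=> dX X c mc; apply/measurable_EFinP; exact: (seq_measurable_cons x mF).
Qed.

(** An open set of columns is a countable union of boxes with rational centres and radii 1/(n+1),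
    and the preimage of a box is a finite intersection of measurable sets. Continuity of [y] thus
    suffices for measurability along an Euler step. *)
Lemma measurable_continuous_col D dX (X : measurableType dX)
    (g : 'cV[R]_D -> R) (c : 'I_D -> X -> R) :
  continuous g -> (forall i, measurable_fun setT (c i)) ->
  measurable_fun setT (fun x => g (\col_i c i x)).
Proof.
move=> cg mc; apply: (measurability _ (RGenOpens.measurableE R)) => _ [_ [a [b ->] <-]].
rewrite setTI.
pose U := g @^-1` `]a, b[%classic.
have oU : open U.
  by apply: open_comp => //= x _; exact: cg.
pose box (p : {ffun 'I_D -> rat} * nat) : set X :=
  \big[setI/setT]_(i < D) (c i @^-1` ball (ratr (p.1 i) : R) (p.2.+1%:R^-1)).
pose good (p : {ffun 'I_D -> rat} * nat) : Prop := forall w : 'cV[R]_D,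
  (forall i, ball (ratr (p.1 i) : R) (p.2.+1%:R^-1) (w i 0)) -> U w.
have -> : (fun x => g (\col_i c i x)) @^-1` `]a, b[%classic =
    \bigcup_(p in [set p | good p]) box p.
  apply/seteqP; split=> x /=.
    move=> Ux; have : nbhs (\col_i c i x) U by apply: open_nbhs_nbhs; split.
    rewrite -nbhs_ballE => -[e /= e0 eU].
    (* Half of [e], since a point of the box is compared with the given one through the rational
       centre. *)
    have [n [k [kE k0 ke]]] : exists n k, [/\ k = n.+1%:R^-1, 0 < k & k < e / 2].
      have [n _ /(_ n (leqnn n))] := near_infty_natSinv_lt (PosNum (divr_gt0 e0 (ltr0Sn R 1))).
      by move=> ?; exists n, n.+1%:R^-1; rewrite invr_gt0.
    have /choice[q hq] : forall i, exists q : rat, ball (ratr q : R) k (c i x).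
      move=> i; have [|q] := @rat_in_itvoo R (c i x - k) (c i x + k); first by lra.
      rewrite in_itv/= => /andP[q1 q2]; exists q; rewrite /ball/=.
      by rewrite ltr_distlC; apply/andP; split; lra.
    exists ([ffun i => q i], n).
      move=> w hw; apply: eU; split => // i j; rewrite mxE (ord1 j).
      have := hw i; have := hq i; rewrite /= ffunE /ball/= -kE.
      by rewrite !ltr_norml => /andP[? ?] /andP[? ?]; apply/andP; split; lra.
    rewrite /box; elim/big_ind : _ => // i _ /=; rewrite ffunE -kE; exact: hq.
  move=> [p gp bx]; apply: gp => i; rewrite mxE.
  by move: bx; rewrite /box (bigD1 i)//= => -[].
rewrite bigcup_mkcond; apply: countable_bigcupT_measurable; first exact: countableP.
move=> p; case: ifP => // _.
rewrite /box; elim/big_ind : _ => // [A B|i _]; first exact: measurableI.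
rewrite -[X in measurable X]setTI; apply: mc => //; exact: measurable_ball.
Qed.

Lemma rseq_measurable_continuous n D (g : 'cV[R]_D -> R) (f : 'I_D -> seq R -> R) :
  continuous g -> (forall i, rseq_measurable n (f i)) ->
  rseq_measurable n (fun v => g (\col_i f i v)).
Proof.
move=> cg mf dX X c mc; apply: measurable_continuous_col => // i; exact: mf.
Qed.

End RealSeqMeasurable.

(** * Functions of Gaussian growth and their integrals *)

Section TameFunctions.
Context {R : realType}.
Local Notation mu := (@lebesgue_measure R).
Implicit Types (ds : seq (R -> R)) (f g : seq R -> R) (d : R -> R).

Definition gauss_weight (a : R) (v : seq R) : R := \prod_(x <- v) expR (a * x ^+ 2).

Definition gauss_bounded (a : R) (n : nat) f : Prop :=
  exists2 C, 0 <= C & forall v, size v = n -> `|f v| <= C * gauss_weight a v.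

(* The rate 1/4 is below the rate 1/2 of the standard normal density. *)
Definition tame (n : nat) f : Prop :=
  rseq_measurable n f /\ gauss_bounded (4^-1) n f.

(** The condition that makes a tame function integrable in one coordinate; the uniform and the
    standard normal density both meet it. *)
Definition light_density d : Prop :=
  density d /\ (\int[mu]_x (d x * expR (4^-1 * x ^+ 2))%:E < +oo)%E.

(** [fine] turns an infinite value into 0; by [iint_rint] this does not happen for a tame integrand
    and light densities. *)
Definition rint ds f : R := fine (iint ds (fun v => (f v)%:E)).

Lemma gauss_weight_gt0 a v : 0 < gauss_weight a v.
Proof. by rewrite /gauss_weight prodr_gt0// => x _; exact: expR_gt0. Qed.

Lemma gauss_weight_ge0 a v : 0 <= gauss_weight a v.
Proof. exact: ltW (gauss_weight_gt0 a v). Qed.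

Lemma gauss_weight_ge1 a v : 0 <= a -> 1 <= gauss_weight a v.
Proof.
move=> a0; rewrite /gauss_weight; elim: v => [|x v IH]; first by rewrite big_nil.
rewrite big_cons -[leLHS]mulr1 ler_pM//.
by rewrite -[leLHS]expR0 ler_expR mulr_ge0// sqr_ge0.
Qed.

Lemma light_density_density ds :
  List.Forall light_density ds -> List.Forall density ds.
Proof. by apply: List.Forall_impl => d []. Qed.

Lemma tame_cst n (k : R) : tame n (fun=> k).
Proof.
split; first exact: rseq_measurable_cst.
exists `|k| => // v _; rewrite ler_peMr// gauss_weight_ge1//.
Qed.

Lemma tameD n f g : tame n f -> tame n g -> tame n (fun v => f v + g v).
Proof.
move=> [mf [C C0 fC]] [mg [B B0 gB]]; split; first exact: rseq_measurableD.
exists (C + B); first exact: addr_ge0.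
move=> v sv; rewrite mulrDl (le_trans (ler_normD _ _))// lerD//; [exact: fC|exact: gB].
Qed.

Lemma tameZ n f k : tame n f -> tame n (fun v => k * f v).
Proof.
move=> [mf [C C0 fC]]; split.
  by apply: rseq_measurableM => //; exact: rseq_measurable_cst.
exists (`|k| * C); first exact: mulr_ge0.
by move=> v sv; rewrite normrM -mulrA ler_wpM2l// fC.
Qed.

Lemma tameN n f : tame n f -> tame n (fun v => - f v).
Proof.
move=> /(tameZ (-1)); congr tame; apply/funext => v; exact: mulN1r.
Qed.

Lemma tameB n f g : tame n f -> tame n g -> tame n (fun v => f v - g v).
Proof. by move=> tf tg; apply: tameD => //; exact: tameN. Qed.

Lemma tame_sum n (I : Type) (s : seq I) (f : I -> seq R -> R) :
  (forall i, tame n (f i)) -> tame n (fun v => \sum_(i <- s) f i v).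
Proof.
move=> tf; elim: s => [|i s IH].
  have -> : (fun v => \sum_(i <- [::]) f i v) = cst 0 by apply/funext => v; rewrite big_nil.
  exact: tame_cst.
have -> : (fun v => \sum_(j <- i :: s) f j v) = (fun v => f i v + \sum_(j <- s) f j v).
  by apply/funext => v; rewrite big_cons.
exact: tameD.
Qed.

Lemma tame_cons n f x : tame n.+1 f -> tame n (fun v => f (x :: v)).
Proof.
move=> [mf [C C0 fC]]; split; first exact: rseq_measurable_cons.
exists (C * expR (4^-1 * x ^+ 2)); first by rewrite mulr_ge0// expR_ge0.
by move=> v sv; rewrite (le_trans (fC _ _)) /= ?sv// /gauss_weight big_cons mulrA.
Qed.

Lemma light_density_integrable d f : light_density d -> tame 1 f ->
  mu.-integrable setT (fun x => (d x)%:E * (f [:: x])%:E)%E.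
Proof.
move=> [[md d0] dw] [mf [C C0 fC]].
have m1 : measurable_fun setT (fun x => (d x)%:E * (f [:: x])%:E)%E.
  apply: emeasurable_funM; first exact/measurable_EFinP.
  exact: seq_measurable1 (rseq_measurable_EFin mf).
have m2 : measurable_fun setT (fun x => (d x * expR (4^-1 * x ^+ 2))%:E).
  apply/measurable_EFinP/measurable_funM => //.
  by apply: measurableT_comp => //; apply: measurable_funM => //; exact: measurable_funX.
apply: (@le_integrable _ _ _ mu setT measurableT _
  (fun x => C%:E * (d x * expR (4^-1 * x ^+ 2))%:E)%E) => //.
  move=> x _; rewrite -!EFinM/= lee_fin !normrM (ger0_norm (d0 x)) (ger0_norm C0).
  rewrite (ger0_norm (expR_ge0 _)) mulrCA ler_wpM2l//.
  by have := fC [:: x] erefl; rewrite /gauss_weight big_seq1.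
apply: integrableZl => //; apply/integrableP; split => //.
by under eq_integral do rewrite abse_EFin ger0_norm ?mulr_ge0 ?expR_ge0//.
Qed.

(** The Gaussian weight is a product over the coordinates, so integrating one of them out multiplies
    the constant by the finite number [B] and leaves the weight of the others. Tameness and
    finiteness are proved together, since the inner integrals must be finite before the next one
    becomes an integral of real values. *)
Lemma tame_rint_app n ds f : List.Forall light_density ds ->
  tame (n + size ds) f ->
  tame n (fun v => rint ds (fun w => f (v ++ w))) /\
  forall v, size v = n -> iint ds (fun w => (f (v ++ w))%:E) \is a fin_num.
Proof.
elim: ds n f => [|d ds IH] n f /=.
  rewrite addn0 => _ tf; split => //.
  by move: tf; congr tame; apply/funext => v; rewrite /rint/= cats0.
move=> /List.Forall_cons_iff[ld Hds]; rewrite -addSnnS => tf.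
have [tI finI] := IH _ _ Hds tf.
have E v : size v = n ->
    (\int[mu]_x ((d x)%:E * iint ds (fun w => (f (v ++ x :: w))%:E)))%E =
    (\int[mu]_x ((d x)%:E * (rint ds (fun w => f (v ++ [:: x] ++ w)))%:E))%E.
  move=> sv; apply: eq_integral => x _; congr (_ * _)%E.
  have := finI (rcons v x); rewrite size_rcons sv => /(_ erefl) fin.
  rewrite /rint fineK -?cat_rcons//.
  by move: fin; congr (_ \is a fin_num); congr iint; apply/funext => w; rewrite cat_rcons.
have tv v : size v = n -> tame 1 (fun x => rint ds (fun w => f (v ++ x ++ w))).
  move=> sv; split; last first.
    move: tI => [_ [C C0 fC]]; exists (C * gauss_weight 4^-1 v).
      by rewrite mulr_ge0// gauss_weight_ge0.
    move=> x sx; have -> : rint ds (fun w => f (v ++ x ++ w)) = rint ds (fun w => f ((v ++ x) ++ w)).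
      by congr rint; apply/funext => w; rewrite catA.
    rewrite (le_trans (fC _ _)) ?size_cat ?sx ?sv ?addn1//.
    by rewrite /gauss_weight big_cat/= mulrA.
  have := (seq_measurable_app sv (m := 1)).
  rewrite addn1 => /(_ (fun v => (rint ds (fun w => f (v ++ w)))%:E)).
  move=> /(_ (rseq_measurable_EFin tI.1)) m1 dX X c mc.
  move: (m1 _ _ _ mc) => /measurable_EFinP.
  by congr measurable_fun; apply/funext => x; congr rint; apply/funext => w; rewrite catA.
have iv v (sv : size v = n) := light_density_integrable ld (tv v sv).
split; last by move=> v sv; rewrite E//; exact: integrable_fin_num (iv v sv).
move: tI => [mI [C C0 fC]].
split.
  have dds : List.Forall density (d :: ds).
    by apply/List.Forall_cons_iff; split; [exact: ld.1|exact: light_density_density].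
  have := @seq_measurable_iint R n (d :: ds) (fun v => (f v)%:E) dds.
  rewrite addnS => /(_ (rseq_measurable_EFin tf.1)) m1.
  move=> dX X c mc.
  exact: (measurableT_comp (fine_measurable measurableT) (m1 _ _ _ mc)).
set B := fine (\int[mu]_x (d x * expR (4^-1 * x ^+ 2))%:E).
have d0 x := ld.1.2 x.
have fB : (\int[mu]_x (d x * expR (4^-1 * x ^+ 2))%:E)%E = B%:E.
  rewrite fineK// ge0_fin_numE; first exact: ld.2.
  by apply: integral_ge0 => x _; rewrite lee_fin mulr_ge0 ?expR_ge0.
exists (C * B).
  rewrite mulr_ge0// fine_ge0// integral_ge0// => x _.
  by rewrite lee_fin mulr_ge0 ?expR_ge0.
move=> v sv; have fin := integrable_fin_num measurableT (iv v sv).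
rewrite /rint/= E// -lee_fin -abse_EFin fineK//.
apply: le_trans (le_abse_integral _ _ _) _ => //.
  exact: (measurable_int _ (iv v sv)).
have m2 : measurable_fun setT (fun x => (d x * expR (4^-1 * x ^+ 2))%:E).
  apply/measurable_EFinP/measurable_funM => //; first exact: ld.1.1.
  by apply: measurableT_comp => //; apply: measurable_funM => //; exact: measurable_funX.
rewrite mulrAC EFinM -fB -ge0_integralZl//=; last 2 first.
- by move=> x _; rewrite lee_fin mulr_ge0 ?expR_ge0.
- by rewrite lee_fin mulr_ge0// gauss_weight_ge0.
apply: ge0_le_integralW => x; first by rewrite lee_fin.
rewrite -EFinM lee_fin normrM (ger0_norm (d0 x)) mulrCA ler_wpM2l//.
have := fC (rcons v x); rewrite size_rcons sv => /(_ erefl).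
rewrite /gauss_weight big_rcons/= mulrA; apply: le_trans.
by rewrite le_eqVlt; apply/orP; left; apply/eqP; congr `|rint _ _|; apply/funext => w; rewrite cat_rcons.
Qed.

Lemma iint_rint ds f : List.Forall light_density ds -> tame (size ds) f ->
  iint ds (fun v => (f v)%:E) = (rint ds f)%:E.
Proof.
move=> Hds tf; have [_ /(_ [::] erefl)] := @tame_rint_app 0 ds f Hds tf.
by move=> fin; rewrite /rint fineK.
Qed.

Lemma tame_rint_cons ds f : List.Forall light_density ds -> tame (size ds).+1 f ->
  tame 1 (fun v => rint ds (fun w => f (v ++ w))).
Proof. by move=> Hds tf; exact: (@tame_rint_app 1 ds f Hds tf).1. Qed.

Lemma rint_linear ds f g k : List.Forall light_density ds ->
  tame (size ds) f -> tame (size ds) g ->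
  rint ds (fun v => k * f v + g v) = k * rint ds f + rint ds g.
Proof.
elim: ds f g => [|d ds IH] f g //= Hds' tf tg.
have [ld Hds] := (List.Forall_cons_iff _ _ _).1 Hds'.
apply: EFin_inj; rewrite EFinD EFinM -!iint_rint//; last first.
  by apply: tameD => //; exact: tameZ.
have jf := light_density_integrable ld (tame_rint_cons Hds tf).
have jg := light_density_integrable ld (tame_rint_cons Hds tg).
have E h : tame (size ds).+1 h -> iint (d :: ds) (fun v => (h v)%:E) =
    (\int[mu]_x ((d x)%:E * (rint ds (fun w => h ([:: x] ++ w)))%:E))%E.
  move=> th; apply: eq_integral => x _; congr (_ * _)%E.
  exact: (@iint_rint ds (fun w => h (x :: w)) Hds (tame_cons x th)).
rewrite !E//; last by apply: tameD => //; exact: tameZ.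
rewrite -integralZl// -integralD//; last exact: integrableZl.
apply: eq_integral => x _.
rewrite (IH (fun w => f (x :: w)) (fun w => g (x :: w)))//; [|exact: tame_cons..].
rewrite -!EFinM -EFinD; congr EFin; ring.
Qed.

Lemma rint_ge0 ds f : List.Forall density ds ->
  (forall v, size v = size ds -> 0 <= f v) -> 0 <= rint ds f.
Proof. by move=> Hds f0; apply/fine_ge0/iint_ge0 => // v sv; rewrite lee_fin f0. Qed.

Lemma eq_rint ds f g : (forall v, size v = size ds -> f v = g v) ->
  rint ds f = rint ds g.
Proof. by move=> fg; congr fine; apply: eq_iint => v sv; rewrite fg. Qed.

Lemma rint0 ds : rint ds (fun=> 0) = 0.
Proof.
rewrite /rint; suff -> : iint ds (fun=> 0%:E) = 0%E by [].
by elim: ds => //= d ds ->; apply: integral0_eq => x _; rewrite mule0.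
Qed.

Lemma rintZ ds f k : List.Forall light_density ds -> tame (size ds) f ->
  rint ds (fun v => k * f v) = k * rint ds f.
Proof.
move=> Hds tf; rewrite -[RHS]addr0 -(rint0 ds) -rint_linear//; last exact: tame_cst.
by congr rint; apply/funext => v; rewrite addr0.
Qed.

Lemma rintD ds f g : List.Forall light_density ds ->
  tame (size ds) f -> tame (size ds) g ->
  rint ds (fun v => f v + g v) = rint ds f + rint ds g.
Proof.
move=> Hds tf tg; rewrite -(mul1r (rint ds f)) -rint_linear//.
by congr rint; apply/funext => v; rewrite mul1r.
Qed.

Lemma rintB ds f g : List.Forall light_density ds ->
  tame (size ds) f -> tame (size ds) g ->
  rint ds (fun v => f v - g v) = rint ds f - rint ds g.
Proof.
move=> Hds tf tg; rewrite rintD//; last exact: tameN.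
congr (_ + _); rewrite -mulN1r -rintZ//.
by congr rint; apply/funext => v; rewrite mulN1r.
Qed.

Lemma rint_sum ds (I : Type) (s : seq I) (f : I -> seq R -> R) :
  List.Forall light_density ds -> (forall i, tame (size ds) (f i)) ->
  rint ds (fun v => \sum_(i <- s) f i v) = \sum_(i <- s) rint ds (f i).
Proof.
move=> Hds tf; elim: s => [|i s IH].
  rewrite big_nil -[RHS](rint0 ds); congr rint.
  by apply/funext => v; rewrite big_nil.
rewrite big_cons -IH -rintD//; last exact: tame_sum.
by congr rint; apply/funext => v; rewrite big_cons.
Qed.

Lemma ler_rint ds f g : List.Forall light_density ds ->
  tame (size ds) f -> tame (size ds) g ->
  (forall v, size v = size ds -> f v <= g v) -> rint ds f <= rint ds g.
Proof.
move=> Hds tf tg fg; rewrite -subr_ge0 -rintB//; apply: rint_ge0.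
  exact: light_density_density.
by move=> v sv; rewrite subr_ge0 fg.
Qed.

Lemma ler_norm_rint ds f g : List.Forall light_density ds ->
  tame (size ds) f -> tame (size ds) g ->
  (forall v, size v = size ds -> `|f v| <= g v) -> `|rint ds f| <= rint ds g.
Proof.
move=> Hds tf tg fg; rewrite ler_norml; apply/andP; split; last first.
  by apply: ler_rint => // v sv; exact: le_trans (ler_norm _) (fg v sv).
rewrite -mulN1r -rintZ//; apply: ler_rint => //; first exact: tameZ.
by move=> v sv; rewrite mulN1r lerNl (le_trans _ (fg v sv))// -normrN ler_norm.
Qed.

(** Fubini for a product of functions of one coordinate each. The factors are indexed by all natural
    numbers, so that the induction on [n] only shifts them; the product is tame because the Gaussian
    bounds of the factors multiply. *)
Lemma rint_prod n (d g : nat -> R -> R) :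
  (forall i, light_density (d i)) ->
  (forall i, measurable_fun setT (g i)) ->
  (forall i, exists2 C, 0 <= C & forall x, `|g i x| <= C * expR (4^-1 * x ^+ 2)) ->
  tame n (fun v => \prod_(i < n) g i (nth 0 v i)) /\
  rint (mkseq d n) (fun v => \prod_(i < n) g i (nth 0 v i)) =
  \prod_(i < n) fine (\int[mu]_x (d i x * g i x)%:E).
Proof.
elim: n d g => [|n IH] d g ld mg gC.
  split; last by rewrite /rint/= !big_ord0.
  by have := @tame_cst 0 1; congr tame; apply/funext => v; rewrite big_ord0.
have [IH1 IH2] := IH (fun i => d i.+1) (fun i => g i.+1)
   (fun i => ld i.+1) (fun i => mg i.+1) (fun i => gC i.+1).
have tS : tame n.+1 (fun v => \prod_(i < n.+1) g i (nth 0 v i)).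
  split.
    apply: rseq_measurable_prod => i; apply: rseq_measurable_comp => //.
    exact: rseq_measurable_nth.
  have [C C0 hC] := gC 0%N; have [B B0 hB] := IH1.2.
  exists (C * B); first exact: mulr_ge0.
  case=> [|x v]//= [sv]; rewrite big_ord_recl/= normrM /gauss_weight big_cons mulrACA.
  by apply: ler_pM => //; exact: hB.
split => //.
have Hds : List.Forall light_density (mkseq (fun i => d i.+1) n).
  by rewrite /mkseq; elim: (iota 0 n) => [|i s IHs] /=; constructor.
apply: EFin_inj; rewrite mkseq_consE -iint_rint/=; last 2 first.
- by constructor.
- by rewrite size_mkseq.
rewrite big_ord_recl/= -IH2 EFinM.
have E x : iint (mkseq (fun i => d i.+1) n)
    (fun v => (\prod_(i < n.+1) g i (nth 0 (x :: v) i))%:E) =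
    (g 0%N x * rint (mkseq (fun i => d i.+1) n) (fun v => \prod_(i < n) g i.+1 (nth 0 v i)))%:E.
  transitivity ((rint (mkseq (fun i => d i.+1) n)
      (fun v => \prod_(i < n.+1) g i (nth 0 (x :: v) i)))%:E).
    by apply: iint_rint => //; rewrite size_mkseq; exact: (tame_cons x tS).
  rewrite -rintZ ?size_mkseq//; congr EFin; congr rint; apply/funext => v.
  by rewrite big_ord_recl.
under eq_integral do rewrite E -EFinM mulrA EFinM muleC.
have tg : tame 1 (fun v => g 0%N (nth 0 v 0)).
  split; first by apply: rseq_measurable_comp => //; exact: rseq_measurable_nth.
  have [C C0 hC] := gC 0%N; exists C => // -[|x []]//= _.
  by rewrite /gauss_weight big_seq1.
have ii : mu.-integrable setT (fun x => (d 0%N x * g 0%N x)%:E).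
  exact: light_density_integrable (ld 0%N) tg.
rewrite (integralZl _ ii)// muleC; congr (_ * _)%E; rewrite fineK//.
exact: (integrable_fin_num measurableT ii).
Qed.

End TameFunctions.

(** * Gaussian moments of polynomials and orthogonality of the Hermite polynomials *)

Section GaussianHermite.
Context {R : realType}.
Local Notation mu := (@lebesgue_measure R).
Local Notation phi := (@normal_pdf R 0 1).
Implicit Types (p : {poly R}) (x a : R).

Lemma integral_is_derive (F f : R -> R) (a b : R) : a < b ->
  (forall x, is_derive x 1 F (f x)) -> continuous f ->
  (\int[mu]_(x in `[a, b]) (f x)%:E = (F b)%:E - (F a)%:E)%E.
Proof.
move=> ab dF cf.
have cF : continuous F.
  by move=> x; apply/differentiable_continuous/derivable1_diffP; apply: ex_derive.
apply: continuous_FTC2 => //.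
- exact: continuous_subspaceT.
- split; first by move=> x _; exact: ex_derive.
  + by apply: cvg_at_right_filter; exact: cF.
  + by apply: cvg_at_left_filter; exact: cF.
- by move=> x _; rewrite derive1E; exact: derive_val.
Qed.

Lemma sqr_le_expR a x : 0 < a -> x ^+ 2 <= a^-1 * expR (a * x ^+ 2).
Proof.
move=> a0; rewrite mulrC ler_pdivlMr// mulrC.
by have := expR_ge1Dx (a * x ^+ 2); lra.
Qed.

Lemma norm_le_expR a x : 0 < a -> `|x| <= (1 + a^-1) * expR (a * x ^+ 2).
Proof.
move=> a0; have h1 := sqr_le_expR x a0.
have h2 : 1 <= expR (a * x ^+ 2).
  by rewrite -[leLHS]expR0 ler_expR mulr_ge0 ?sqr_ge0// ltW.
have h3 : `|x| <= 1 + x ^+ 2.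
  by rewrite -real_normK ?num_real//; have := sqr_ge0 (`|x| - 1); have := normr_ge0 x; nra.
by rewrite mulrDl mul1r; lra.
Qed.

(** The rate is arbitrary so that the induction can halve it: one half bounds the polynomial of
    lower degree, the other absorbs the additional factor X. *)
Lemma horner_le_expR p a : 0 < a ->
  exists2 C, 0 <= C & forall x, `|p.[x]| <= C * expR (a * x ^+ 2).
Proof.
elim/poly_ind: p a => [|p c IH] a a0.
  by exists 0 => // x; rewrite horner0 normr0 mul0r.
have a20 : 0 < a / 2 by lra.
have [C C0 hC] := IH _ a20.
exists (C * (1 + (a / 2)^-1) + `|c|).
  by rewrite addr_ge0// mulr_ge0// addr_ge0// invr_ge0 ltW.
move=> x; rewrite hornerMXaddC (le_trans (ler_normD _ _))// mulrDl lerD//.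
  rewrite normrM (_ : a * x ^+ 2 = a / 2 * x ^+ 2 + a / 2 * x ^+ 2); last by field.
  by rewrite expRD mulrACA ler_pM// norm_le_expR.
by rewrite ler_peMr// -[leLHS]expR0 ler_expR mulr_ge0 ?sqr_ge0// ltW.
Qed.

Lemma normal_pdf01E x : phi x = normal_peak 1 * expR (- (x ^+ 2) / 2).
Proof.
by rewrite normal_pdfE ?oner_neq0// /normal_fun subr0 expr1n.
Qed.

Lemma light_density_normal : light_density phi.
Proof.
split; first by split; [exact: measurable_normal_pdf|exact: normal_pdf_ge0].
(* exp(-x^2/2 + x^2/4) is, up to a constant, the normal density of variance 2. *)
have E x : phi x * expR (4^-1 * x ^+ 2) =
    (normal_peak 1 / normal_peak (Num.sqrt 2)) * normal_pdf 0 (Num.sqrt 2) x.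
  rewrite normal_pdf01E [in RHS]normal_pdfE// /normal_fun subr0.
  rewrite mulrA divfK ?gt_eqF ?normal_peak_gt0// -mulrA -expRD.
  by congr (_ * expR _); rewrite sqr_sqrtr// -[2 *+ 2]mulr_natr; field.
under eq_integral do rewrite E EFinM.
rewrite integralZl//; last exact: integrable_normal_pdf.
by rewrite integral_normal_pdf mule1 ltry.
Qed.

Lemma light_density_nseq_normal n : List.Forall light_density (nseq n phi).
Proof. by elim: n => [|n IH]; constructor => //; exact: light_density_normal. Qed.

Lemma tame_horner p : tame 1 (fun v => p.[nth 0 v 0]).
Proof.
split.
  apply: rseq_measurable_comp; last exact: rseq_measurable_nth.
  by apply: continuous_measurable_fun; exact: continuous_horner.
have [|C C0 hC] := @horner_le_expR p 4^-1; first by rewrite invr_gt0.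
by exists C => // -[|x []]//= _; rewrite /gauss_weight big_seq1.
Qed.

Definition gauss_moment p : R := rint [:: phi] (fun v => p.[nth 0 v 0]).

Lemma gauss_momentE p : gauss_moment p = fine (\int[mu]_x (phi x * p.[x])%:E).
Proof. by []. Qed.

Lemma gauss_momentD p q : gauss_moment (p + q) = gauss_moment p + gauss_moment q.
Proof.
rewrite /gauss_moment -rintD ?size_nseq; [|exact: (light_density_nseq_normal 1)|exact: tame_horner..].
by congr rint; apply/funext => v; rewrite hornerD.
Qed.

Lemma is_derive_gauss p x :
  is_derive x 1 (fun t => phi t * p.[t]) (phi x * (p^`() - 'X * p).[x]).
Proof.
have -> : (fun t => phi t * p.[t]) =
    (fun t : R => normal_peak 1 * (expR (t * t * (- 2^-1)) * p.[t])).
  apply/funext => t; rewrite normal_pdf01E.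
  by rewrite (_ : - (t ^+ 2) / 2 = t * t * (- 2^-1)); [rewrite -[LHS]mulrA|rewrite expr2; field].
apply: is_derive_eq.
rewrite normal_pdf01E !hornerE /GRing.scale/=.
rewrite (_ : - (x ^+ 2) / 2 = x * x * (- 2^-1)); last by rewrite expr2; field.
by rewrite /cst; field.
Qed.

Lemma gauss_boundary p :
  (phi n.+1%:R * p.[n.+1%:R])%:E @[n --> \oo] --> 0%E.
Proof.
have [|C C0 hC] := @horner_le_expR p 4^-1; first by rewrite invr_gt0.
apply/fine_cvgP; split; first exact: nearW.
(* Against the growth of [p] a factor exp(-y^2/4) remains, and it is at most 4/y for y >= 1 because
   exp(t) >= 1 + t. *)
apply: (@squeeze_cvgr _ _ _ _ (fun n => - (normal_peak 1 * C * 4) * (@harmonic R) n)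
  (fun n => (normal_peak 1 * C * 4) * (@harmonic R) n)).
- apply: nearW => n /=; rewrite mulNr -ler_norml.
  have n0 : 0 < n.+1%:R :> R by rewrite ltr0n.
  have n1 : 1 <= n.+1%:R :> R by rewrite ler1n.
  rewrite /harmonic; move: n0 n1; set y := n.+1%:R => y0 y1.
  have pk : 0 <= normal_peak (1 : R) by exact: normal_peak_ge0.
  rewrite normrM normal_pdf01E (ger0_norm (mulr_ge0 pk (expR_ge0 _))) -!mulrA.
  rewrite ler_wpM2l//.
  apply: (@le_trans _ _ (expR (- y ^+ 2 / 2) * (C * expR (4^-1 * y ^+ 2)))).
    by rewrite ler_wpM2l ?expR_ge0.
  rewrite mulrCA ler_wpM2l// -expRD.
  rewrite (_ : _ + _ = - (4^-1 * y ^+ 2)); last by field.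
  rewrite expRN -ler_pV2 ?inE ?unitfE ?gt_eqF ?invr_gt0 ?expR_gt0 ?divr_gt0//=.
  rewrite invrK invf_div; apply: le_trans (expR_ge1Dx _).
  by rewrite expr2; nra.
- by rewrite -(mulr0 (- (normal_peak 1 * C * 4))); apply: cvgMr; exact: cvg_harmonic.
- by rewrite -(mulr0 (normal_peak 1 * C * 4)); apply: cvgMr; exact: cvg_harmonic.
Qed.

Lemma gauss_boundaryN p :
  (phi (- n.+1%:R) * p.[- n.+1%:R])%:E @[n --> \oo] --> 0%E.
Proof.
suff -> : (fun n => (phi (- n.+1%:R) * p.[- n.+1%:R])%:E) =
    (fun n => (phi n.+1%:R * (p \Po (- 'X)).[n.+1%:R])%:E) by exact: gauss_boundary.
apply/funext => n; by rewrite horner_comp !hornerE !normal_pdf01E sqrrN.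
Qed.

(** Stein's identity: phi (p' - X p) is the derivative of phi p, so its integral over [-n-1, n+1]
    consists of boundary terms, which tend to 0. *)
Lemma gauss_moment_stein p : gauss_moment (p^`() - 'X * p) = 0.
Proof.
set r := p^`() - 'X * p.
rewrite gauss_momentE; set g := fun x => (phi x * r.[x])%:E.
have ig : mu.-integrable setT g.
  exact: (light_density_integrable light_density_normal (tame_horner r)).
have cphir : continuous (fun x => phi x * r.[x]).
  by move=> x; apply: cvgM; [apply: continuous_normal_pdf; exact: oner_neq0|exact: continuous_horner].
pose gn n := g \_ `[- n.+1%:R, n.+1%:R].
have mg : measurable_fun setT g by exact: measurable_int ig.
have [_ _ H] : [/\ mu.-integrable setT g,
    [sequence \int[mu]_x `|gn n x - g x|]_n @ \oo --> 0%E &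
    [sequence \int[mu]_x (gn n x)]_n @ \oo --> \int[mu]_x g x]%E.
  apply: (@dominated_convergence _ _ _ mu setT measurableT gn g (fun x => `|g x|)%E).
  - move=> n; apply/(measurable_restrictT _ _).1 => //; exact: measurable_funTS.
  - exact: mg.
  - apply: aeW => x _; apply: cvg_near_cst.
    exists (Num.truncn `|x|).+1 => // n /= xn; rewrite /gn patchE mem_set//=.
    rewrite in_itv/= -ler_norml (le_trans (ltW (truncnS_gt _)))// ler_nat.
    exact: leqW.
  - exact: integrable_abse.
  - apply: aeW => x n _; rewrite /gn patchE; case: ifP => // _.
    by rewrite abse0 abse_ge0.
have E n : (\int[mu]_x (gn n x) =
    (phi n.+1%:R * p.[n.+1%:R])%:E - (phi (- n.+1%:R) * p.[- n.+1%:R])%:E)%E.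
  rewrite /gn -integral_mkcond.
  apply: (integral_is_derive (F := fun x => phi x * p.[x])) => //.
    by rewrite -subr_gt0 opprK -natrD ltr0n.
  by move=> x; exact: is_derive_gauss.
have H0 : (\int[mu]_x (gn n x))%E @[n --> \oo] --> 0%E.
  rewrite (_ : (fun n => _) = (fun n => (phi n.+1%:R * p.[n.+1%:R])%:E -
      (phi (- n.+1%:R) * p.[- n.+1%:R])%:E)%E); last by apply/funext => n; exact: E.
  have h : ((0 : R)%:E +? - (0 : R)%:E)%E by [].

  have := cvgeB h (gauss_boundary p) (gauss_boundaryN p); rewrite sube0; apply.
by rewrite (cvg_unique _ H H0).
Qed.

(** The recurrence comes from differentiating the Rodrigues formula of [hermite] once more. *)
Fixpoint hermite_poly (q : nat) : {poly R} :=
  if q is q'.+1 then 'X * hermite_poly q' - (hermite_poly q')^`() else 1.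

Lemma hermiteE q x : hermite q x = (hermite_poly q).[x].
Proof.
have H : derive1n q (fun t : R => expR (- (t ^+ 2) / 2)) =
    (fun t => (-1) ^+ q * (hermite_poly q).[t] * expR (- (t ^+ 2) / 2)).
  elim: q => [|q IH]; first by apply/funext => t; rewrite /= hornerC expr0 !mul1r.
  rewrite derive1nS IH; apply/funext => t; rewrite derive1E.
  have -> : (fun t => (-1) ^+ q * (hermite_poly q).[t] * expR (- (t ^+ 2) / 2)) =
      (fun t : R => (-1) ^+ q * (hermite_poly q).[t] * expR (t * t * (- 2^-1))).
    by apply/funext => u; congr (_ * expR _); rewrite expr2; field.
  apply: (@derive_val _ _ _ _ _ _ _ (is_derive_eq _ _)).
  rewrite !hornerE /GRing.scale/= /cst exprS.
  rewrite (_ : - (t ^+ 2) / 2 = t * t * (- 2^-1)); last by rewrite expr2; field.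
  by field.
have e : expR (x ^+ 2 / 2) * expR (- (x ^+ 2) / 2) = 1.
  by rewrite -expRD mulNr subrr expR0.
have s : (-1) ^+ q * (-1) ^+ q = 1 :> R by rewrite -exprMn mulrNN mulr1 expr1n.
rewrite /hermite H; transitivity (((-1) ^+ q * (-1) ^+ q) *
  (expR (x ^+ 2 / 2) * expR (- (x ^+ 2) / 2)) * (hermite_poly q).[x]); first by ring.
by rewrite s e !mul1r.
Qed.

(** Integration by parts: Stein's identity for H_q p replaces H_(q+1) p by H_q p' under the Gaussian
    mean, and after all [q] steps nothing is left of [p]. *)
Lemma hermite_orthogonal q p : (size p <= q)%N ->
  gauss_moment (hermite_poly q * p) = 0.
Proof.
elim: q p => [|q IH] p.
  rewrite leqn0 size_poly_eq0 => /eqP ->; rewrite mulr0 -(rint0 [:: phi]).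
  by congr rint; apply/funext => v; rewrite horner0.
move=> sp.
have -> : hermite_poly q.+1 * p =
   ((- (hermite_poly q * p))^`() - 'X * (- (hermite_poly q * p))) + hermite_poly q * p^`().
  by rewrite /= derivN derivM; ring.
rewrite gauss_momentD gauss_moment_stein add0r IH//.
by have [->|p0] := eqVneq p 0; rewrite ?deriv0 ?size_poly0// -ltnS (leq_trans _ sp)// lt_size_deriv.
Qed.

End GaussianHermite.

(** * Legendre polynomials: end-point values, differential equation, bound by 1 *)

Section Legendre.
Context {R : realType}.
Local Notation mu := (@lebesgue_measure R).
Implicit Types (p g : {poly R}) (x a b : R) (q k n : nat).

(** As much of the Leibniz rule as is needed at a zero of order q. It gives both the vanishing of
    the lower derivatives of (X^2 - 1)^q at 1 and -1 and the values of [legendre] there. *)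
Lemma derivn_mul_XsubC_exp a g q k : (k <= q)%N ->
  exists g', (('X - a%:P) ^+ q * g)^`(k) = ('X - a%:P) ^+ (q - k) * g' /\
    g'.[a] = (q ^_ k)%:R * g.[a].
Proof.
elim: k => [|k IH] kq.
  by exists g; rewrite derivn0 subn0 ffactn0 mul1r.
have [g' [E Ea]] := IH (ltnW kq).
exists ((q - k)%:R%:P * g' + ('X - a%:P) * g'^`()); split; last first.
  by rewrite !hornerE subrr mul0r addr0 Ea ffactnSr natrM mulrA; congr (_ * _); rewrite mulrC.
rewrite derivnS E derivM deriv_exp derivXsubC mul1r.
have -> : (q - k)%N = (q - k.+1).+1 by rewrite subnS prednK// subn_gt0.
rewrite /= exprS -mulr_natl -polyC_natr; ring.
Qed.

Lemma sqr_sub1_exp q : ('X ^+ 2 - 1 : {poly R}) ^+ q =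
  ('X - 1%:P) ^+ q * ('X - (-1)%:P) ^+ q.
Proof. by rewrite -exprMn polyCN opprK polyC1; congr (_ ^+ _); ring. Qed.

Lemma derivn_sqr_sub1_exp_lt q k x : (k < q)%N -> x = 1 \/ x = -1 ->
  ((('X ^+ 2 - 1 : {poly R}) ^+ q)^`(k)).[x] = 0.
Proof.
move=> kq; rewrite sqr_sub1_exp => -[] ->.
  have [g [-> _]] := derivn_mul_XsubC_exp 1 (('X - (-1)%:P) ^+ q) (ltnW kq).
  by rewrite !hornerE subrr expr0n subn_eq0 leqNgt kq mul0r.
rewrite mulrC.
have [g [-> _]] := derivn_mul_XsubC_exp (-1) (('X - 1%:P) ^+ q) (ltnW kq).
by rewrite !hornerE subrr expr0n subn_eq0 leqNgt kq mul0r.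
Qed.

Lemma legendre_norm_neq0 q : (2 ^ q * q`!)%:R != 0 :> R.
Proof. by rewrite pnatr_eq0 -lt0n muln_gt0 expn_gt0 fact_gt0. Qed.

Lemma legendre1 q : (@legendre R q).[1] = 1.
Proof.
rewrite /legendre hornerZ sqr_sub1_exp.
have [g [-> E]] := derivn_mul_XsubC_exp 1 (('X - (-1)%:P) ^+ q) (leqnn q).
have e : (('X - (-1)%:P) ^+ q).[1] = (2 ^ q)%:R :> R.
  by rewrite horner_exp hornerXsubC opprK natrX.
by rewrite subnn expr0 mul1r E ffactnn e -natrM mulnC mulVf// mulnC legendre_norm_neq0.
Qed.

Lemma legendreN1 q : (@legendre R q).[-1] = (-1) ^+ q.
Proof.
rewrite /legendre hornerZ sqr_sub1_exp (mulrC (('X - 1%:P) ^+ q)).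
have [g [-> E]] := derivn_mul_XsubC_exp (-1) (('X - 1%:P) ^+ q) (leqnn q).
have e : (('X - 1%:P) ^+ q).[-1] = (-1) ^+ q * (2 ^ q)%:R :> R.
  by rewrite horner_exp hornerXsubC natrX -exprMn; congr (_ ^+ _); ring.
rewrite subnn expr0 mul1r E ffactnn e.
transitivity ((-1) ^+ q * ((2 ^ q * q`!)%:R^-1 * (2 ^ q * q`!)%:R) : R).
  by set c := _^-1; rewrite natrM; ring.
by rewrite mulVf ?legendre_norm_neq0// mulr1.
Qed.

(** The power w = (X^2 - 1)^q satisfies the first-order equation [base]. Differentiating it n + 1
    times gives [main n], and n = q is the equation for the q-th derivative of w. *)
Lemma legendre_ode q : (1 - 'X ^+ 2) * (@legendre R q)^`()^`() =
  2%:R *: ('X * (@legendre R q)^`()) - (q * q.+1)%:R *: @legendre R q.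
Proof.
pose w : {poly R} := ('X ^+ 2 - 1) ^+ q.
have du : ('X ^+ 2 - 1 : {poly R})^`() = 2%:R * 'X.
  by rewrite derivB derivXn derivC subr0 expr1 mulr_natl.
have base : ('X ^+ 2 - 1) * w^`() = (2 * q)%:R%:P * 'X * w.
  rewrite /w; case: q {w} => [|q]; first by rewrite expr0 derivC muln0 !mul0r mulr0.
  rewrite deriv_exp du /= natrM polyCM !polyC_natr -mulr_natl [_ ^+ q.+1]exprS; ring.
have main n : ('X ^+ 2 - 1) * w^`(n.+2) + (2 * (n.+1%:R - q%:R))%:P * 'X * w^`(n.+1) +
    (n.+1%:R * (n%:R - 2 * q%:R))%:P * w^`(n) = 0.
  elim: n => [|n IH].
    have := congr1 (@deriv _) base; rewrite !derivM du derivC derivX.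
    rewrite derivnS derivn1 derivn0 mul0r add0r mulr1 => h.
    have -> : ('X ^+ 2 - 1) * w^`()^`() =
       ((2 * q)%:R)%:P * w + (2 * q)%:R%:P * 'X * w^`() - 2%:R * 'X * w^`().
      by apply: (addrI (2%:R * 'X * w^`())); rewrite h; ring.
    by rewrite !natrM !(polyCM, polyCB, polyC_natr); ring.
  have := congr1 (@deriv _) IH; rewrite !derivD !derivM du !derivC derivX.
  rewrite -!derivnS !mul0r !add0r mulr1 => h.
  rewrite -[RHS]h !(polyCM, polyCB, polyC_natr).
  by rewrite -[n.+3]addn1 -[n.+2]addn1 -[n.+1]addn1 !natrD; ring.
have := main q; rewrite /legendre -/w !derivZ -!derivnS => h.
set c := _^-1.
have {h}-> : (1 - 'X ^+ 2) * (c *: w^`(q.+2)) =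
  c *: ((2 * (q.+1%:R - q%:R))%:P * 'X * w^`(q.+1) +
    (q.+1%:R * (q%:R - 2 * q%:R))%:P * w^`(q)).
  by rewrite -!mul_polyC; rewrite -[RHS]addr0 -[in RHS](mulr0 (- c%:P)) -h; ring.
rewrite -!mul_polyC !(polyCM, polyCB, polyC_natr) natrM -natr1; ring.
Qed.

Lemma legendre_le1 q x : -1 <= x <= 1 -> `|(@legendre R q).[x]| <= 1.
Proof.
move=> x11; case: (posnP q) => [->|q0].
  by rewrite /legendre expr0 fact0 muln1 expn0 invr1 scale1r derivn0 hornerC normr1.
pose L := @legendre R q; pose c : R := (q * q.+1)%:R.
have c0 : 0 < c by rewrite ltr0n muln_gt0 q0.
have ode : (1 - 'X ^+ 2) * L^`()^`() = 2%:R *: ('X * L^`()) - c *: L by exact: legendre_ode.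
have L1 : L.[1] ^+ 2 = 1 by rewrite legendre1 expr1n.
have LN1 : L.[-1] ^+ 2 = 1 by rewrite legendreN1 -exprM mulnC exprM sqrrN !expr1n.
rewrite -/L; clearbody L c.
(* The energy E is monotone on each side of 0 by the differential equation,
   so it is largest at the end points. *)
pose E : {poly R} := c *: L ^+ 2 + (1 - 'X ^+ 2) * L^`() ^+ 2.
have dE : E^`() = 2%:R *: ('X * L^`() ^+ 2).
  rewrite /E derivD derivZ deriv_exp derivM deriv_exp derivB derivXn derivC sub0r /= !expr1.
  have -> : (1 - 'X ^+ 2) * (L^`()^`() * L^`() *+ 2) =
     ((1 - 'X ^+ 2) * L^`()^`()) * L^`() * 2%:R by rewrite -mulr_natr; ring.
  rewrite ode -!mul_polyC !polyC_natr; ring.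
have Eend y : y ^+ 2 = 1 -> L.[y] ^+ 2 = 1 -> E.[y] = c.
  move=> y1 Ly; have e1 : (1 - 'X ^+ 2 : {poly R}).[y] = 0.
    by rewrite -polyC1 hornerD hornerN hornerC hornerXn y1 subrr.
  by rewrite /E hornerD hornerZ horner_exp Ly mulr1 hornerM e1 mul0r addr0.
have E1 : E.[1] = c by apply: Eend; rewrite ?expr1n.
have EN1 : E.[-1] = c by apply: Eend; rewrite ?sqrrN ?expr1n.
have dEx y : (horner E)^`()%classic y = 2 * (y * L^`().[y] ^+ 2).
  by rewrite -derivE dE !hornerE.
have cE A : {within A, continuous (horner E)}.
  by apply: continuous_subspaceT; exact: continuous_horner.
have Ec : E.[x] <= c.
  move/andP: x11 => [x1 x2]; have [x0|x0] := leP 0 x.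
    rewrite -E1; apply: (@ger0_derive1_ndecr _ (horner E) 0 1) => // y.
    rewrite in_itv/= => /andP[y0 _].
    by rewrite dEx mulr_ge0// mulr_ge0 ?sqr_ge0// ltW.
  rewrite -EN1; apply: (@ler0_derive1_nincr _ (horner E) (-1) 0) => //; last exact: ltW.
  move=> y; rewrite in_itv/= => /andP[_ y0].
  by rewrite dEx mulr_ge0_le0// mulr_le0_ge0 ?sqr_ge0// ltW.
have : c * L.[x] ^+ 2 <= c.
  apply: le_trans Ec; rewrite /E hornerD hornerZ horner_exp lerDl hornerM horner_exp.
  rewrite mulr_ge0 ?sqr_ge0// -polyC1 hornerD hornerN hornerC hornerXn subr_ge0.
  by move/andP: x11 => [x1 x2]; rewrite -[leRHS](expr1n _ 2) -real_normK ?num_real// ler_sqr ?nnegrE// ler_norml x1.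
rewrite -{2}(mulr1 c) ler_pM2l// -[leRHS](expr1n R 2) => h.
rewrite -(@ler_pXn2r _ 2)// ?nnegrE//.
by rewrite real_normK ?num_real.
Qed.

End Legendre.

(** * Uniform means of polynomials and orthogonality of the Legendre polynomials *)

Section LegendreOrthogonality.
Context {R : realType}.
Local Notation mu := (@lebesgue_measure R).
Implicit Types (p g : {poly R}) (x a b : R) (q k n : nat).

(** At i = 0 the quotient is a division by 0, hence 0: the primitive has no constant term. *)
Definition primitive p : {poly R} := \poly_(i < (size p).+1) (p`_i.-1 / i%:R).

Lemma deriv_primitive p : (primitive p)^`() = p.
Proof.
apply/polyP => i; rewrite coef_deriv coef_poly ltnS; case: ltnP => [_|pi].
  by rewrite /= -[LHS]mulr_natr divfK// pnatr_eq0.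
by rewrite mul0rn nth_default.
Qed.

Lemma measurable_unif_pdf a b : measurable_fun setT (unif_pdf a b).
Proof.
have -> : unif_pdf a b = (fun x => if (a < x) && (x <= b) then (b - a)^-1 else 0).
  by [].
apply: measurable_fun_ifT => //=; apply: measurable_and.
  by apply: measurable_fun_ltr.
by apply: measurable_fun_ler.
Qed.

Lemma unif_pdf_ge0 a b x : a < b -> 0 <= unif_pdf a b x.
Proof. by move=> ab; rewrite /unif_pdf; case: ifP => // _; rewrite invr_ge0 subr_ge0 ltW. Qed.

Lemma density_unif a b : a < b -> density (unif_pdf a b).
Proof.
by move=> ab; split; [exact: measurable_unif_pdf|move=> x; exact: unif_pdf_ge0].
Qed.

(** The weight lives on the half-open interval, as the cubes of the algorithm do; the fundamental
    theorem of calculus takes the closed one. *)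
Lemma integral_unif_pdf a b (f : R -> R) : a < b -> continuous f ->
  (\int[mu]_x (unif_pdf a b x * f x)%:E = \int[mu]_(x in `[a, b]) ((b - a)^-1 * f x)%:E)%E.
Proof.
move=> ab cf; rewrite -integral_itv_obnd_cbnd; last first.
  apply/measurable_EFinP/measurable_funM => //; apply: measurable_funTS.
  exact: continuous_measurable_fun.
rewrite [RHS]integral_mkcond; apply: eq_integral => x _.
rewrite patchE /unif_pdf mem_setE in_itv/=.
by case: ifP; rewrite ?mul0r.
Qed.

Lemma light_density_unif a b : a < b -> light_density (unif_pdf a b).
Proof.
move=> ab; split; first exact: density_unif.
have cw : continuous (fun x : R => expR (4^-1 * x ^+ 2)).
  move=> x; apply: continuous_comp; last exact: continuous_expR.
  by apply: cvgM; [exact: cvg_cst|exact: exprn_continuous].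
rewrite integral_unif_pdf//; apply: le_lt_trans (_ : (\int[mu]_(x in `[a, b])
    ((b - a)^-1 * expR (4^-1 * (`|a| + `|b|) ^+ 2))%:E < +oo)%E); last first.
  rewrite integral_cst//= lebesgue_measure_itv/= lte_fin ab -EFinB -EFinM ltry//.
apply: ge0_le_integral => //.
- by move=> x _; rewrite lee_fin mulr_ge0 ?invr_ge0 ?subr_ge0 ?expR_ge0// ltW.
- apply/measurable_EFinP/measurable_funM => //; apply: measurable_funTS.
  exact: continuous_measurable_fun.
- move=> x /=; rewrite in_itv/= => /andP[ax xb]; rewrite lee_fin.
  rewrite ler_wpM2l ?invr_ge0 ?subr_ge0 ?(ltW ab)// ler_expR ler_wpM2l ?invr_ge0//.
  rewrite -real_normK ?num_real// ler_sqr ?nnegrE ?addr_ge0// ler_norml.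
  by have := ler_norm b; have := ler_norm (- a); rewrite normrN; have := normr_ge0 a; have := normr_ge0 b; lra.
Qed.

Definition mean_itv a b (p : {poly R}) : R := rint [:: unif_pdf a b] (fun v => p.[nth 0 v 0]).

Lemma mean_itvE a b p : a < b -> mean_itv a b p^`() = (p.[b] - p.[a]) / (b - a).
Proof.
move=> ab; rewrite /mean_itv /rint/=.
under eq_integral do rewrite -EFinM.
rewrite (integral_unif_pdf (f := horner p^`()))//; last exact: continuous_horner.
rewrite (integral_is_derive (F := fun x => (b - a)^-1 * p.[x]) (f := fun x => (b - a)^-1 * p^`().[x]))//.
- by rewrite -EFinB/= -mulrBr mulrC.
- by move=> x; apply: cvgM; [exact: cvg_cst|exact: continuous_horner].
Qed.

Lemma mean_itvD a b p g : a < b -> mean_itv a b (p + g) = mean_itv a b p + mean_itv a b g.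
Proof.
move=> ab; rewrite /mean_itv -rintD//; [|by constructor => //; exact: light_density_unif|exact: tame_horner..].
by congr rint; apply/funext => v; rewrite hornerD.
Qed.

Lemma mean_itvZ a b (c : R) p : a < b -> mean_itv a b (c *: p) = c * mean_itv a b p.
Proof.
move=> ab; rewrite /mean_itv -rintZ//; [|by constructor => //; exact: light_density_unif|exact: tame_horner].
by congr rint; apply/funext => v; rewrite hornerZ.
Qed.

Let lt11 : -1 < 1 :> R. Proof. by rewrite (lt_trans (ltrN10 _)). Qed.

(** The change of variables is purely algebraic: with primitives, both sides are differences of one
    polynomial between the points 1 and -1. *)
Lemma mean_itv_affine a b p : a < b ->
  mean_itv a b (p \Po (((b - a) / 2)^-1 *: ('X - ((a + b) / 2)%:P))) = mean_itv (-1) 1 p.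
Proof.
move=> ab; have ba : b - a != 0 by rewrite subr_eq0 gt_eqF.
rewrite -{1}(deriv_primitive p) -{2}(deriv_primitive p); set P := primitive p.
set l := _ *: _.
have -> : P^`() \Po l = (((b - a) / 2) *: (P \Po l))^`().
  rewrite derivZ deriv_comp {2}/l derivZ derivXsubC alg_polyC (mulrC (_ \Po _)) mul_polyC scalerA.
  by rewrite mulfV ?scale1r// mulf_neq0// invr_eq0 pnatr_eq0.
rewrite !mean_itvE//.
rewrite !hornerE !horner_comp /l !hornerE.
have -> : ((b - a) / 2)^-1 * (b - (a + b) / 2) = 1 by field.
have -> : ((b - a) / 2)^-1 * (a - (a + b) / 2) = -1 by field.
by field.
Qed.

Local Notation J := (mean_itv (-1) 1).

(** Integration by parts [k] times. Every boundary term contains a derivative of (X^2 - 1)^q of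
    order below q, which vanishes at both end points, and [p] is differentiated down to 0. *)
Lemma mean_derivn_orthogonal q k p : (k <= q)%N -> (size p <= k)%N ->
  J ((('X ^+ 2 - 1) ^+ q)^`(k) * p) = 0.
Proof.
set w := _ ^+ q; elim: k p => [|k IH] p kq sp.
  move: sp; rewrite leqn0 size_poly_eq0 => /eqP ->; rewrite mulr0 -[0]deriv0 mean_itvE//.
  by rewrite !horner0 subrr mul0r.
have -> : w^`(k.+1) * p = (w^`(k) * p)^`() + (-1) *: (w^`(k) * p^`()).
  by rewrite derivM -derivnS scaleN1r addrK.
rewrite mean_itvD// mean_itvZ// IH ?(ltnW kq)// ?mulr0 ?addr0.
  rewrite mean_itvE// !hornerM /w !derivn_sqr_sub1_exp_lt//; [|by right|by left].
  by rewrite !mul0r subrr mul0r.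
by have [->|p0] := eqVneq p 0; rewrite ?deriv0 ?size_poly0// -ltnS (leq_trans _ sp)// lt_size_deriv.
Qed.

Lemma mean_legendre_orthogonal q p : (size p <= q)%N -> J (legendre q * p) = 0.
Proof. by move=> sp; rewrite /legendre -scalerAl mean_itvZ// mean_derivn_orthogonal// mulr0. Qed.

Lemma coef_derivn_sqr_sub1_exp q : ((('X ^+ 2 - 1 : {poly R}) ^+ q)^`(q))`_q != 0 /\
  (size ((('X ^+ 2 - 1 : {poly R}) ^+ q)^`(q)) <= q.+1)%N.
Proof.
set w := _ ^+ q.
have sq : size ('X ^+ 2 - 1 : {poly R}) = 3%N by rewrite size_XnsubC.
have m2 : ('X ^+ 2 - 1 : {poly R}) \is monic by rewrite monicXnsubC.
have mw : w \is monic by exact: monic_exp.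
have sw : size w = (2 * q).+1.
  by rewrite -(prednK (_ : 0 < size w)%N) ?size_poly_gt0 ?monic_neq0// size_exp sq.
split; last first.
  apply/leq_sizeP => j jq; rewrite coef_derivn nth_default ?mul0rn// sw; lia.
rewrite coef_derivn (_ : w`_(q + q) = lead_coef w); last by rewrite lead_coefE sw; congr (_`_ _); lia.
by rewrite (monicP mw) pnatr_eq0 -lt0n ffact_gt0 leq_addr.
Qed.

Lemma size_legendre q : (size (@legendre R q) <= q.+1)%N.
Proof.
have [_ s] := coef_derivn_sqr_sub1_exp q.
exact: leq_trans (size_scale_leq _ _) s.
Qed.

Lemma coef_legendre_neq0 q : (@legendre R q)`_q != 0.
Proof.
have [n0 _] := coef_derivn_sqr_sub1_exp q.
by rewrite coefZ mulf_neq0// invr_eq0 legendre_norm_neq0.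
Qed.

(** The mean of (X L^2)' is known from the end-point values. Since X L' and q L have the same
    coefficient of degree q, X L' = q L + r with r of lower degree, and (X L^2)' is (2q + 1) L^2 up
    to a term 2 L r of mean 0. *)
Lemma mean_legendre_sqr q : J (legendre q * legendre q) = (2 * q + 1)%:R^-1.
Proof.
set L := legendre q.
have e : J (('X * (L * L))^`()) = 1.
  have s : (-1) ^+ q * (-1) ^+ q = 1 :> R by rewrite -exprMn mulrNN mulr1 expr1n.
  by rewrite mean_itvE// !hornerM !hornerX legendre1 legendreN1 s; field.
pose r := 'X * L^`() - q%:R *: L.
have sr : (size r <= q)%N.
  apply/leq_sizeP => j; rewrite leq_eqVlt => /orP[/eqP <-|qj].
    rewrite coefB coefXM coefZ; have [->|q0] := eqVneq q 0%N; first by rewrite mul0r subrr.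
    by rewrite coef_deriv prednK ?lt0n// -[X in X - _]mulr_natl subrr.
  rewrite coefB coefXM coefZ; case: j qj => // j; rewrite ltnS => qj.
  have Lj : L`_j.+1 = 0 by rewrite nth_default// (leq_trans (size_legendre q)).
  by rewrite /= coef_deriv Lj mul0rn mulr0 subrr.
have dE : ('X * (L * L))^`() = (2 * q + 1)%:R *: (L * L) + 2%:R *: (L * r).
  rewrite !derivM derivX /r -!mul_polyC !polyC_natr natrD natrM; ring.
move: e; rewrite dE mean_itvD// !mean_itvZ// (mean_legendre_orthogonal sr) mulr0 addr0.
move=> h; apply: (mulfI (x := (2 * q + 1)%:R)); first by rewrite pnatr_eq0 addn1.
by rewrite h divff// pnatr_eq0 addn1.
Qed.

Lemma mean_legendre i j : J (legendre i * legendre j) = (i == j)%:R * (2 * i + 1)%:R^-1.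
Proof.
have [<-|] := eqVneq i j; first by rewrite mul1r mean_legendre_sqr.
rewrite neq_ltn mul0r => /orP[ij|ji].
  by rewrite mulrC mean_legendre_orthogonal// (leq_trans (size_legendre i)).
by rewrite mean_legendre_orthogonal// (leq_trans (size_legendre j)).
Qed.

Lemma legendre_span n p : (size p <= n)%N ->
  exists c : nat -> R, p = \sum_(k < n) c k *: legendre k.
Proof.
elim: n p => [|n IH] p.
  by rewrite leqn0 size_poly_eq0 => /eqP ->; exists (fun=> 0); rewrite big_ord0.
move=> sp; pose a := p`_n / (@legendre R n)`_n.
have sr : (size (p - a *: legendre n)%R <= n)%N.
  apply/leq_sizeP => j; rewrite leq_eqVlt coefB coefZ => /orP[/eqP <-|nj].
    by rewrite /a divfK ?coef_legendre_neq0// subrr.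
  by rewrite !nth_default ?mulr0 ?subrr// ?(leq_trans sp nj)// (leq_trans (size_legendre n) nj).
have [c cE] := IH _ sr; exists (fun k => if k == n then a else c k).
rewrite big_ord_recr/= eqxx -{1}(subrK (a *: legendre n) p) cE; congr (_ + _).
by apply: eq_bigr => k _; rewrite ltn_eqF.
Qed.

End LegendreOrthogonality.

(** * Multivariate polynomials: expansion in the product Legendre basis, Taylor approximation *)

Section PolynomialFunctions.
Context {R : realType} {D : nat}.
Implicit Types (g p : 'cV[R]_D -> R) (x : 'cV[R]_D) (j : 'I_D -> nat).

Definition monomial j x : R := \prod_(d < D) x d 0 ^+ j d.

(* The degree is less than [n], the convention of [size] on univariate polynomials. *)
Inductive polyfun (n : nat) : ('cV[R]_D -> R) -> Prop :=
| polyfun0 : polyfun n (fun=> 0)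
| polyfun_monomial c j : (mi_norm j < n)%N -> polyfun n (fun x => c * monomial j x)
| polyfun_add p q : polyfun n p -> polyfun n q -> polyfun n (fun x => p x + q x).

Lemma polyfun_sum n (I : Type) (s : seq I) (p : I -> 'cV[R]_D -> R) :
  (forall i, polyfun n (p i)) -> polyfun n (fun x => \sum_(i <- s) p i x).
Proof.
move=> hp; elim: s => [|i s IH].
  by rewrite (_ : (fun _ => _) = fun=> 0); [exact: polyfun0|apply/funext => x; rewrite big_nil].
rewrite (_ : (fun _ => _) = fun x => p i x + \sum_(k <- s) p k x); first exact: polyfun_add.
by apply/funext => x; rewrite big_cons.
Qed.

Lemma polyfunW m n p : (m <= n)%N -> polyfun m p -> polyfun n p.
Proof.
move=> mn; elim=> [|c j jm|p1 p2 _ h1 _ h2]; first exact: polyfun0.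
  exact/polyfun_monomial/(leq_trans jm).
exact: polyfun_add.
Qed.

Lemma polyfun_cst n (c : R) : (0 < n)%N -> polyfun n (fun=> c).
Proof.
move=> n0; rewrite (_ : (fun _ => _) = fun x => c * monomial (fun=> 0%N) x).
  by apply: polyfun_monomial; rewrite /mi_norm big1.
by apply/funext => x; rewrite /monomial big1 ?mulr1// => d _; rewrite expr0.
Qed.

Lemma polyfunZ n (c : R) p : polyfun n p -> polyfun n (fun x => c * p x).
Proof.
elim=> [|k j jn|p1 p2 _ h1 _ h2].
- by rewrite (_ : (fun _ => _) = fun=> 0); [exact: polyfun0|apply/funext => x; rewrite mulr0].
- rewrite (_ : (fun _ => _) = fun x => (c * k) * monomial j x); first exact: polyfun_monomial.
  by apply/funext => x; rewrite mulrA.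
- rewrite (_ : (fun _ => _) = fun x => c * p1 x + c * p2 x); first exact: polyfun_add.
  by apply/funext => x; rewrite mulrDr.
Qed.

Lemma polyfunM m n p q : polyfun m.+1 p -> polyfun n.+1 q ->
  polyfun (m + n).+1 (fun x => p x * q x).
Proof.
elim=> [|k j jn|p1 p2 _ h1 _ h2] hq.
- by rewrite (_ : (fun _ => _) = fun=> 0); [exact: polyfun0|apply/funext => x; rewrite mul0r].
- elim: hq => [|k' j' jn'|p1 p2 _ h1 _ h2].
  + by rewrite (_ : (fun _ => _) = fun=> 0); [exact: polyfun0|apply/funext => x; rewrite mulr0].
  + rewrite (_ : (fun _ => _) = fun x => (k * k') * monomial (fun d => (j d + j' d)%N) x).
      by apply: polyfun_monomial; rewrite /mi_norm big_split/= ltnS leq_add// -ltnS.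
    apply/funext => x; rewrite mulrACA /monomial -big_split/=; congr (_ * _).
    by apply: eq_bigr => d _; rewrite exprD.
  + rewrite (_ : (fun _ => _) = fun x => k * monomial j x * p1 x + k * monomial j x * p2 x).
      exact: polyfun_add.
    by apply/funext => x; rewrite mulrDr.
- rewrite (_ : (fun _ => _) = fun x => p1 x * q x + p2 x * q x).
    by apply: polyfun_add; [exact: h1|exact: h2].
  by apply/funext => x; rewrite mulrDl.
Qed.

Lemma polyfun_coord d : polyfun 2 (fun x => x d 0).
Proof.
rewrite (_ : (fun _ => _) = fun x => 1 * monomial (fun e => (e == d : nat)) x).
  by apply: polyfun_monomial; rewrite /mi_norm (bigD1 d)//= eqxx big1// => e /negbTE ->.
apply/funext => x; rewrite /monomial (bigD1 d)//= eqxx expr1 big1 ?mulr1 ?mul1r//.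
by move=> e /negbTE ->; rewrite expr0.
Qed.

Lemma polyfunX n m p : polyfun n.+1 p -> polyfun (m * n).+1 (fun x => p x ^+ m).
Proof.
move=> hp; elim: m => [|m IH].
  by rewrite (_ : (fun _ => _) = fun=> 1); [exact: polyfun_cst|apply/funext => x; rewrite expr0].
rewrite (_ : (fun _ => _) = fun x => p x * p x ^+ m); last by apply/funext => x; rewrite exprS.
by rewrite mulSn; exact: polyfunM.
Qed.

Lemma polyfun_prod (I : Type) (s : seq I) (n : I -> nat) (p : I -> 'cV[R]_D -> R) :
  (forall i, polyfun (n i).+1 (p i)) ->
  polyfun (\sum_(i <- s) n i).+1 (fun x => \prod_(i <- s) p i x).
Proof.
move=> hp; elim: s => [|i s IH].
  rewrite big_nil (_ : (fun _ => _) = fun=> 1); first exact: polyfun_cst.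
  by apply/funext => x; rewrite big_nil.
rewrite big_cons (_ : (fun _ => _) = fun x => p i x * \prod_(k <- s) p k x).
  exact: polyfunM.
by apply/funext => x; rewrite big_cons.
Qed.

Lemma polyfun_mulmx n p (A : 'M[R]_D) : polyfun n p -> polyfun n (fun x => p (A *m x)).
Proof.
elim=> [|c j jn|p1 p2 _ h1 _ h2]; [exact: polyfun0| |exact: polyfun_add].
apply: polyfunZ; apply: (polyfunW jn); rewrite /mi_norm.
apply: (@polyfun_prod _ _ j) => d.
suff h : polyfun 2 (fun x => (A *m x) d 0) by have := polyfunX (j d) h; rewrite muln1.
rewrite (_ : (fun _ => _) = fun x => \sum_e A d e * x e 0); last by apply/funext => x; rewrite mxE.
by apply: polyfun_sum => e; apply: polyfunZ; exact: polyfun_coord.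
Qed.

Lemma polyfun_scale n p (s : R) : polyfun n p -> polyfun n (fun x => p (s *: x)).
Proof.
move=> /(polyfun_mulmx s%:M); congr polyfun; apply/funext => x.
by rewrite mul_scalar_mx.
Qed.

(** Each power in a monomial is expanded in Legendre polynomials of at most its degree, and the
    product is multiplied out. No product of total degree above Q survives. *)
Lemma polyfun_span_pj Q p : polyfun Q.+1 p ->
  exists beta : 'I_(nK D Q) -> R, forall u, p u = \sum_(k < nK D Q) beta k * pj (@jnth D Q k) u.
Proof.
elim=> [|c j jQ|p1 p2 _ [b1 h1] _ [b2 h2]].
- by exists (fun=> 0) => u; rewrite big1// => k _; rewrite mul0r.
- have jd d : (j d <= Q)%N.
    by move: jQ; rewrite ltnS; apply: leq_trans; rewrite /mi_norm (bigD1 d)//= leq_addr.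
  have /choice[a aE] : forall d, exists a : nat -> R,
      'X^(j d) = \sum_(k < (j d).+1) a k *: legendre k.
    by move=> d; apply: legendre_span; rewrite size_polyXn.
  (* Coefficients for the normalised polynomials, continued by 0 beyond [j d], so that the sums of
     all coordinates have the same range. *)
  pose w d k : R := if (k <= j d)%N then a d k / Num.sqrt ((2 * k + 1)%:R) else 0.
  exists (fun k => c * \prod_d w d (@jnth D Q k d)) => u.
  have E d : u d 0 ^+ j d = \sum_(k < Q.+1) w d k *
      (Num.sqrt ((2 * k + 1)%:R) * (legendre k).[u d 0]).
    have := congr1 (fun q => q.[u d 0]) (aE d); rewrite hornerXn horner_sum => ->.
    rewrite (big_ord_widen Q.+1 (fun k => (a d k *: legendre k).[u d 0])) ?ltnS//.
    rewrite big_mkcond; apply: eq_bigr => k _; rewrite /w ltnS; case: ifP => _.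
      rewrite hornerZ mulrA divfK// sqrtr_eq0 -ltNge ltr0n; lia.
    by rewrite mul0r.
  rewrite /monomial (eq_bigr _ (fun d _ => E d)) bigA_distr_bigA/= mulr_sumr.
  transitivity (\sum_(f <- mis D Q) c * \prod_(d < D) w d (f d) * pj (fun d => f d) u).
    rewrite /mis big_filter big_enum_cond/= [RHS]big_mkcond/=; apply: eq_bigr => f _.
    rewrite big_split/= mulrA; case: ifPn => // fQ.
    (* The degree of [f] exceeds Q, that of [j] does not; so some [f d] exceeds [j d], and there [w]
       is 0. *)
    have [d fd] : exists d, (j d < f d)%N.
      apply/existsP; apply: contraNT fQ; rewrite negb_exists => /forallP h.
      apply: (@leq_trans (mi_norm j)); last by rewrite -ltnS.
      by apply: leq_sum => d _; rewrite leqNgt.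
    by rewrite (bigD1 d)//= /w leqNgt fd/= !mul0r mulr0 mul0r.
  by rewrite (big_nth [ffun=> ord0]) big_mkord; apply: eq_bigr => k _.
- exists (fun k => b1 k + b2 k) => u; rewrite h1 h2 -big_split/=.
  by apply: eq_bigr => k _; rewrite mulrDl.
Qed.

Lemma is_derive_line g (a v : 'cV[R]_D) (t : R) : derivable g (a + t *: v) v ->
  is_derive t 1 (fun s => g (a + s *: v)) (derive g (a + t *: v) v).
Proof.
move=> dg; have E : (fun h : R => h^-1 *: ((fun s => g (a + s *: v)) (h *: 1 + t) - g (a + t *: v))) =
  (fun h : R => h^-1 *: (g (h *: v + (a + t *: v)) - g (a + t *: v))).
  apply/funext => h; congr (_ *: (g _ - _)).
  by rewrite [h *: 1]mulr1 scalerDl addrCA.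
apply: DeriveDef; first by rewrite /derivable /= E.
by rewrite /derive /= E.
Qed.

Lemma le_increment (F f : R -> R) (r B x : R) :
  (forall t : R, is_derive t 1 F (f t)) -> (forall t : R, `|t| <= r -> `|f t| <= B) ->
  `|x| <= r -> `|F x - F 0| <= B * `|x|.
Proof.
move=> dF fB xr.
have cF A : {within A, continuous F}.
  apply: continuous_subspaceT => t.
  by apply/differentiable_continuous/derivable1_diffP; apply: ex_derive.
have [x0|x0|->] := ltgtP x 0.
- have [c] := MVT x0 (fun t _ => dF t) (cF _).
  rewrite in_itv/= => /andP[c1 c2] E.
  rewrite distrC E normrM sub0r normrN ler_wpM2r// fB//.
  by rewrite (le_trans _ xr)// !ltr0_norm//; lra.
- have [c] := MVT x0 (fun t _ => dF t) (cF _).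
  rewrite in_itv/= => /andP[c1 c2] E.
  rewrite E normrM subr0 ler_wpM2r// fB//.
  by rewrite (le_trans _ xr)// !gtr0_norm//; lra.
- by rewrite subrr normr0 mulr0.
Qed.

(** The corners of the path from 0 to [x] whose edges are parallel to the axes, taken in the order
    of the coordinates. *)
Definition prefix_col (k : nat) x : 'cV[R]_D := \col_e (if (e < k)%N then x e 0 else 0).

Lemma prefix_colS (i : 'I_D) x : prefix_col i.+1 x = prefix_col i x + x i 0 *: unitv i.
Proof.
apply/colP => e; rewrite !mxE eqxx andbT ltnS.
case: (ltngtP e i) => [ei|ei|/val_inj ->].
- by rewrite (_ : e == i = false) ?mulr0 ?addr0//; apply/eqP => ?; subst e; rewrite ltnn in ei.
- by rewrite (_ : e == i = false) ?mulr0 ?addr0//; apply/eqP => ?; subst e; rewrite ltnn in ei.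
- by rewrite eqxx mulr1 add0r.
Qed.

(** [P x] is the integral of [p] along the i-th edge of the path of [prefix_col], expressed by an
    antiderivative on that edge; integrating a monomial there raises the degree by one. *)
Lemma polyfun_primitive n p (i : 'I_D) : polyfun n p ->
  exists P, polyfun n.+1 P /\ forall x, exists q : R -> R,
    (forall t : R, is_derive t 1 q (p (prefix_col i x + t *: unitv i))) /\
    P x = q (x i 0) - q 0.
Proof.
elim=> [|c j jn|p1 p2 _ [P1 [h1 H1]] _ [P2 [h2 H2]]].
- exists (fun=> 0); split; first exact: polyfun0.
  by move=> x; exists (cst 0); split; [move=> t; exact: is_derive_cst|rewrite subrr].
- pose K x := c * \prod_(e < D | e != i) prefix_col i x e 0 ^+ j e.
  have E x t : c * monomial j (prefix_col i x + t *: unitv i) = K x * t ^+ j i.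
    rewrite /K /monomial (bigD1 i)//= mulrAC -mulrA; congr (_ * (_ * _)).
      by rewrite !mxE ltnn !eqxx/= mulr1 add0r.
    by apply: eq_bigr => e ei; rewrite !mxE (negbTE ei)/= mulr0 addr0.

  exists (fun x => K x * (x i 0 ^+ (j i).+1 / (j i).+1%:R)); split; last first.
    move=> x; exists (horner ((K x / (j i).+1%:R) *: 'X^((j i).+1))); split.
      move=> t; rewrite E; apply: is_derive_eq.
      by rewrite derivZ derivXn hornerZ hornerMn hornerXn -[_ ^+ _ *+ _]mulr_natl/= mulrA divfK.
    by rewrite !hornerZ !hornerXn expr0n/= mulr0 subr0 mulrA [RHS]mulrAC.
  (* Beyond coordinate i the path is still at 0, so a monomial with a positive exponent there
     vanishes on the edge. *)
  have [/existsP[e /andP[ei je]]|/existsPn h] := boolP [exists e : 'I_D, (i < e)%N && (0 < j e)%N].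
    rewrite (_ : (fun _ => _) = fun=> 0); first exact: polyfun0.
    apply/funext => x; rewrite /K (bigD1 e)/=; last by apply/eqP => ?; subst e; rewrite ltnn in ei.
    by rewrite mxE ltnNge (ltnW ei)/= expr0n eqn0Ngt je/= mul0r mulr0 mul0r.
  pose j' e := (j e + (e == i))%N.
  rewrite (_ : (fun _ => _) = fun x => (c / (j i).+1%:R) * monomial j' x).
    have e1 : (\sum_(e < D) (e == i) = 1)%N.
      by rewrite (bigD1 i)//= eqxx big1// => e /negbTE ->.
    by apply: polyfun_monomial; rewrite /mi_norm big_split/= e1 addn1.
  apply/funext => x; rewrite /K /monomial [in RHS](bigD1 i)//= /j' eqxx addn1.
  rewrite (eq_bigr (fun e => x e 0 ^+ (j e + (e == i)))); first by field.
  move=> e ei; rewrite (negbTE ei) addn0 mxE; case: ltnP => // ie.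
  have := h e; rewrite (_ : (i < e)%N) /= -?eqn0Ngt; last first.
    by rewrite ltn_neqAle ie andbT eq_sym.
  by move=> /eqP ->; rewrite !expr0.
- exists (fun x => P1 x + P2 x); split; first exact: polyfun_add.
  move=> x; have [q1 [d1 e1]] := H1 x; have [q2 [d2 e2]] := H2 x.
  exists (q1 \+ q2); split; first by move=> t; apply: is_deriveD.
  by rewrite e1 e2 /=; ring.
Qed.

(** Induction on the order: the partial derivatives are approximated first, and the approximations
    are integrated along the axis-parallel path from [a] to [a + x]. Only partial derivatives enter,
    which is what [CbM] speaks of; each order costs a factor D r, for D edges of length at most
    r. *)
Lemma taylor_polyfun n M g (a : 'cV[R]_D) : CbM n M g ->
  exists2 p, polyfun n p & forall (r : R) x, (forall d, `|x d 0| <= r) ->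
    `|g (a + x) - p x| <= D%:R ^+ n * M * r ^+ n.
Proof.
elim: n g => [|n IH] g /=.
  move=> [_ gM]; exists (fun=> 0); first exact: polyfun0.
  by move=> r x xr; rewrite subr0 !expr0 mul1r mulr1.
move=> [_ [_ dg]].
have /choice[p hp] : forall i, exists p, polyfun n p /\ forall (r : R) x, (forall d, `|x d 0| <= r) ->
    `|partial i g (a + x) - p x| <= D%:R ^+ n * M * r ^+ n.
  by move=> i; have [p h1 h2] := IH _ (dg i).2; exists p.
have /choice[P hP] : forall i, exists P, polyfun n.+1 P /\ forall x, exists q : R -> R,
    (forall t : R, is_derive t 1 q (p i (prefix_col i x + t *: unitv i))) /\
    P x = q (x i 0) - q 0.
  by move=> i; apply: polyfun_primitive; exact: (hp i).1.
exists (fun x => g a + \sum_i P i x).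
  by apply: polyfun_add; [exact: polyfun_cst|apply: polyfun_sum => i; exact: (hP i).1].
move=> r x xr.
have -> : g (a + x) - (g a + \sum_i P i x) =
    \sum_(i < D) (g (a + prefix_col i.+1 x) - g (a + prefix_col i x) - P i x).
  rewrite big_split/= sumrN opprD addrA; congr (_ - _).
  rewrite -(big_mkord xpredT (fun i => g (a + prefix_col i.+1 x) - g (a + prefix_col i x))).
  rewrite telescope_sumr//; congr (g _ - g _).
    by congr (_ + _); apply/colP => e; rewrite mxE ltn_ord.
  by rewrite (_ : prefix_col 0 x = 0) ?addr0//; apply/colP => e; rewrite !mxE.
apply: le_trans (ler_norm_sum _ _ _) _.
have bnd (i : 'I_D) : `|g (a + prefix_col i.+1 x) - g (a + prefix_col i x) - P i x|
   <= D%:R ^+ n * M * r ^+ n.+1.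
  have [q [dq ->]] := (hP i).2 x.
  (* The derivative of [F] is the approximation error of the i-th partial derivative along the
     edge. *)
  pose F t := g (a + prefix_col i x + t *: unitv i) - q t.
  have -> : g (a + prefix_col i.+1 x) - g (a + prefix_col i x) - (q (x i 0) - q 0) =
      F (x i 0) - F 0.
    by rewrite /F prefix_colS scale0r addr0 addrA; ring.
  have dF (t : R) : is_derive t 1 F (partial i g (a + prefix_col i x + t *: unitv i) -
      p i (prefix_col i x + t *: unitv i)).
    have h1 := is_derive_line ((dg i).1 (a + prefix_col i x + t *: unitv i)).
    have h2 := dq t; exact: is_deriveB.
  have r0 : 0 <= r by apply: le_trans (xr i).
  apply: le_trans (le_increment (r := r) (B := D%:R ^+ n * M * r ^+ n) dF _ (xr i)) _.
    move=> t tr; rewrite -addrA; apply: (hp i).2 => e; rewrite !mxE eqxx andbT.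
    case: (ltngtP e i) => [ei|ei|/val_inj ->].
    - by rewrite (_ : e == i = false) ?mulr0 ?addr0//; apply/eqP => ?; subst e; rewrite ltnn in ei.
    - by rewrite (_ : e == i = false) ?mulr0 ?addr0 ?normr0//; apply/eqP => ?; subst e; rewrite ltnn in ei.
    - by rewrite eqxx mulr1 add0r.
  rewrite exprSr mulrA ler_wpM2l//.
  have := (hp i).2 r 0; rewrite addr0 => /(_ _) h; apply: le_trans (h _); first exact: normr_ge0.
  by move=> d; rewrite mxE normr0.
apply: le_trans (ler_sum _ (fun i _ => bnd i)) _.
by rewrite sumr_const card_ord -[leLHS]mulr_natl [D%:R ^+ n.+1]exprS !mulrA.
Qed.

Lemma CbMW m n M g : (m <= n)%N -> CbM n M g -> CbM m M g.
Proof.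
elim: m n g => [|m IH] [|n] g //=; first by move=> _ [cg [gM _]].
rewrite ltnS => mn [cg [gM dg]]; do 2 split => //.
by move=> i; split; [exact: (dg i).1|apply: IH mn _; exact: (dg i).2].
Qed.

End PolynomialFunctions.

(** * Quadratic forms, the smallest singular value and stability of least squares *)

Section LeastSquares.
Context {R : realType}.

Definition sqnorm (n : nat) (v : 'cV[R]_n) : R := \sum_i v i 0 ^+ 2.
Definition quad (n : nat) (M : 'M[R]_n) (v : 'cV[R]_n) : R := (v^T *m M *m v) 0 0.

Lemma sqnormE n (v : 'cV[R]_n) : sqnorm v = (v^T *m v) 0 0.
Proof. by rewrite mxE; apply: eq_bigr => i _; rewrite mxE expr2. Qed.

Lemma mx11B (B C : 'M[R]_1) : (B - C) 0 0 = B 0 0 - C 0 0.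
Proof. by rewrite !mxE. Qed.

Lemma mx11Z (k : R) (B : 'M[R]_1) : (k *: B) 0 0 = k * B 0 0.
Proof. by rewrite mxE. Qed.

Lemma sqnorm_ge0 n (v : 'cV[R]_n) : 0 <= sqnorm v.
Proof. by apply: sumr_ge0 => i _; exact: sqr_ge0. Qed.

Lemma sqnorm_eq0 n (v : 'cV[R]_n) : (sqnorm v == 0) = (v == 0).
Proof.
rewrite psumr_eq0; last by move=> i _; exact: sqr_ge0.
apply/allP/eqP => [h|-> i _]; last by rewrite /= mxE expr0n eqxx.
by apply/colP => i; rewrite mxE; apply/eqP; rewrite -sqrf_eq0; apply: h; rewrite mem_index_enum.
Qed.

Lemma norm2_sqr n (v : 'cV[R]_n) : norm2 v ^+ 2 = sqnorm v.
Proof. by rewrite /norm2 sqr_sqrtr//; exact: sqnorm_ge0. Qed.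

Lemma sqnormZ n (k : R) (v : 'cV[R]_n) : sqnorm (k *: v) = k ^+ 2 * sqnorm v.
Proof. by rewrite /sqnorm mulr_sumr; apply: eq_bigr => i _; rewrite mxE exprMn. Qed.

Lemma quadE n (M : 'M[R]_n) v : quad M v = \sum_i \sum_j M i j * (v i 0 * v j 0).
Proof.
rewrite /quad -mulmxA mxE; apply: eq_bigr => i _; rewrite !mxE mulr_sumr.
by apply: eq_bigr => j _; rewrite mulrCA.
Qed.

Lemma quadZ n (M : 'M[R]_n) k v : quad M (k *: v) = k ^+ 2 * quad M v.
Proof.
rewrite /quad (_ : (k *: v)^T = k *: v^T); last by apply/matrixP => i j; rewrite !mxE.
by rewrite -!scalemxAl -scalemxAr !mxE expr2 mulrA.
Qed.

Lemma quad_gram m n (A : 'M[R]_(m, n)) v : quad (A^T *m A) v = sqnorm (A *m v).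
Proof. rewrite /quad sqnormE trmx_mul !mulmxA. by []. Qed.

Lemma quad_le n (M : 'M[R]_n) : exists2 c, 0 < c & forall v, quad M v <= c * sqnorm v.
Proof.
exists (1 + \sum_i \sum_j `|M i j|).
  by rewrite ltr_wpDr//; do 2 (apply: sumr_ge0 => ? _).
move=> v; rewrite quadE mulrDl mul1r -[leLHS]add0r lerD ?sqnorm_ge0// mulr_suml.
apply: ler_sum => i _; rewrite mulr_suml; apply: ler_sum => j _.
apply: le_trans (ler_norm _) _; rewrite normrM ler_wpM2l//.
have vi k : v k 0 ^+ 2 <= sqnorm v.
  by rewrite /sqnorm (bigD1 k)//= lerDl sumr_ge0// => l _; exact: sqr_ge0.
have := vi i; have := vi j; rewrite normrM -(real_normK (num_real (v i 0))) -(real_normK (num_real (v j 0))).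
by move: (`|v i 0|) (`|v j 0|) => a b; have := sqr_ge0 (a - b); nra.
Qed.

Lemma quadB n (M : 'M[R]_n) (u v : 'cV[R]_n) (t : R) : M^T = M ->
  quad M (u - t *: v) = quad M u - 2 * t * (v^T *m (M *m u)) 0 0 + t ^+ 2 * quad M v.
Proof.
move=> sM; rewrite /quad (_ : (u - t *: v)^T = u^T - t *: v^T); last first.
  by apply/matrixP => i j; rewrite !mxE.
rewrite !mulmxBl !mulmxBr -!scalemxAl -!scalemxAr.
have e : (u^T *m M *m v) 0 0 = (v^T *m (M *m u)) 0 0.
  transitivity ((v^T *m (M *m u))^T 0 0); last by rewrite [LHS]mxE.
  by rewrite !trmx_mul trmxK sM.
rewrite !(mx11B, mx11Z) e mulmxA; ring.
Qed.

(** Positivity at v - c^-1 N v, with [c] an upper bound of the form, yields |N v|^2 <= c quad N v,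
    and the inverse of N bounds |v| by |N v|. *)
Lemma unitmx_quad_coercive n (N : 'M[R]_n) : N^T = N -> N \in unitmx ->
  (forall v, 0 <= quad N v) -> exists2 d, 0 < d & forall v, d * sqnorm v <= quad N v.
Proof.
move=> sN uN pN; have [c c0 hc] := quad_le N.
have [k k0 hk] := quad_le ((invmx N)^T *m invmx N).
have h v : sqnorm (N *m v) <= c * quad N v.
  have := pN (v - c^-1 *: (N *m v)); rewrite quadB// -sqnormE.
  have := hc (N *m v) => h1 h2.
  have h3 : c^-1 ^+ 2 * quad N (N *m v) <= c^-1 * sqnorm (N *m v).
    rewrite expr2 -mulrA ler_wpM2l ?invr_ge0 ?(ltW c0)//.
    by rewrite mulrC ler_pdivrMr// mulrC.
  rewrite -ler_pdivrMl//; move: h2 h3; set s := sqnorm _; set q := quad N v.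
  by move: (quad N _) => w; lra.
exists (k * c)^-1; first by rewrite invr_gt0 mulr_gt0.
move=> v; rewrite mulrC ler_pdivrMr ?mulr_gt0//.
have := hk (N *m v); rewrite quad_gram mulKmx// => h1.
apply: le_trans h1 _; rewrite [leRHS]mulrCA ler_pM2l// mulrC; exact: h.
Qed.

(** Take for [a] the infimum of the form on the unit sphere. M - a is positive semidefinite; if it
    were invertible it would be coercive, and the infimum would be larger than [a]. Whether the
    infimum is attained does not matter for this argument. *)
Lemma rayleigh n (M : 'M[R]_n) : (0 < n)%N -> M^T = M -> (forall v, 0 <= quad M v) ->
  exists2 a, eigenvalue M a & forall v, a * sqnorm v <= quad M v.
Proof.
move=> n0 sM pM.
pose S := [set quad M v | v in [set v | sqnorm v = 1]].
have S0 : S !=set0.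
  exists (quad M (delta_mx (Ordinal n0) 0)); exists (delta_mx (Ordinal n0) 0) => //=.
  rewrite /sqnorm (bigD1 (Ordinal n0))//= mxE !eqxx expr1n big1 ?addr0// => i i0.
  by rewrite mxE (negbTE i0) expr0n.
have Slb : has_lbound S by exists 0 => _ [v _ <-]; exact: pM.
have hS : has_inf S by split.
pose a := inf S.
have le1 v : sqnorm v = 1 -> a <= quad M v.
  by move=> v1; apply: ge_inf => //; exists v.
have scal v : v != 0 -> exists2 u, sqnorm u = 1 & quad M v = sqnorm v * quad M u.
  move=> v0; have sv : 0 < sqnorm v by rewrite lt_neqAle sqnorm_ge0 eq_sym sqnorm_eq0 v0.
  exists ((Num.sqrt (sqnorm v))^-1 *: v).
    by rewrite sqnormZ exprVn sqr_sqrtr ?(ltW sv)// mulVf// gt_eqF.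
  by rewrite quadZ exprVn sqr_sqrtr ?(ltW sv)// mulrA divff ?mul1r// gt_eqF.
have le v : a * sqnorm v <= quad M v.
  have [->|v0] := eqVneq v 0.
    rewrite (_ : sqnorm 0 = 0) ?mulr0//; apply/eqP; by rewrite sqnorm_eq0.
  have [u u1 ->] := scal v v0; rewrite mulrC ler_wpM2l ?sqnorm_ge0//; exact: le1.
exists a => //.
pose N := M - a%:M.
have qN v : quad N v = quad M v - a * sqnorm v.
  by rewrite /quad /N mulmxBr mulmxBl mul_mx_scalar -scalemxAl sqnormE mx11B mx11Z.
rewrite /eigenvalue /eigenspace kermx_eq0 row_free_unit -/N.
apply/negP => uN.
have sN : N^T = N by rewrite /N linearB/= sM tr_scalar_mx.
have [|d d0 hd] := unitmx_quad_coercive sN uN.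
  by move=> v; rewrite qN subr_ge0.
have [_ [v v1 <-] hv] := inf_adherent d0 hS.
by have := hd v; rewrite qN v1 !mulr1 -/a; move: hv; rewrite -/a; lra.
Qed.

Section Gram.
Variables (L K : nat) (A : 'M[R]_(L, K)).
Hypothesis K0 : (0 < K)%N.

Let gram_sym : (A^T *m A)^T = A^T *m A. Proof. by rewrite trmx_mul trmxK. Qed.
Let gram_ge0 v : 0 <= quad (A^T *m A) v. Proof. by rewrite quad_gram sqnorm_ge0. Qed.

Lemma eigenvalue_gram a : eigenvalue (A^T *m A) a ->
  exists2 v, sqnorm v = 1 & sqnorm (A *m v) = a.
Proof.
move=> /eigenvalueP[u ua u0]; pose v := u^T.
have sv : 0 < sqnorm v by rewrite lt_neqAle sqnorm_ge0 eq_sym sqnorm_eq0 trmx_eq0 u0.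
have q : sqnorm (A *m v) = a * sqnorm v.
  rewrite -quad_gram /quad /v trmxK ua -scalemxAl mxE; congr (_ * _).
  by rewrite sqnormE trmxK.
exists ((Num.sqrt (sqnorm v))^-1 *: v).
  by rewrite sqnormZ exprVn sqr_sqrtr ?(ltW sv)// mulVf// gt_eqF.
by rewrite -scalemxAr sqnormZ q exprVn sqr_sqrtr ?(ltW sv)// mulrCA mulVf ?mulr1// gt_eqF.
Qed.

Let E := [set a : R | eigenvalue (A^T *m A) a].

Let E_lb : has_lbound E.
Proof. by exists 0 => a /eigenvalue_gram[v _ <-]; exact: sqnorm_ge0. Qed.

Lemma smin_sq_le v : smin_sq A * sqnorm v <= sqnorm (A *m v).
Proof.
have [a Ea ha] := rayleigh K0 gram_sym gram_ge0.
rewrite -quad_gram; apply: le_trans (ha v); rewrite ler_wpM2r ?sqnorm_ge0//.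
exact: ge_inf.
Qed.

Lemma smin_sq_lt c : smin_sq A < c -> exists2 v, sqnorm v = 1 & sqnorm (A *m v) < c.
Proof.
have [a Ea ha] := rayleigh K0 gram_sym gram_ge0.
have E0 : E !=set0 by exists a.
move=> /(inf_lt E0)[e Ee ec].
by have [v v1 vE] := eigenvalue_gram Ee; exists v => //; rewrite vE.
Qed.

(** [mp_pinv] is picked by [xget], so it satisfies the Penrose equations once some matrix does, and
    (A^T A)^-1 A^T is one. *)
Lemma mp_pinv_gram : A^T *m A \in unitmx ->
  [/\ A *m mp_pinv A *m A = A, mp_pinv A *m A *m mp_pinv A = mp_pinv A,
     (A *m mp_pinv A)^T = A *m mp_pinv A & (mp_pinv A *m A)^T = mp_pinv A *m A].
Proof.
move=> uA; pose B := invmx (A^T *m A) *m A^T.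
have BA : B *m A = 1%:M by rewrite /B -mulmxA mulVmx.
apply: (xgetPex 0 (P := [set B : 'M[R]_(K, L) | [/\ A *m B *m A = A, B *m A *m B = B,
   (A *m B)^T = A *m B & (B *m A)^T = B *m A]])).
exists B; split => //=.
- by rewrite -mulmxA BA mulmx1.
- by rewrite BA mul1mx.
- by rewrite /B !trmx_mul trmxK trmx_inv gram_sym mulmxA.
- by rewrite BA trmx1.
Qed.

(** The pseudoinverse B is a left inverse of A, so the coefficient error is B r, where r is the
    residual of the competitor [beta]; and A B r, a projection of r, is no longer than r. *)
Lemma least_squares_le y beta c : 0 < c -> c <= smin_sq A ->
  c * sqnorm (mp_pinv A *m y - beta) <= sqnorm (y - A *m beta).
Proof.
move=> c0 cs.
have uA : A^T *m A \in unitmx.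
  rewrite -row_free_unit -kermx_eq0; apply/negPn/negP => k0.
  have z : (0 : R)%:M = 0 :> 'M[R]_K by apply/matrixP => i j; rewrite !mxE mul0rn.
  have [|v v1 v0] := @eigenvalue_gram 0; first by rewrite /eigenvalue /eigenspace z subr0.
  have := smin_sq_le v; rewrite v0 v1 mulr1; lra.
have [AB BAB sAB sBA] := mp_pinv_gram uA; set B := mp_pinv A in AB BAB sAB sBA *.
have BA : B *m A = 1%:M.
  have e : A^T *m A *m (B *m A) = A^T *m A *m 1%:M.
    by rewrite mulmx1 -mulmxA (mulmxA A B A) AB.
  by have := congr1 (mulmx (invmx (A^T *m A))) e; rewrite !mulKmx.
set r := y - A *m beta.
have -> : B *m y - beta = B *m r by rewrite mulmxBr mulmxA BA mul1mx.
apply: (@le_trans _ _ (smin_sq A * sqnorm (B *m r))); first by rewrite ler_wpM2r ?sqnorm_ge0.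
apply: le_trans (smin_sq_le _) _.
(* A *m B is an orthogonal projection. *)
pose P := A *m B.
have PP : P *m P = P by rewrite /P mulmxA AB.
have sP : P^T = P by exact: sAB.
rewrite mulmxA -/P; clearbody P r.
have e : (P *m r)^T *m r = r^T *m P *m r by rewrite trmx_mul sP.
have e' : (P *m r)^T *m (P *m r) = r^T *m P *m r.
  by rewrite trmx_mul sP !mulmxA -(mulmxA r^T P P) PP.
have E2 : sqnorm (r - P *m r) = sqnorm r - sqnorm (P *m r).
  rewrite 3!sqnormE (_ : (r - P *m r)^T = r^T - (P *m r)^T); last first.
    by apply/matrixP => i j; rewrite !mxE.
  by rewrite mulmxBl !mulmxBr e e' mulmxA !mx11B subrr subr0.
by rewrite -subr_ge0 -E2 sqnorm_ge0.
Qed.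

End Gram.
End LeastSquares.

(** * Integration over independent samples *)

Section Blocks.
Context {R : realType}.
Implicit Types (bs : seq (seq (R -> R))) (F G : seq (seq R) -> \bar R).

Definition blocks_supp bs (vs : seq (seq R)) : bool :=
  all2 (fun b v => (size v == size b) && all2 (fun (d : R -> R) x => d x != 0) b v) bs vs.

Lemma iblocks_ge0 bs F : List.Forall (List.Forall density) bs ->
  (forall vs, 0 <= F vs)%E -> (0 <= iblocks bs F)%E.
Proof.
elim: bs F => [|b bs IH] F /=; first by move=> _; exact.
move=> /List.Forall_cons_iff[db dbs] F0; apply: iint_ge0 => // v _.
by apply: IH => // vs; exact: F0.
Qed.

Lemma le_iblocks bs F G : List.Forall (List.Forall density) bs ->
  (forall vs, 0 <= F vs)%E ->
  (forall vs, blocks_supp bs vs -> (F vs <= G vs)%E) ->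
  (iblocks bs F <= iblocks bs G)%E.
Proof.
elim: bs F G => [|b bs IH] F G /=; first by move=> _ _; exact.
move=> /List.Forall_cons_iff[db dbs] F0 FG; apply: le_iint_supp => // [v _|v sv bv].
  by apply: iblocks_ge0 => // vs; exact: F0.
by apply: IH => // vs bvs; apply: FG; rewrite /= sv eqxx bv.
Qed.

(** The blocks are independent, so the mean of a product with one factor per block is the product of
    the means. The majorant of the error is brought into this form. *)
Lemma iblocks_sum_prod bs (T : Type) (ts : seq T) (c : T -> R)
    (phi : T -> nat -> seq R -> R) :
  List.Forall (List.Forall light_density) bs ->
  (forall t m, tame (size (nth [::] bs m)) (phi t m)) ->
  (forall t, 0 <= c t) -> (forall t m v, 0 <= phi t m v) ->
  iblocks bs (fun vs => (\sum_(t <- ts) c t *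
     \prod_(m < size bs) phi t m (nth [::] vs m))%:E) =
  (\sum_(t <- ts) c t * \prod_(m < size bs) rint (nth [::] bs m) (phi t m))%:E.
Proof.
elim: bs c phi => [|b bs IH] c phi /=.
  by move=> *; congr EFin; apply: eq_bigr => t _; rewrite !big_ord0.
move=> /List.Forall_cons_iff[db dbs] tphi c0 phi0.
pose P t := \prod_(m < size bs) rint (nth [::] bs m) (phi t m.+1).
transitivity (iint b (fun v => (\sum_(t <- ts) (c t * P t) * phi t 0%N v)%:E)).
  apply: eq_iint => v _.
  have := IH (fun t => c t * phi t 0%N v) (fun t m => phi t m.+1) dbs.
  move=> /(_ (fun t m => tphi t m.+1)) /(_ (fun t => mulr_ge0 (c0 t) (phi0 t 0%N v))).
  move=> /(_ (fun t m => phi0 t m.+1)) h.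
  transitivity (iblocks bs (fun vs => (\sum_(t <- ts) c t * phi t 0%N v *
     \prod_(m < size bs) phi t m.+1 (nth [::] vs m))%:E)).
    congr iblocks; apply/funext => vs; congr EFin; apply: eq_bigr => t _.
    by rewrite big_ord_recl/= mulrA.
  by rewrite h; congr EFin; apply: eq_bigr => t _; rewrite mulrAC.
have tt t : tame (size b) (fun v => (c t * P t) * phi t 0%N v).
  by apply: tameZ; exact: (tphi t 0%N).
transitivity ((rint b (fun v => \sum_(t <- ts) (c t * P t) * phi t 0%N v))%:E).
  by apply: iint_rint => //; exact: tame_sum.
rewrite (@rint_sum R b T ts (fun t v => (c t * P t) * phi t 0%N v))//; congr EFin.
apply: eq_bigr => t _; rewrite rintZ//; last exact: (tphi t 0%N).
by rewrite big_ord_recl/= -mulrA; congr (_ * _); rewrite mulrC.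
Qed.

Lemma nth_flatten_nseq (I S : Type) (F : I -> S) (s0 : S) (i0 : I) (s : seq I) (L m : nat) :
  (m < size s * L)%N ->
  nth s0 (flatten [seq nseq L (F i) | i <- s]) m = F (nth i0 s (m %/ L)).
Proof.
elim: s m => [|i s IH] m //=; rewrite mulSn => mL.
rewrite nth_cat size_nseq; case: ltnP => [ml|lm].
  by rewrite nth_nseq ml divn_small.
have L0 : (0 < L)%N by rewrite lt0n; apply/eqP => L0; move: mL; rewrite L0 muln0.
rewrite IH; last by rewrite ltn_subLR.
by rewrite -{2}(subnK lm) divnDr ?dvdnn// divnn L0 addn1.
Qed.

Lemma size_flatten_nseq (I S : Type) (F : I -> S) (s : seq I) (L : nat) :
  size (flatten [seq nseq L (F i) | i <- s]) = (size s * L)%N.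
Proof. by elim: s => //= i s IH; rewrite size_cat size_nseq IH mulSn. Qed.

Lemma prod_block (n L k : nat) (a : nat -> R) : (k < n)%N ->
  \prod_(m < n * L) (if (m %/ L == k)%N then a m else 1) = \prod_(l < L) a (k * L + l)%N.
Proof.
elim: n => [|n IH] //; rewrite ltnS => kn.
have -> : (n.+1 * L = n * L + L)%N by rewrite mulSn addnC.
have E (l : 'I_L) : ((n * L + l) %/ L = n)%N.
  have L0 : (0 < L)%N by apply: leq_trans (ltn_ord l).
  by rewrite divnMDl// divn_small// addn0.
rewrite big_split_ord/=; move: kn; rewrite leq_eqVlt => /orP[/eqP ->|kn].
  rewrite big1 ?mul1r; last first.
    move=> [m /= mnL] _; rewrite ltn_eqF//.
    have L0 : (0 < L)%N by rewrite lt0n; apply/eqP => L0; move: mnL; rewrite L0 muln0.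
    by rewrite ltn_divLR.
  by apply: eq_bigr => l _; rewrite E eqxx.
by rewrite IH// [X in _ * X]big1 ?mulr1// => l _; rewrite E gtn_eqF.
Qed.

Lemma expRN_le (x : R) : 0 <= x -> expR (- x) <= 1 - x + x ^+ 2 / 2.
Proof.
move=> x0; pose f := (fun t : R => 1 - t + t ^+ 2 / 2 - expR (- t)).
suff : f 0 <= f x by rewrite /f oppr0 expR0 expr0n/= mul0r; lra.
have df (t : R) : is_derive t 1 f (- 1 + t + expR (- t)).
  by apply: is_derive_eq; rewrite /GRing.scale/=; field.
apply: (@ger0_derive1_ndecr _ f 0 x) => //.
- by move=> t _; rewrite derive1E derive_val; have := expR_ge1Dx (- t); lra.
- apply: continuous_subspaceT => t.
  by apply/differentiable_continuous/derivable1_diffP; apply: ex_derive.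
Qed.

End Blocks.

(** * Uniform sampling in one cube and the Chernoff factor of one sample *)

Section CellSampling.
Context {R : realType}.
Local Notation phi := (@normal_pdf R 0 1).

(** Turns a family over ['I_D] into one over the natural numbers, the form that [rint_prod]
    takes. *)
Definition ord_ext (D : nat) (T : Type) (x0 : T) (F : 'I_D -> T) (n : nat) : T :=
  oapp F x0 (insub n).

Lemma ord_extE (D : nat) (T : Type) (x0 : T) (F : 'I_D -> T) (d : 'I_D) : ord_ext x0 F d = F d.
Proof. by rewrite /ord_ext valK. Qed.

Lemma map_enum_ord (D : nat) (T : Type) (x0 : T) (F : 'I_D -> T) :
  [seq F d | d <- enum 'I_D] = mkseq (ord_ext x0 F) D.
Proof.
rewrite /mkseq -val_enum_ord -map_comp; apply: eq_map => d /=.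
by rewrite ord_extE.
Qed.

Lemma all2_nth (T U : Type) (P : T -> U -> bool) x0 y0 s t n :
  all2 P s t -> (n < size s)%N -> P (nth x0 s n) (nth y0 t n).
Proof. by elim: s t n => [|x s IH] [|y t] [|n] //= /andP[Pxy st] //; exact: IH. Qed.

Lemma rint_nseq_normal1 n : rint (nseq n phi) (fun=> 1) = 1.
Proof.
elim: n => [|n IH]; first by rewrite /rint.
rewrite /rint /=; have := iint_rint (light_density_nseq_normal n) (tame_cst _ 1).
move=> hn; under eq_integral do rewrite hn IH mule1.
by rewrite integral_normal_pdf.
Qed.

(** Integrates out the Gaussian half of a sample when the integrand depends on its uniform half
    alone. *)
Lemma rint_cat_normal ds n f g : List.Forall light_density ds ->
  tame (size ds) g ->
  (forall v w, size v = size ds -> f (v ++ w) = g v) ->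
  rint (ds ++ nseq n phi) f = rint ds g.
Proof.
move=> lds tg fg; rewrite {1}/rint iint_cat; congr fine; apply: eq_iint => v sv.
transitivity ((rint (nseq n phi) (fun=> g v))%:E).
  rewrite -(iint_rint (light_density_nseq_normal n)); last exact: tame_cst.
  by apply: eq_iint => w _; rewrite fg.
rewrite -[g v]mulr1 (@rintZ R _ (fun=> 1)) ?rint_nseq_normal1//.
  exact: light_density_nseq_normal.
exact: tame_cst.
Qed.

Section Cell.
Variables (D : nat) (h : R) (i : 'I_D -> int).
Hypothesis h0 : 0 < h.

(** The affine map that takes the cube onto (-1, 1]^D. *)
Definition cell_coord (x : 'cV[R]_D) : 'cV[R]_D := (h / 2)^-1 *: (x - cube_center h i).

Definition cell_dens : seq (R -> R) :=
  [seq unif_pdf (h * (i d)%:~R) (h * ((i d)%:~R + 1)) | d <- enum 'I_D].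

Lemma cell_coordE x d : cell_coord x d 0 = (h / 2)^-1 * (x d 0 - h * ((i d)%:~R + 1 / 2)).
Proof. by rewrite !mxE. Qed.

Let ab (k : int) : h * k%:~R < h * (k%:~R + 1).
Proof. by rewrite ltr_pM2l// ltrDl. Qed.

Lemma light_cell_dens : List.Forall light_density cell_dens.
Proof.
rewrite /cell_dens; elim: (enum _) => [|d s IH]; constructor => //.
exact: light_density_unif.
Qed.

Lemma size_cell_dens : size cell_dens = D.
Proof. by rewrite size_map size_enum_ord. Qed.

(** In the coordinates of the cell, a uniform point of the cube has independent coordinates that are
    uniform on [-1, 1]. *)
Lemma rint_cell_prod (p : 'I_D -> {poly R}) :
  tame D (fun w => \prod_(d < D) (p d).[cell_coord (vec_of_seq D w) d 0]) /\
  rint cell_dens (fun w => \prod_(d < D) (p d).[cell_coord (vec_of_seq D w) d 0]) =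
  \prod_(d < D) mean_itv (-1) 1 (p d).
Proof.
pose ii := ord_ext (0 : int) i; pose pp := ord_ext (0 : {poly R}) p.
pose l (k : int) : {poly R} := (h / 2)^-1 *: ('X - (h * (k%:~R + 1 / 2))%:P).
pose dd n := unif_pdf (h * (ii n)%:~R) (h * ((ii n)%:~R + 1)).
pose g n x := (pp n \Po l (ii n)).[x].
have [||| tP rP] := @rint_prod R D dd g.
- by move=> n; exact: light_density_unif.
- by move=> n; apply: continuous_measurable_fun; exact: continuous_horner.
- by move=> n; apply: horner_le_expR; rewrite invr_gt0.
have E w : \prod_(d < D) (p d).[cell_coord (vec_of_seq D w) d 0] = \prod_(d < D) g d (nth 0 w d).
  apply: eq_bigr => d _; rewrite /g /pp /ii !ord_extE horner_comp cell_coordE mxE.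
  by rewrite /l !hornerE.
have fE : (fun w => \prod_(d < D) (p d).[cell_coord (vec_of_seq D w) d 0]) =
  (fun w => \prod_(d < D) g d (nth 0 w d)) by apply/funext.
rewrite fE; split => //.
rewrite /cell_dens (map_enum_ord (unif_pdf 0 1)).
transitivity (rint (mkseq dd D) (fun v => \prod_(d < D) g d (nth 0 v d))).
  congr (rint _ _); apply/eq_in_map => n; rewrite mem_iota add0n => /andP[_ nD].
  by rewrite /dd /ii -[n]/(val (Ordinal nD)) !ord_extE.
rewrite rP; apply: eq_bigr => d _.
rewrite -(mean_itv_affine (p d) (ab (i d))) /mean_itv /rint/=; congr fine.
apply: eq_integral => x _; rewrite -EFinM /dd /g /pp /ii !ord_extE; congr (_ * _)%:E.
congr (_ \Po _).[x]; rewrite /l; congr (_^-1 *: ('X - _%:P)); by field.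
Qed.

Lemma pj_cellE (j : 'I_D -> nat) w : pj j (cell_coord (vec_of_seq D w)) =
  \prod_(d < D) (Num.sqrt ((2 * j d + 1)%:R) *: legendre (j d)).[cell_coord (vec_of_seq D w) d 0].
Proof. by apply: eq_bigr => d _; rewrite [RHS]hornerZ. Qed.

Variable Q : nat.
Local Notation K := (nK D Q).
Local Notation eta k u := (pj (@jnth D Q k) u).

Lemma jnth_inj (k k' : 'I_K) : (forall d, @jnth D Q k d = jnth Q k' d) -> k = k'.
Proof.
move=> kk; apply/val_inj/eqP; rewrite /= -(nth_uniq [ffun=> ord0] (ltn_ord k) (ltn_ord k')).
  by apply/eqP/ffunP => d; apply: val_inj; exact: kk.
by rewrite filter_uniq// enum_uniq.
Qed.

Lemma pj_orthonormal (k k' : 'I_K) :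
  tame D (fun w => eta k (cell_coord (vec_of_seq D w)) * eta k' (cell_coord (vec_of_seq D w))) /\
  rint cell_dens (fun w => eta k (cell_coord (vec_of_seq D w)) * eta k' (cell_coord (vec_of_seq D w)))
  = (k == k')%:R.
Proof.
pose s (n : nat) : R := Num.sqrt ((2 * n + 1)%:R).
have s2 n : s n ^+ 2 = (2 * n + 1)%:R by rewrite sqr_sqrtr.
pose p d : {poly R} := (s (@jnth D Q k d) *: legendre (@jnth D Q k d)) *
  (s (@jnth D Q k' d) *: legendre (@jnth D Q k' d)).
have fE : (fun w => eta k (cell_coord (vec_of_seq D w)) * eta k' (cell_coord (vec_of_seq D w))) =
    (fun w => \prod_(d < D) (p d).[cell_coord (vec_of_seq D w) d 0]).
  apply/funext => w; rewrite !pj_cellE -big_split/=; apply: eq_bigr => d _.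
  by rewrite hornerM.
rewrite fE; have [tp ->] := rint_cell_prod p; split => //.
have E d : mean_itv (-1) 1 (p d) = (@jnth D Q k d == @jnth D Q k' d)%:R.
  rewrite /p -scalerAl -scalerAr scalerA mean_itvZ ?(lt_trans (ltrN10 _))// mean_legendre.
  case: eqP => [->|_]; last by rewrite mul0r mulr0.
  by rewrite -expr2 s2 mul1r divff// pnatr_eq0 addn1.
rewrite (eq_bigr _ (fun d _ => E d)).
have [<-|kk'] := eqVneq k k'; first by rewrite big1// => d _; rewrite eqxx.
have [d dk] : exists d, @jnth D Q k d != @jnth D Q k' d.
  apply/existsP; apply: contraNT kk'; rewrite negb_exists => /forallP kk.
  by apply/eqP/jnth_inj => d; apply/eqP; have := kk d; rewrite negbK.
by rewrite (bigD1 d)//= (negbTE dk) mul0r.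
Qed.

(** The constant m of the Chernoff bound; [cstar] is 2/3 + 8/3 m. *)
Definition legendre_mass : R := \sum_(j <- mis D Q) \prod_(d < D) ((2 * (j d : nat) + 1)%:R : R).

Lemma legendre_massE : legendre_mass = \sum_(k < K) \prod_(d < D) (2 * @jnth D Q k d + 1)%:R.
Proof. by rewrite /legendre_mass (big_nth [ffun=> ord0]) big_mkord. Qed.

Lemma pj_sqr_le (j : 'I_D -> nat) (u : 'cV[R]_D) : (forall d, -1 <= u d 0 <= 1) ->
  pj j u ^+ 2 <= \prod_(d < D) (2 * j d + 1)%:R.
Proof.
move=> u1; rewrite /pj -prodrXl; apply: ler_prod => d _; rewrite sqr_ge0/=.
rewrite exprMn sqr_sqrtr// ler_piMr// -real_normK ?num_real// expr_le1//.
exact: legendre_le1.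
Qed.

(** Cauchy-Schwarz for a unit vector: |e - S v|^2 is nonnegative and equals |e|^2 - S^2. *)
Lemma sqr_sum_le (n : nat) (v : 'cV[R]_n) (e : 'I_n -> R) : sqnorm v = 1 ->
  (\sum_k v k 0 * e k) ^+ 2 <= \sum_k e k ^+ 2.
Proof.
move=> v1; set S := \sum_k v k 0 * e k.
have : 0 <= \sum_k (e k - S * v k 0) ^+ 2 by apply: sumr_ge0 => k _; exact: sqr_ge0.
have -> : \sum_k (e k - S * v k 0) ^+ 2 = \sum_k e k ^+ 2 - S ^+ 2.
  rewrite (eq_bigr (fun k => e k ^+ 2 + ((- 2 * S) * (v k 0 * e k) + S ^+ 2 * v k 0 ^+ 2))).
    by rewrite big_split/= big_split/= -!mulr_sumr -/S -/(sqnorm v) v1; ring.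
  by move=> k _; ring.
by rewrite subr_ge0.
Qed.

Lemma sum_pj_sqr_le (v : 'cV[R]_K) (u : 'cV[R]_D) : sqnorm v = 1 ->
  (forall d, -1 <= u d 0 <= 1) ->
  (\sum_k v k 0 * eta k u) ^+ 2 <= legendre_mass.
Proof.
move=> v1 u1; apply: le_trans (sqr_sum_le _ v1) _; rewrite legendre_massE.
by apply: ler_sum => k _; exact: pj_sqr_le.
Qed.

Lemma cell_dens_supp w : size w = D -> all2 (fun (d : R -> R) x => d x != 0) cell_dens w ->
  cube h i (vec_of_seq D w).
Proof.
move=> sw; rewrite /cell_dens (map_enum_ord (unif_pdf 0 1)) => hw d; rewrite mxE.
have : forall n, (n < D)%N -> ord_ext (unif_pdf 0 1)
    (fun d => unif_pdf (h * (i d)%:~R) (h * ((i d)%:~R + 1))) n (nth 0 w n) != 0.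
  move=> n nD; have := all2_nth (fun=> 0) 0 hw (n := n).
  by rewrite size_mkseq nth_mkseq//; exact.
move=> /(_ _ (ltn_ord d)); rewrite ord_extE /unif_pdf.
by case: ifP => // _; rewrite eqxx.
Qed.

Lemma cube_cell_coord x : cube h i x -> forall d, -1 <= cell_coord x d 0 <= 1.
Proof.
move=> cx d; have /andP[x1 x2] := cx d; rewrite cell_coordE.
have h20 : 0 < h / 2 by lra.
rewrite mulrC ler_pdivlMr// ler_pdivrMr//; apply/andP; split; lra.
Qed.

(* [expR (-x) <= 1 - x + x^2/2] applied to [x = s Z] with [0 <= Z <= m] and [E Z = 1]. *)
Lemma rint_cell_exp (v : 'cV[R]_K) (s : R) : sqnorm v = 1 -> 0 <= s ->
  s * legendre_mass <= 2 ->
  tame D (fun w => expR (- (s * (\sum_k v k 0 * eta k (cell_coord (vec_of_seq D w))) ^+ 2))) /\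
  rint cell_dens (fun w => expR (- (s * (\sum_k v k 0 * eta k (cell_coord (vec_of_seq D w))) ^+ 2)))
  <= expR (- (s - s ^+ 2 * legendre_mass / 2)).
Proof.
move=> v1 s0 sm.
set Z := fun w => (\sum_k v k 0 * eta k (cell_coord (vec_of_seq D w))) ^+ 2.
have ZE : Z = (fun w => \sum_k \sum_k' (v k 0 * v k' 0) *
    (eta k (cell_coord (vec_of_seq D w)) * eta k' (cell_coord (vec_of_seq D w)))).
  apply/funext => w; rewrite /Z expr2 mulr_suml; apply: eq_bigr => k _.
  by rewrite mulr_sumr; apply: eq_bigr => k' _; rewrite mulrACA.
have tt (k k' : 'I_K) : tame D (fun w => (v k 0 * v k' 0) *
    (eta k (cell_coord (vec_of_seq D w)) * eta k' (cell_coord (vec_of_seq D w)))).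
  by apply: tameZ; exact: (pj_orthonormal k k').1.
have tZ : tame D Z.
  by rewrite ZE; apply: tame_sum => k; apply: tame_sum => k'; exact: tt.
have Z0 w : 0 <= Z w by exact: sqr_ge0.
have EZ : rint cell_dens Z = 1.
  rewrite ZE (@rint_sum _ _ _ _ (fun k w => \sum_k' (v k 0 * v k' 0) *
    (eta k (cell_coord (vec_of_seq D w)) * eta k' (cell_coord (vec_of_seq D w))))); last 2 first.
  - exact: light_cell_dens.
  - by move=> k; rewrite size_cell_dens; apply: tame_sum => k'; exact: tt.
  rewrite -v1; apply: eq_bigr => k _.
  rewrite (@rint_sum _ _ _ _ (fun k' w => (v k 0 * v k' 0) *
    (eta k (cell_coord (vec_of_seq D w)) * eta k' (cell_coord (vec_of_seq D w))))); last 2 first.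
  - exact: light_cell_dens.
  - by move=> k'; rewrite size_cell_dens; exact: tt.
  have F k' : rint cell_dens (fun w => (v k 0 * v k' 0) *
    (eta k (cell_coord (vec_of_seq D w)) * eta k' (cell_coord (vec_of_seq D w)))) =
    (v k 0 * v k' 0) * (k == k')%:R.
    rewrite (@rintZ _ _ (fun w => eta k (cell_coord (vec_of_seq D w)) * eta k' (cell_coord (vec_of_seq D w)))) ?(pj_orthonormal k k').2//.
      exact: light_cell_dens.
    by rewrite size_cell_dens; exact: (pj_orthonormal k k').1.
  rewrite (eq_bigr _ (fun k' _ => F k')) (bigD1 k)//= eqxx mulr1 big1 ?addr0 ?expr2//.
  by move=> k' kk'; rewrite eq_sym (negbTE kk') mulr0.
set q := fun w => expR (- (s * Z w)).
have tq : tame D q.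
  split.
    apply: (rseq_measurable_comp (h := fun x => expR (- (s * x)))); last exact: tZ.1.
    by apply: measurableT_comp => //; apply: measurableT_comp => //; exact: measurable_funM.
  exists 1 => // w _; rewrite ger0_norm ?expR_ge0// mul1r.
  apply: (@le_trans _ _ 1); last by apply: gauss_weight_ge1; rewrite invr_ge0.
  by rewrite -[leRHS]expR0 ler_expR oppr_le0 mulr_ge0.
split => //.
set kappa := s - s ^+ 2 * legendre_mass / 2.
have k0 : 0 <= kappa.
  have -> : kappa = s * (2 - s * legendre_mass) / 2 by rewrite /kappa; field.
  by rewrite divr_ge0// mulr_ge0// subr_ge0.
(* Because Z has mean 1 and 1 - kappa <= exp(-kappa), the claim reduces to one that is linear in the
   integrand and can be checked pointwise. *)
suff : rint cell_dens q + kappa * rint cell_dens Z <= 1.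
  by rewrite EZ mulr1; have := expR_ge1Dx (- kappa); lra.
have r1 : rint cell_dens (fun=> 1) = 1.
  have [_] := rint_cell_prod (fun=> 1).
  rewrite (_ : (fun _ => \prod_(d < D) _) = fun=> 1); last first.
    by apply/funext => w; rewrite big1// => d _; rewrite hornerC.
  move=> ->; rewrite big1// => d _.
  transitivity (mean_itv (-1) 1 (('X : {poly R})^`())); first by rewrite derivX.
  rewrite mean_itvE ?(lt_trans (ltrN10 _))// !hornerX divff// opprK.
rewrite -rintZ; [|exact: light_cell_dens|by rewrite size_cell_dens].
rewrite -rintD; [|exact: light_cell_dens|by rewrite size_cell_dens|by rewrite size_cell_dens; exact: tameZ].
rewrite -[leRHS]r1 -lee_fin -!iint_rint; last 4 first.
- exact: light_cell_dens.
- exact: tame_cst.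
- exact: light_cell_dens.
- by rewrite size_cell_dens; apply: tameD => //; exact: tameZ.
apply: le_iint_supp.
- exact/light_density_density/light_cell_dens.
- by move=> w _; rewrite lee_fin addr_ge0 ?expR_ge0// mulr_ge0.
rewrite size_cell_dens => w sw supp; rewrite lee_fin.
(* This bound needs the point to lie in the cube, so only the support of the density is
   considered. *)
have Zm : Z w <= legendre_mass.
  by apply: sum_pj_sqr_le => //; apply: cube_cell_coord; exact: cell_dens_supp.
have := expRN_le (mulr_ge0 s0 (Z0 w)); rewrite /q /kappa.
move: (Z w) (Z0 w) Zm => z z0 zm; move: (expR _) => e he.
(* That is z^2 <= m z, which makes the quadratic term of the exponential bound linear in z. *)
have : s ^+ 2 * (z * (legendre_mass - z)) >= 0.
  by rewrite mulr_ge0 ?sqr_ge0// mulr_ge0// subr_ge0.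
nra.
Qed.

End Cell.
End CellSampling.

(** * Gaussian expectations of functions of a vector and the bound on the target *)

Section GaussExpectation.
Context {R : realType} {D : nat}.
Local Notation phi := (@normal_pdf R 0 1).
Local Notation vec := (@vec_of_seq R D).
Implicit Types (z a : 'cV[R]_D) (S : 'M[R]_D) (v : seq R).

Lemma gaussE_rint (F : 'cV[R]_D -> R) : gaussE F = rint (nseq D phi) (fun v => F (vec v)).
Proof. by []. Qed.

Let light := light_density_nseq_normal (R := R) D.

Definition vweight (r : R) z : R := \prod_(d < D) expR (r * z d 0 ^+ 2).

Lemma gauss_weight_vec r v : size v = D -> gauss_weight r v = vweight r (vec v).
Proof.
move=> sv; rewrite /gauss_weight (big_nth 0) sv big_mkord.
by apply: eq_bigr => d _; rewrite mxE.
Qed.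

Lemma vweight_ge0 r z : 0 <= vweight r z.
Proof. by apply: prodr_ge0 => d _; exact: expR_ge0. Qed.

Lemma vweightM r s z : vweight r z * vweight s z = vweight (r + s) z.
Proof. by rewrite /vweight -big_split/=; apply: eq_bigr => d _; rewrite -expRD mulrDl. Qed.

Lemma vweight_le r s z : r <= s -> vweight r z <= vweight s z.
Proof.
move=> rs; apply: ler_prod => d _; rewrite expR_ge0/= ler_expR.
by rewrite ler_wpM2r ?sqr_ge0.
Qed.

Lemma vweight_ge1 r z : 0 <= r -> 1 <= vweight r z.
Proof.
move=> r0; apply: le_trans (vweight_le _ r0).
by rewrite /vweight big1// => d _; rewrite mul0r expR0.
Qed.

Lemma expR_le_vweight r z d : 0 <= r -> expR (r * z d 0 ^+ 2) <= vweight r z.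
Proof.
move=> r0; rewrite /vweight (bigD1 d)//= ler_peMr ?expR_ge0//.
apply: (big_ind (fun x => 1 <= x)) => // [x y|e _]; first exact: mulr_ege1.
by rewrite -[leLHS]expR0 ler_expR mulr_ge0 ?sqr_ge0.
Qed.

Definition vtame (F : 'cV[R]_D -> R) : Prop := tame D (fun v => F (vec v)).
Definition vmeasurable (F : 'cV[R]_D -> R) : Prop := rseq_measurable D (fun v => F (vec v)).

Lemma vtame_bound F r (C : R) : vmeasurable F -> r <= 4^-1 -> 0 <= C ->
  (forall z, `|F z| <= C * vweight r z) -> vtame F.
Proof.
move=> mF r4 C0 FC; split => //; exists C => // v sv.
apply: le_trans (FC _) _; rewrite gauss_weight_vec// ler_wpM2l//; exact: vweight_le.
Qed.

Lemma vmeasurable_coord d : vmeasurable (fun z => z d 0).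
Proof.
rewrite /vmeasurable (_ : (fun _ => _) = fun v => nth 0 v d); last by apply/funext => v; rewrite mxE.
exact: rseq_measurable_nth.
Qed.

Lemma vmeasurable_continuous (g : 'cV[R]_D -> R) (V : 'cV[R]_D -> 'cV[R]_D) : continuous g ->
  (forall d, vmeasurable (fun z => V z d 0)) -> vmeasurable (fun z => g (V z)).
Proof.
move=> cg mV; rewrite /vmeasurable.
rewrite (_ : (fun _ => _) = fun v => g (\col_d (V (vec v) d 0))).
  by apply: (rseq_measurable_continuous (f := fun d v => V (vec v) d 0)).
by apply/funext => v; congr g; apply/colP => d; rewrite mxE.
Qed.

Lemma vmeasurable_affine a S (V : 'cV[R]_D -> 'cV[R]_D) :
  (forall d, vmeasurable (fun z => V z d 0)) ->
  forall d, vmeasurable (fun z => (a + S *m V z) d 0).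
Proof.
move=> mV d; rewrite /vmeasurable.
rewrite (_ : (fun _ => _) = fun v => a d 0 + \sum_e S d e * V (vec v) e 0).
  apply: rseq_measurableD; first exact: rseq_measurable_cst.
  apply: rseq_measurable_sum => e; apply: rseq_measurableM; first exact: rseq_measurable_cst.
  exact: mV.
by apply/funext => v; rewrite !mxE.
Qed.

Lemma vmeasurable_trunc r d : vmeasurable (fun z => truncv r z d 0).
Proof.
rewrite /vmeasurable (_ : (fun _ => _) = fun v => Num.max (Num.min (nth 0 v d) r) (- r)).
  apply: (rseq_measurable_comp (h := fun t => Num.max (Num.min t r) (- r))).
    by apply: measurable_maxr => //; apply: measurable_minr.
  exact: rseq_measurable_nth.
by apply/funext => v; rewrite !mxE.
Qed.

Lemma norm_trunc_le r z d : 0 <= r -> `|truncv r z d 0| <= `|z d 0|.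
Proof.
move=> r0; rewrite mxE; move: (z d 0) => t.
have l1 := ler_norm t; have l2 := ler_norm (- t); rewrite normrN in l2.
rewrite ler_norml le_max le_min ge_max ge_min; apply/andP; split.
  by apply/orP; left; apply/andP; split; lra.
by apply/andP; split; [apply/orP; left|]; lra.
Qed.

Lemma trunc_le r z d : 0 <= r -> `|truncv r z d 0| <= r.
Proof.
move=> r0; rewrite mxE; move: (z d 0) => t.
by rewrite ler_norml le_max lexx orbT/= ge_max ge_min lexx orbT/= (le_trans _ r0)// oppr_le0.
Qed.

Lemma truncv_id r z : (forall d, `|z d 0| <= r) -> truncv r z = z.
Proof.
move=> zr; apply/colP => d; rewrite mxE; have := zr d; rewrite ler_norml => /andP[h1 h2].
by rewrite (min_idPl h2) (max_idPl h1).
Qed.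

Lemma vweight_trunc r s z : 0 <= r -> 0 <= s -> vweight s (truncv r z) <= vweight s z.
Proof.
move=> r0 s0; apply: ler_prod => d _; rewrite expR_ge0/= ler_expR ler_wpM2l//.
rewrite -[leLHS]real_normK ?num_real// -[leRHS]real_normK ?num_real//.
by rewrite ler_sqr ?nnegrE// norm_trunc_le.
Qed.

(** The finite mean of exp(|z|^2/4), with which all Gaussian expectations are compared. *)
Definition gauss_const : R := rint (nseq D phi) (gauss_weight 4^-1).

Lemma vtame_vweight : vtame (vweight 4^-1).
Proof.
apply: (@vtame_bound _ 4^-1 1) => //; last first.
  by move=> z; rewrite mul1r ger0_norm// vweight_ge0.
apply: rseq_measurable_prod => d; apply: (rseq_measurable_comp (h := fun t => expR (4^-1 * t ^+ 2))).
  by apply: measurableT_comp => //; apply: measurable_funM => //; exact: measurable_funX.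
exact: vmeasurable_coord.
Qed.

Lemma gauss_const_ge0 : 0 <= gauss_const.
Proof.
apply: rint_ge0; first exact: light_density_density.
by move=> v _; exact: gauss_weight_ge0.
Qed.

Lemma gaussE_le F r (C : R) : vmeasurable F -> r <= 4^-1 -> 0 <= C ->
  (forall z, `|F z| <= C * vweight r z) -> `|gaussE F| <= C * gauss_const.
Proof.
move=> mF r4 C0 FC; have tF := vtame_bound mF r4 C0 FC.
have tw : tame D (fun v => C * vweight 4^-1 (vec v)) by apply: tameZ; exact: vtame_vweight.
rewrite gaussE_rint.
apply: le_trans (ler_norm_rint (g := fun v => C * vweight 4^-1 (vec v)) light _ _ _) _; rewrite ?size_nseq//.
  by move=> v sv; apply: le_trans (FC _) _; rewrite ler_wpM2l// vweight_le.
rewrite (@rintZ _ _ (fun v => vweight 4^-1 (vec v)))//; last by rewrite size_nseq; exact: vtame_vweight.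
rewrite le_eqVlt; apply/orP; left; apply/eqP; congr (_ * _); apply: eq_rint => v; rewrite size_nseq => sv.
by rewrite gauss_weight_vec.
Qed.

Lemma gaussED F G : vtame F -> vtame G -> gaussE (fun z => F z + G z) = gaussE F + gaussE G.
Proof. by move=> tF tG; rewrite !gaussE_rint (@rintD _ _ (fun v => F (vec v)) (fun v => G (vec v)))// size_nseq. Qed.

Lemma gaussEB F G : vtame F -> vtame G -> gaussE (fun z => F z - G z) = gaussE F - gaussE G.
Proof. by move=> tF tG; rewrite !gaussE_rint (@rintB _ _ (fun v => F (vec v)) (fun v => G (vec v)))// size_nseq. Qed.

Lemma gaussEZ c F : vtame F -> gaussE (fun z => c * F z) = c * gaussE F.
Proof. by move=> tF; rewrite !gaussE_rint (@rintZ _ _ (fun v => F (vec v)))// size_nseq. Qed.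

Lemma gaussE_sum (I : Type) (s : seq I) (F : I -> 'cV[R]_D -> R) : (forall i, vtame (F i)) ->
  gaussE (fun z => \sum_(i <- s) F i z) = \sum_(i <- s) gaussE (F i).
Proof. by move=> tF; rewrite !gaussE_rint (@rint_sum _ _ _ _ (fun i v => F i (vec v)))// size_nseq. Qed.

Definition l1norm z : R := \sum_(d < D) `|z d 0|.

Lemma l1norm_ge0 z : 0 <= l1norm z.
Proof. by apply: sumr_ge0. Qed.

Lemma l1norm_exp_le n (r : R) : 0 < r ->
  exists2 C, 0 <= C & forall z, l1norm z ^+ n <= C * vweight r z.
Proof.
(* The rate is shared among the [n] factors; [n.+1] avoids a division by 0. *)
move=> r0; pose s := r / n.+1%:R; have s0 : 0 < s by rewrite divr_gt0.
pose c := D%:R * (1 + s^-1); have c0 : 0 <= c by rewrite mulr_ge0// addr_ge0// invr_ge0 ltW.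
exists (c ^+ n); first exact: exprn_ge0.
move=> z; have h : l1norm z <= c * vweight s z.
  apply: le_trans (_ : \sum_(d < D) (1 + s^-1) * vweight s z <= _).
    apply: ler_sum => d _; apply: le_trans (norm_le_expR _ s0) _.
    by rewrite ler_wpM2l ?addr_ge0 ?invr_ge0 ?(ltW s0)// expR_le_vweight// ltW.
  by rewrite sumr_const card_ord -[leLHS]mulr_natl mulrA.
have h2 : l1norm z ^+ n <= (c * vweight s z) ^+ n.
  by apply: lerXn2r => //; rewrite nnegrE ?l1norm_ge0// mulr_ge0// vweight_ge0.
apply: le_trans h2 _; rewrite exprMn ler_wpM2l ?exprn_ge0//.
apply: (@le_trans _ _ (vweight (s * n%:R) z)); last first.
  apply: vweight_le; rewrite /s -mulrA ler_piMr ?(ltW r0)// mulrC.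
  by rewrite ler_pdivrMr// mul1r ler_nat.
rewrite /vweight -prodrXl; apply: ler_prod => d _; rewrite exprn_ge0 ?expR_ge0//=.
by rewrite -expRM_natr mulrAC.
Qed.

Variable iota : 'I_D -> nat.

Definition hermite_prod z : R := \prod_(d < D) hermite (iota d) (z d 0).

Lemma hermite_prodE z : hermite_prod z = \prod_(d < D) (hermite_poly (iota d)).[z d 0].
Proof. by apply: eq_bigr => d _; rewrite hermiteE. Qed.

Lemma hermite_miE Delta z : hermite_mi iota Delta z =
  powR Delta (- ((mi_norm iota)%:R / 2)) * hermite_prod z.
Proof. by []. Qed.

Lemma vmeasurable_hermite_prod (V : 'cV[R]_D -> 'cV[R]_D) :
  (forall d, vmeasurable (fun z => V z d 0)) -> vmeasurable (fun z => hermite_prod (V z)).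
Proof.
move=> mV; rewrite /vmeasurable.
rewrite (_ : (fun _ => _) = fun v => \prod_(d < D) (hermite_poly (iota d)).[V (vec v) d 0]).
  apply: rseq_measurable_prod => d; apply: (rseq_measurable_comp (h := horner _)); last exact: mV.
  by apply: continuous_measurable_fun; exact: continuous_horner.
by apply/funext => v; rewrite hermite_prodE.
Qed.

(** The rate 1/16 leaves room below the rate 1/4 of [tame] for a second factor: 1/16 once more in
    [target_bound], 1/6 in [trunc_error]. *)
Lemma hermite_prod_le : exists2 C, 0 <= C & forall z, `|hermite_prod z| <= C * vweight 16^-1 z.
Proof.
have /choice[C hC] : forall d : 'I_D, exists C, 0 <= C /\ forall x,
    `|(hermite_poly (iota d)).[x]| <= C * expR (16^-1 * x ^+ 2) :> R.
  move=> d; have [|C C0 h] := @horner_le_expR R (hermite_poly (iota d)) 16^-1.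
    by rewrite invr_gt0.
  by exists C.
exists (\prod_(d < D) C d); first by apply: prodr_ge0 => d _; have [] := hC d.
move=> z; rewrite hermite_prodE normr_prod /vweight -big_split/=.
by apply: ler_prod => d _; rewrite normr_ge0/=; have [_] := hC d; exact.
Qed.

(** A monomial of total degree below that of [iota] has some exponent [j d] below [iota d], and the
    integral over that coordinate vanishes. *)
Lemma hermite_prod_orthogonal p : polyfun (mi_norm iota) p ->
  vtame (fun z => hermite_prod z * p z) /\ gaussE (fun z => hermite_prod z * p z) = 0.
Proof.
elim=> [|c j jn|p1 p2 _ [t1 e1] _ [t2 e2]].
- rewrite (_ : (fun _ => _) = fun=> 0); last by apply/funext => z; rewrite mulr0.
  by split; [exact: tame_cst|rewrite gaussE_rint rint0].
- pose q d : {poly R} := hermite_poly (iota d) * 'X^(j d).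
  pose qq := ord_ext (0 : {poly R}) q.
  have [||| tP rP] := @rint_prod R D (fun=> phi) (fun n => horner (qq n)).
  + by move=> _; exact: light_density_normal.
  + by move=> n; apply: continuous_measurable_fun; exact: continuous_horner.
  + by move=> n; apply: horner_le_expR; rewrite invr_gt0.
  have E : (fun v => hermite_prod (vec v) * monomial j (vec v)) =
      (fun v => \prod_(d < D) (qq d).[nth 0 v d]).
    apply/funext => v; rewrite hermite_prodE /monomial -big_split/=.
    by apply: eq_bigr => d _; rewrite /qq ord_extE hornerM hornerXn mxE.
  have tm : vtame (fun z => hermite_prod z * monomial j z) by rewrite /vtame E.
  have zE : (fun z => hermite_prod z * (c * monomial j z)) =
      (fun z => c * (hermite_prod z * monomial j z)) by apply/funext => z; rewrite mulrCA.
  rewrite zE; split; first exact: tameZ.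
  rewrite gaussEZ// gaussE_rint E (_ : nseq D phi = mkseq (fun=> phi) D); last first.
    apply: (@eq_from_nth _ phi); rewrite ?size_nseq ?size_mkseq// => k kD.
    by rewrite nth_nseq kD nth_mkseq.
  rewrite rP; have [d jd] : exists d, (j d < iota d)%N.
    apply/existsP; apply: contraTT jn; rewrite negb_exists => /forallP h.
    by rewrite -leqNgt; apply: leq_sum => d _; rewrite leqNgt.
  rewrite (bigD1 d)//= -gauss_momentE /qq ord_extE hermite_orthogonal ?mul0r ?mulr0//.
  by rewrite size_polyXn.
- have zE : (fun z => hermite_prod z * (p1 z + p2 z)) =
      (fun z => hermite_prod z * p1 z + hermite_prod z * p2 z) by apply/funext => z; rewrite mulrDr.
  by rewrite zE; split; [exact: tameD|rewrite gaussED// e1 e2 addr0].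
Qed.

Definition linear_bound (c : R) S : Prop := forall z d, `|(S *m z) d 0| <= c * l1norm z.

Lemma CbM_bounded n M (y : 'cV[R]_D -> R) : CbM n M y -> continuous y /\ forall x, `|y x| <= M.
Proof. by case: n => [//|n] [cy [yM _]]. Qed.

(** After the Taylor polynomial is removed, the remainder is of order Delta^(n/2), which is exactly
    what the weight Delta^(-n/2) costs. The constant precedes [y], [a] and [S], so it serves all
    starting points at once. *)
Lemma target_bound (My c : R) : 0 <= My -> 0 <= c -> exists2 C, 0 <= C &
  forall (y : 'cV[R]_D -> R) a S (Delta : R), CbM (mi_norm iota) My y -> linear_bound c S ->
  0 < Delta ->
  `|gaussE (fun z => hermite_mi iota Delta z * y (a + Num.sqrt Delta *: (S *m z)))| <= C.
Proof.
move=> My0 c0; set n := mi_norm iota.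
have [CH CH0 hCH] := hermite_prod_le.
have [|Cl Cl0 hCl] := @l1norm_exp_le n 16^-1; first by rewrite invr_gt0.
pose B := CH * (D%:R ^+ n * My * c ^+ n * Cl).
have B0 : 0 <= B by rewrite !mulr_ge0// ?exprn_ge0.
exists (B * gauss_const); first by rewrite mulr_ge0// gauss_const_ge0.
move=> y a S Delta yM Sc D0; have [p hp py] := taylor_polyfun a yM.
set s := Num.sqrt Delta; have s0 : 0 < s by rewrite sqrtr_gt0.
have hp' : polyfun n (fun z => p (s *: (S *m z))).
  by apply: (polyfun_mulmx (p := fun x => p (s *: x))); exact: polyfun_scale.
have [tp ep] := hermite_prod_orthogonal hp'.
have mX : vmeasurable (fun z => y (a + s *: (S *m z))).
  apply: vmeasurable_continuous; first by have [] := CbM_bounded yM.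
  move=> d; rewrite (_ : (fun _ => _) = fun z => (a + (s *: S) *m z) d 0).
    by apply: vmeasurable_affine => e; exact: vmeasurable_coord.
  by apply/funext => z; rewrite -scalemxAl.
have y1 x : `|y x| <= My by have [_] := CbM_bounded yM; exact.
have mHy : vmeasurable (fun z => hermite_prod z * y (a + s *: (S *m z))).
  apply: (@rseq_measurableM R D (fun v => hermite_prod (vec v)) (fun v => y (a + s *: (S *m vec v)))) => //.
  by apply: (vmeasurable_hermite_prod (V := id)) => d; exact: vmeasurable_coord.
have tHy : vtame (fun z => hermite_prod z * y (a + s *: (S *m z))).
  apply: (@vtame_bound _ 16^-1 (CH * My)) => //; first by lra.
  - exact: mulr_ge0.
  - by move=> z; rewrite normrM mulrAC; apply: ler_pM.
pose F z := hermite_prod z * y (a + s *: (S *m z)) - hermite_prod z * p (s *: (S *m z)).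
have EF : gaussE (fun z => hermite_prod z * y (a + s *: (S *m z))) = gaussE F.
  by rewrite gaussEB// ep subr0.
have -> : (fun z => hermite_mi iota Delta z * y (a + s *: (S *m z))) =
    (fun z => powR Delta (- (n%:R / 2)) * (hermite_prod z * y (a + s *: (S *m z)))).
  by apply/funext => z; rewrite hermite_miE -mulrA.
rewrite gaussEZ// EF.
have FB z : `|F z| <= (B * s ^+ n) * vweight (8^-1) z.
  rewrite /F -mulrBr normrM.
  have h1 : `|y (a + s *: (S *m z)) - p (s *: (S *m z))| <= D%:R ^+ n * My * (s * (c * l1norm z)) ^+ n.
    apply: py => d; rewrite mxE normrM (ger0_norm (ltW s0)) ler_wpM2l ?(ltW s0)//; exact: Sc.
  have h2 : (s * (c * l1norm z)) ^+ n <= s ^+ n * (c ^+ n * (Cl * vweight 16^-1 z)).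
    rewrite !exprMn ler_wpM2l ?exprn_ge0 ?(ltW s0)// ler_wpM2l ?exprn_ge0//.
  apply: le_trans (ler_pM _ _ (hCH z) (le_trans h1 (ler_wpM2l _ h2))) _ => //.
    by rewrite mulr_ge0// exprn_ge0.
  rewrite (_ : 8^-1 = 16^-1 + 16^-1 :> R); last by field.
  rewrite -vweightM /B; move: (vweight _ _) => w.
  by rewrite le_eqVlt; apply/orP; left; apply/eqP; ring.
have mF : vmeasurable F.
  apply: rseq_measurableD => //; apply: (rseq_measurable_comp (h := -%R)) => //.
  exact: tp.1.
have := gaussE_le mF _ _ FB; rewrite normrM (ger0_norm (powR_ge0 _ _)) => /(_ _ _)h.
apply: le_trans (ler_wpM2l (powR_ge0 _ _) (h _ _)) _; [by lra|by rewrite mulr_ge0// exprn_ge0// ltW|].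
rewrite mulrA [X in X * _](_ : _ = B)//.
have -> : s ^+ n = powR Delta (n%:R / 2).
  by rewrite /s -powR12_sqrt ?(ltW D0)// -powR_mulrn ?powR_ge0// -powRrM mulrC.
by rewrite mulrCA -powRD; [rewrite addNr powRr0 mulr1|rewrite (gt_eqF D0) implybT].
Qed.

End GaussExpectation.

(** * Error of the fit in a single cube *)

Section LocalError.
Context {R : realType} {D : nat}.
Implicit Types (z a x u w : 'cV[R]_D) (S : 'M[R]_D).

(** With a = x + Delta b(x), S = sigma(x) and s = sqrt Delta this is the truncated Euler step from
    x. *)
Definition affine_trunc a S (s r : R) z : 'cV[R]_D := a + s *: (S *m truncv r z).

Lemma vmeasurable_affine_scale a S (s : R) (V : 'cV[R]_D -> 'cV[R]_D) :
  (forall d, vmeasurable (fun z => V z d 0)) ->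
  forall d, vmeasurable (fun z => (a + s *: (S *m V z)) d 0).
Proof.
move=> mV d; rewrite (_ : (fun _ => _) = fun z => (a + (s *: S) *m V z) d 0).
  exact: vmeasurable_affine.
by apply/funext => z; rewrite -scalemxAl.
Qed.

Lemma vmeasurable_affine_trunc a S (s r : R) d :
  vmeasurable (fun z => affine_trunc a S s r z d 0).
Proof.
apply: (@vmeasurable_affine_scale _ _ _ (truncv r)) => e.
exact: vmeasurable_trunc.
Qed.

Lemma vmeasurableM (F G : 'cV[R]_D -> R) : vmeasurable F -> vmeasurable G ->
  vmeasurable (fun z => F z * G z).
Proof. exact: rseq_measurableM. Qed.

Lemma vmeasurableB (F G : 'cV[R]_D -> R) : vmeasurable F -> vmeasurable G ->
  vmeasurable (fun z => F z - G z).
Proof.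
move=> mF mG; apply: rseq_measurableD => //.
exact: (rseq_measurable_comp (h := -%R)).
Qed.

Lemma vmeasurable_hermite_trunc iota (r : R) :
  vmeasurable (fun z => hermite_prod iota (truncv r z)).
Proof. by apply: vmeasurable_hermite_prod => d; exact: vmeasurable_trunc. Qed.

(** The integrands agree when no coordinate of z exceeds [r]. Otherwise exp(-r^2/6) exp(z_d^2/6) >=
    1 for some d, and this factor can be inserted because 1/16 + 1/6 stays below 1/4. *)
Lemma trunc_error (iota : 'I_D -> nat) (My : R) : 0 <= My -> exists2 C, 0 <= C &
  forall (y : 'cV[R]_D -> R) a S (Delta r : R), continuous y -> (forall x, `|y x| <= My) ->
  0 < Delta -> 0 <= r ->
  `|gaussE (fun z => hermite_mi iota Delta z * y (a + Num.sqrt Delta *: (S *m z))) -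
    gaussE (fun z => y (affine_trunc a S (Num.sqrt Delta) r z) * hermite_mi iota Delta (truncv r z))|
  <= C * powR Delta (- ((mi_norm iota)%:R / 2)) * expR (- (r ^+ 2 / 6)).
Proof.
move=> My0; have [CH CH0 hCH] := @hermite_prod_le R D iota.
exists (2 * My * CH * gauss_const (D := D)).
  by rewrite !mulr_ge0// gauss_const_ge0.
move=> y a S Delta r cy y1 D0 r0; set s := Num.sqrt Delta.
set P := powR Delta _; have P0 : 0 <= P by exact: powR_ge0.
pose F1 z := hermite_prod iota z * y (a + s *: (S *m z)).
pose F2 z := y (affine_trunc a S s r z) * hermite_prod iota (truncv r z).
have m1 : vmeasurable F1.
  apply: vmeasurableM.
    by apply: (@vmeasurable_hermite_prod _ _ _ id) => d; exact: vmeasurable_coord.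
  apply: vmeasurable_continuous => // d.
  by apply: (@vmeasurable_affine_scale _ _ _ (id)) => e; exact: vmeasurable_coord.
have m2 : vmeasurable F2.
  apply: vmeasurableM; last exact: vmeasurable_hermite_trunc.
  by apply: vmeasurable_continuous => // d; exact: vmeasurable_affine_trunc.
have b1 z : `|F1 z| <= CH * My * vweight 16^-1 z by rewrite normrM mulrAC; apply: ler_pM.
have b2 z : `|F2 z| <= CH * My * vweight 16^-1 z.
  rewrite normrM mulrC mulrAC; apply: ler_pM => //.
  apply: le_trans (hCH _) _; rewrite ler_wpM2l// vweight_trunc//.
have CM : 0 <= CH * My by exact: mulr_ge0.
have t1 : vtame F1 by apply: (vtame_bound m1 _ CM b1); lra.
have t2 : vtame F2 by apply: (vtame_bound m2 _ CM b2); lra.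
have -> : (fun z => hermite_mi iota Delta z * y (a + s *: (S *m z))) = (fun z => P * F1 z).
  by apply/funext => z; rewrite hermite_miE -mulrA.
have -> : (fun z => y (affine_trunc a S s r z) * hermite_mi iota Delta (truncv r z)) =
    (fun z => P * F2 z).
  by apply/funext => z; rewrite hermite_miE mulrCA.
rewrite !gaussEZ// -mulrBr -gaussEB// normrM (ger0_norm P0).
have FB z : `|F1 z - F2 z| <= (2 * My * CH * expR (- (r ^+ 2 / 6))) * vweight (16^-1 + 6^-1) z.
  have [/forallP zr|/forallPn[d]] := boolP [forall d, `|z d 0| <= r].
    rewrite /F1 /F2 /affine_trunc truncv_id// mulrC subrr normr0.
    by rewrite !mulr_ge0 ?vweight_ge0 ?expR_ge0.
  rewrite -ltNge => rz; apply: le_trans (ler_normB _ _) _.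
  apply: le_trans (lerD (b1 z) (b2 z)) _; rewrite -vweightM.
  have h : 1 <= expR (- (r ^+ 2 / 6)) * vweight 6^-1 z.
    apply: (@le_trans _ _ (expR (- (r ^+ 2 / 6)) * expR (6^-1 * z d 0 ^+ 2))).
      rewrite -expRD -[leLHS]expR0 ler_expR.
      have : r ^+ 2 <= z d 0 ^+ 2.
        by rewrite -[leRHS]real_normK ?num_real// ler_sqr ?nnegrE// ltW.
      lra.
    by rewrite ler_wpM2l ?expR_ge0// expR_le_vweight// invr_ge0.
  have w0 := vweight_ge0 16^-1 z.
  move: (vweight 16^-1 z) (vweight 6^-1 z) (expR (- (r ^+ 2 / 6))) w0 h => w1 w2 e w0 h.
  rewrite (_ : _ * (w1 * w2) = 2 * (CH * My * w1) * (e * w2)); last by ring.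
  have h3 : 0 <= CH * My * w1 by rewrite mulr_ge0.
  by nra.
have r4 : 16^-1 + 6^-1 <= 4^-1 :> R by lra.
have B0 : 0 <= 2 * My * CH * expR (- (r ^+ 2 / 6)) by rewrite !mulr_ge0 ?expR_ge0.
apply: le_trans (ler_wpM2l P0 (gaussE_le (vmeasurableB m1 m2) r4 B0 FB)) _.
by rewrite le_eqVlt; apply/orP; left; apply/eqP; ring.
Qed.

Lemma trunc_product_bound (iota : 'I_D -> nat) : exists2 C, 0 <= C &
  forall (g : 'cV[R]_D -> R) (Delta r B : R), vmeasurable g -> (forall z, `|g z| <= B) -> 0 <= r ->
  vtame (fun z => g z * hermite_mi iota Delta (truncv r z)) /\
  `|gaussE (fun z => g z * hermite_mi iota Delta (truncv r z))| <=
    C * B * powR Delta (- ((mi_norm iota)%:R / 2)).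
Proof.
have [CH CH0 hCH] := @hermite_prod_le R D iota.
exists (CH * gauss_const (D := D)); first by rewrite mulr_ge0// gauss_const_ge0.
move=> g Delta r B mg gB r0; set P := powR Delta _; have P0 : 0 <= P by exact: powR_ge0.
have B0 : 0 <= B by apply: le_trans (gB 0).
have mF : vmeasurable (fun z => g z * hermite_mi iota Delta (truncv r z)).
  apply: vmeasurableM => //; apply: (@vmeasurableM (fun=> P)).
    exact: rseq_measurable_cst.
  exact: vmeasurable_hermite_trunc.
have FB z : `|g z * hermite_mi iota Delta (truncv r z)| <= (B * P * CH) * vweight 16^-1 z.
  rewrite hermite_miE -/P !normrM (ger0_norm P0) -!mulrA.
  apply: ler_pM => //; first by rewrite mulr_ge0.
  rewrite ler_wpM2l//; apply: le_trans (hCH _) _; rewrite ler_wpM2l//.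
  exact: vweight_trunc.
have C0 : 0 <= B * P * CH by rewrite !mulr_ge0.
have r4 : 16^-1 <= 4^-1 :> R by lra.
split; first exact: vtame_bound r4 C0 FB.
apply: le_trans (gaussE_le mF r4 C0 FB) _.
by rewrite le_eqVlt; apply/orP; left; apply/eqP; ring.
Qed.

(** The radius is 2 and not 1 because the Euler step may leave its cube, by up to 1 in the
    coordinates of the cell. *)
Lemma horner_box (p : {poly R}) : exists2 C, 0 <= C & forall s t : R, `|s| <= 2 -> `|t| <= 2 ->
  `|p.[s]| <= C /\ `|p.[s] - p.[t]| <= C * `|s - t|.
Proof.
elim/poly_ind: p => [|p c [C C0 IH]].
  by exists 0 => // s t _ _; rewrite !horner0 subrr normr0 mul0r.
exists (3 * C + `|c|); first by rewrite addr_ge0// mulr_ge0.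
move=> s t s2 t2; have [h1 h2] := IH s t s2 t2; rewrite !hornerMXaddC; split.
  apply: le_trans (ler_normD _ _) _; rewrite lerD2r normrM.
  by apply: le_trans (ler_pM _ _ h1 s2) _ => //; lra.
rewrite opprD addrACA subrr addr0.
have -> : p.[s] * s - p.[t] * t = p.[s] * (s - t) + (p.[s] - p.[t]) * t by ring.
apply: le_trans (ler_normD _ _) _; rewrite !normrM.
have e1 := ler_pM (normr_ge0 _) (normr_ge0 (s - t)) h1 (lexx _).
have e2 := ler_pM (normr_ge0 _) (normr_ge0 t) h2 t2.
apply: le_trans (lerD e1 e2) _.
have := mulr_ge0 (normr_ge0 c) (normr_ge0 (s - t)); rewrite mulrDl; lra.
Qed.

Lemma prod_box (I : Type) (s : seq I) (p : I -> {poly R}) : exists2 C, 0 <= C &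
  forall (u w : I -> R) (dl : R), 0 <= dl -> (forall i, `|u i| <= 2) -> (forall i, `|w i| <= 2) ->
  (forall i, `|u i - w i| <= dl) ->
  `|\prod_(i <- s) (p i).[u i]| <= C /\
  `|\prod_(i <- s) (p i).[u i] - \prod_(i <- s) (p i).[w i]| <= C * dl.
Proof.
elim: s => [|i s [C C0 IH]].
  by exists 1 => // u w dl dl0 _ _ h; rewrite !big_nil normr1 subrr normr0 mul1r.
have [B B0 hB] := horner_box (p i); exists (2 * (B * C)); first by rewrite !mulr_ge0.
move=> u w dl dl0 u2 w2 uw; have [h1 h2] := IH u w dl dl0 u2 w2 uw.
(* The induction hypothesis at equal points, for the bound on the product at [w]. *)
have [h3 _] := IH w w 0 (lexx _) w2 w2 (fun i => ltac:(by rewrite subrr normr0)).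
have [h4 h5] := hB (u i) (w i) (u2 i) (w2 i).
have h6 : `|(p i).[u i] - (p i).[w i]| <= B * dl by apply: le_trans h5 _; rewrite ler_wpM2l.
rewrite !big_cons; move: h1 h2 h3 h4 h6.
set a := \prod_(j <- s) (p j).[u j]; set b := \prod_(j <- s) (p j).[w j].
set c := (p i).[u i]; set d := (p i).[w i]; clearbody a b c d => h1 h2 h3 h4 h6.
split.
  rewrite normrM; apply: le_trans (ler_pM _ _ h4 h1) _ => //.
  by have := mulr_ge0 B0 C0; lra.
have -> : c * a - d * b = c * (a - b) + (c - d) * b by ring.
apply: le_trans (ler_normD _ _) _; rewrite !normrM.
have e1 := ler_pM (normr_ge0 _) (normr_ge0 _) h4 h2.
have e2 := ler_pM (normr_ge0 _) (normr_ge0 _) h6 h3.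
by apply: le_trans (lerD e1 e2) _; rewrite le_eqVlt; apply/orP; left; apply/eqP; ring.
Qed.

Variable Q : nat.
Local Notation K := (nK D Q).
Local Notation eta k u := (pj (@jnth D Q k) u).

Lemma pj_box : exists2 B, 0 <= B & forall (k : 'I_K) u w (dl : R), 0 <= dl ->
  (forall d, `|u d 0| <= 2) -> (forall d, `|w d 0| <= 2) -> (forall d, `|u d 0 - w d 0| <= dl) ->
  `|eta k u| <= B /\ `|eta k u - eta k w| <= B * dl.
Proof.
have /choice[B hB] : forall k : 'I_K, exists B, 0 <= B /\ forall u w (dl : R), 0 <= dl ->
  (forall d, `|u d 0| <= 2) -> (forall d, `|w d 0| <= 2) -> (forall d, `|u d 0 - w d 0| <= dl) ->
  `|eta k u| <= B /\ `|eta k u - eta k w| <= B * dl.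
  move=> k; have [B B0 h] := prod_box (index_enum 'I_D)
    (fun d => Num.sqrt ((2 * @jnth D Q k d + 1)%:R) *: legendre (@jnth D Q k d)).
  exists B; split => // u w dl dl0 u2 w2 uw.
  have E v : eta k v = \prod_(d < D) (Num.sqrt ((2 * @jnth D Q k d + 1)%:R) *: legendre (@jnth D Q k d)).[v d 0].
    by apply: eq_bigr => d _; rewrite [RHS]hornerZ.
  by rewrite !E; exact: (h (fun d => u d 0) (fun d => w d 0)).
exists (\sum_k B k); first by apply: sumr_ge0 => k _; have [] := hB k.
move=> k u w dl dl0 u2 w2 uw; have [_ /(_ u w dl dl0 u2 w2 uw)[h1 h2]] := hB k.
have le : B k <= \sum_k B k.
  by rewrite [leRHS](bigD1 k)//= lerDl sumr_ge0// => j _; have [] := hB j.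
split; first exact: le_trans le.
by apply: le_trans h2 _; rewrite ler_wpM2r.
Qed.

Lemma natr_mul_sum n (c : R) : n%:R * c = \sum_(l < n) c.
Proof. by rewrite sumr_const card_ord mulr_natl. Qed.

Lemma nK_gt0 : (0 < K)%N.
Proof.
rewrite /nK -has_predT; apply/hasP; exists [ffun=> ord0] => //.
by rewrite mem_filter mem_enum andbT big1// => d _; rewrite ffunE.
Qed.

Lemma sqnorm_coord_le n (v : 'cV[R]_n) k : sqnorm v = 1 -> `|v k 0| <= 1.
Proof.
move=> v1; rewrite -(@ler_pXn2r _ 2)// ?nnegrE// real_normK ?num_real// expr1n -v1.
by rewrite /sqnorm (bigD1 k)//= lerDl sumr_ge0// => j _; exact: sqr_ge0.
Qed.

(** A grid of mesh 1/N on [-1, 1]^n. In each grid cell that meets the sphere a unit vector is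
    chosen, so that the net itself lies on the sphere; [e1] fills in for the other cells. *)
Lemma unit_net n (e : R) : (0 < n)%N -> 0 < e -> exists net : seq 'cV[R]_n,
  (forall g, g \in net -> sqnorm g = 1) /\
  forall v, sqnorm v = 1 -> exists2 g, g \in net & forall k, `|v k 0 - g k 0| <= e.
Proof.
move=> n0 e0.
pose N := (Num.truncn (e^-1)).+1.
have N0 : 0 < N%:R :> R by rewrite ltr0n.
have Ne : N%:R^-1 <= e.
  rewrite -[leRHS]invrK lef_pV2 ?posrE// ?invr_gt0//; apply: ltW; exact: truncnS_gt.
(* The coordinate 1 falls into the cell with index 2N, hence 2N + 1 cells in each direction. *)
pose T := {ffun 'I_n -> 'I_(N.*2.+1)}.
pose cell (f : T) (v : 'cV[R]_n) := sqnorm v = 1 /\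
   forall k, (f k : nat)%:R <= N%:R * (v k 0 + 1) <= (f k).+1%:R.
pose e1 : 'cV[R]_n := delta_mx (Ordinal n0) 0.
have e1n : sqnorm e1 = 1.
  rewrite /sqnorm (bigD1 (Ordinal n0))//= mxE !eqxx expr1n big1 ?addr0// => i i0.
  by rewrite mxE (negbTE i0) expr0n.
pose pick f := if pselect (exists v, cell f v) is left p then proj1_sig (cid p) else e1.
exists [seq pick f | f <- enum T]; split.
  move=> g /mapP[f _ ->]; rewrite /pick; case: pselect => // p.
  by case: (cid p) => v [] .
move=> v v1.
have bnd k : 0 <= N%:R * (v k 0 + 1) < N.*2.+1%:R.
  have := sqnorm_coord_le k v1; rewrite ler_norml => /andP[h1 h2].
  rewrite mulr_ge0 ?(ltW N0)//=; last by lra.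
  by rewrite -natr1 -muln2 natrM; nra.
pose f : T := [ffun k => inord (Num.truncn (N%:R * (v k 0 + 1)))].
have fE k : (f k : nat) = Num.truncn (N%:R * (v k 0 + 1)).
  rewrite ffunE inordK//; have /andP[h1 h2] := bnd k.
  by rewrite -(ltr_nat R); apply: le_lt_trans h2; rewrite truncn_le.
have cf : cell f v.
  split => // k; rewrite fE; have /andP[h1 _] := bnd k.
  by rewrite truncn_le h1/= ltW// truncnS_gt.
exists (pick f); first by apply/mapP; exists f => //; rewrite mem_enum.
move=> k; rewrite /pick; case: pselect => [p|[]]; last by exists v.
case: (cid p) => g [_ gf] /=; have := gf k; have := cf.2 k.
move=> /andP[a1 a2] /andP[b1 b2]; apply: le_trans Ne.
rewrite -[N%:R^-1]mul1r ler_pdivlMr// -(ger0_norm (ltW N0)) -normrM ler_norml.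
move: a1 a2 b1 b2; rewrite -natr1; set t := _%:R => a1 a2 b1 b2.
by apply/andP; split; lra.
Qed.

(* A small singular value of the matrix built from the points [X l] is witnessed,
   up to a small loss, by a net vector at the nearby points [U l]. *)
Lemma small_singular_value (tau tau' : R) : tau < tau' -> exists net : seq 'cV[R]_K, exists2 dl, 0 < dl &
  (forall g, g \in net -> sqnorm g = 1) /\
  forall L (X U : 'I_L -> 'cV[R]_D), (0 < L)%N ->
  (forall l d, `|U l d 0| <= 1) -> (forall l d, `|X l d 0 - U l d 0| <= dl) ->
  smin_sq (\matrix_(l < L, k < K) eta k (X l)) < tau * L%:R ->
  exists2 g, g \in net & \sum_l (\sum_k g k 0 * eta k (U l)) ^+ 2 <= tau' * L%:R.
Proof.
move=> tt; have [B B0 hB] := pj_box.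
pose M := K%:R * B; have M0 : 0 <= M by rewrite mulr_ge0.
(* Mesh of the net and admissible distance of X from U. The linear forms are bounded by M and change
   by at most 2 M e, so their squares change by at most 4 M^2 e; the 1 keeps X in the box of radius
   2. *)
pose e := Num.min 1 ((tau' - tau) / (4 * M ^+ 2 + 1)).
have M1 : 0 < 4 * M ^+ 2 + 1 by rewrite ltr_wpDl// mulr_ge0// sqr_ge0.
have e0 : 0 < e by rewrite /e lt_min ltr01 divr_gt0// subr_gt0.
have e1 : e <= 1 by rewrite /e ge_min lexx.
have eM : 4 * M ^+ 2 * e <= tau' - tau.
  have : e * (4 * M ^+ 2 + 1) <= tau' - tau by rewrite -ler_pdivlMr// /e ge_min lexx orbT.
  by move: (sqr_ge0 M); nra.
have [net [n1 nv]] := unit_net nK_gt0 e0.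
exists net, e => //; split => // L X U L0 U1 XU sm.
have [v v1 vA] := smin_sq_lt nK_gt0 sm.
have [g gn gv] := nv v v1; exists g => //.
have g1 := n1 _ gn.
have U2 l d : `|U l d 0| <= 2 by apply: le_trans (U1 l d) _; lra.
have X2 l d : `|X l d 0| <= 2.
  rewrite -(subrK (U l d 0) (X l d 0)); apply: le_trans (ler_normD _ _) _.
  by have := XU l d; have := U1 l d; lra.
apply: (@le_trans _ _ (sqnorm ((\matrix_(l < L, k < K) eta k (X l)) *m v) + (4 * M ^+ 2 * e) * L%:R)); last first.
  have : 4 * M ^+ 2 * e * L%:R <= (tau' - tau) * L%:R by rewrite ler_wpM2r.
  by move: vA; lra.
have -> : (4 * M ^+ 2 * e) * L%:R = \sum_(l < L) 4 * M ^+ 2 * e.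
  by rewrite sumr_const card_ord -[RHS]mulr_natr.
rewrite /sqnorm -big_split/=; apply: ler_sum => l _; rewrite mxE.
have -> : \sum_j (\matrix_(l0, k) eta k (X l0)) l j * v j 0 = \sum_k v k 0 * eta k (X l).
  by apply: eq_bigr => k _; rewrite mxE mulrC.
have bound (c : 'cV[R]_K) (Y : 'cV[R]_D) : sqnorm c = 1 -> (forall d, `|Y d 0| <= 2) ->
    `|\sum_k c k 0 * eta k Y| <= M.
  move=> c1 Y2; apply: le_trans (ler_norm_sum _ _ _) _.
  apply: (@le_trans _ _ (\sum_(k < K) B)); last by rewrite sumr_const card_ord -[leLHS]mulr_natl.
  apply: ler_sum => k _; rewrite normrM -[leRHS]mul1r ler_pM//.
    exact: sqnorm_coord_le.
  have [] := hB k Y Y 0 (lexx _) Y2 Y2 => //.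
  by move=> d; rewrite subrr normr0.
have h1 := bound g (U l) g1 (U2 l); have h2 := bound v (X l) v1 (X2 l).
have h3 : `|\sum_k g k 0 * eta k (U l) - \sum_k v k 0 * eta k (X l)| <= 2 * M * e.
  rewrite -sumrB; apply: le_trans (ler_norm_sum _ _ _) _.
  apply: (@le_trans _ _ (\sum_(k < K) 2 * B * e)); last first.
    rewrite sumr_const card_ord -[leLHS]mulr_natl /M le_eqVlt; apply/orP; left; apply/eqP; ring.
  apply: ler_sum => k _.
  have [|b1 b2] := hB k (U l) (X l) e (ltW e0) (U2 l) (X2 l).
    by move=> d; rewrite distrC.
  have -> : g k 0 * eta k (U l) - v k 0 * eta k (X l) =
    - ((v k 0 - g k 0) * eta k (U l)) + v k 0 * (eta k (U l) - eta k (X l)) by ring.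
  apply: le_trans (ler_normD _ _) _; rewrite normrN !normrM.
  have f1 := ler_pM (normr_ge0 _) (normr_ge0 _) (gv k) b1.
  have f2 := ler_pM (normr_ge0 _) (normr_ge0 _) (sqnorm_coord_le k v1) b2.
  by apply: le_trans (lerD f1 f2) _; lra.
move: h1 h2 h3; set p := \sum_k _; set q := \sum_k _ => h1 h2 h3.
rewrite -lerBlDl subr_sqr; apply: le_trans (ler_norm _) _; rewrite normrM.
have h4 : `|p + q| <= 2 * M by apply: le_trans (ler_normD _ _) _; lra.
by apply: le_trans (ler_pM _ _ h3 h4) _ => //; rewrite le_eqVlt; apply/orP; left; apply/eqP; ring.
Qed.

Lemma vmeasurable_pj (j : 'I_D -> nat) (V : 'cV[R]_D -> 'cV[R]_D) :
  (forall d, vmeasurable (fun z => V z d 0)) -> vmeasurable (fun z => pj j (V z)).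
Proof.
move=> mV; rewrite /vmeasurable /pj; apply: rseq_measurable_prod => d.
apply: rseq_measurableM; first exact: rseq_measurable_cst.
apply: (rseq_measurable_comp (h := horner _)); last exact: mV.
by apply: continuous_measurable_fun; exact: continuous_horner.
Qed.

(** The Taylor polynomial of [y] at the centre of the cube has coefficients [beta] in the basis and
    competes with the least-squares solution. Its residual at each of the L points is at most N
    h^(Q+1), so the L in the sum of squares cancels the L in tau L, and the coefficients differ by
    at most N h^(Q+1) / sqrt tau. *)
Lemma regression_error (iota : 'I_D -> nat) (My tau : R) : 0 <= My -> 0 < tau -> exists2 C, 0 <= C &
  forall (y : 'cV[R]_D -> R) (h : R) (i : 'I_D -> int) a S (Delta r : R) L (X : 'I_L -> 'cV[R]_D),
  CbM Q.+1 My y -> 0 < h -> 0 < Delta -> 0 <= r -> (0 < L)%N ->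
  (forall l d, `|cell_coord h i (X l) d 0| <= 2) ->
  (forall z d, `|cell_coord h i (affine_trunc a S (Num.sqrt Delta) r z) d 0| <= 2) ->
  let A := \matrix_(l < L, k < K) eta k (cell_coord h i (X l)) in
  let alpha := mp_pinv A *m (\col_(l < L) y (X l)) in
  tau * L%:R <= smin_sq A ->
  `|gaussE (fun z => y (affine_trunc a S (Num.sqrt Delta) r z) * hermite_mi iota Delta (truncv r z)) -
    \sum_k alpha k 0 * gaussE (fun z => eta k (cell_coord h i (affine_trunc a S (Num.sqrt Delta) r z))
       * hermite_mi iota Delta (truncv r z))|
  <= C * h ^+ Q.+1 * powR Delta (- ((mi_norm iota)%:R / 2)).
Proof.
move=> My0 tau0; have [B B0 hB] := pj_box; have [C C0 hC] := trunc_product_bound iota.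
pose N := D%:R ^+ Q.+1 * My; have N0 : 0 <= N by rewrite mulr_ge0// exprn_ge0.
pose T := K%:R * B / Num.sqrt tau.
have T0 : 0 <= T by rewrite divr_ge0 ?mulr_ge0.
exists (C * (N * (1 + T))); first by rewrite !mulr_ge0// addr_ge0.
move=> y h i a S Delta r L X yM h0 D0 r0 L0 X2 Xt2 A alpha sA.
set Xt := affine_trunc a S (Num.sqrt Delta) r.
have [cy y1] := CbM_bounded yM.
have [p hp py] := taylor_polyfun (cube_center h i) yM.
have [beta hbeta] := polyfun_span_pj (polyfun_scale (h / 2) hp).
have h20 : 0 < h / 2 by lra.
(* Cell coordinates up to 2 mean distance at most h from the centre in each coordinate. *)
have appr x : (forall d, `|cell_coord h i x d 0| <= 2) ->
    `|y x - \sum_k beta k * eta k (cell_coord h i x)| <= N * h ^+ Q.+1.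
  move=> x2; rewrite -hbeta /cell_coord scalerA mulfV ?gt_eqF// scale1r.
  have := py h (x - cube_center h i); rewrite [cube_center h i + _]addrC subrK; apply => d.
  have := x2 d; rewrite /cell_coord [X in `|X|]mxE normrM gtr0_norm ?invr_gt0//.
  by rewrite mulrC ler_pdivrMr//; lra.
pose bv : 'cV[R]_K := \col_k beta k.
have sq1 : tau * sqnorm (alpha - bv) <= (N * h ^+ Q.+1) ^+ 2.
  have tL : 0 < tau * L%:R by rewrite mulr_gt0// ltr0n.
  have := least_squares_le nK_gt0 (\col_(l < L) y (X l)) bv tL sA.
  rewrite -/alpha => le1.
  have le2 : sqnorm (\col_(l < L) y (X l) - A *m bv) <= L%:R * (N * h ^+ Q.+1) ^+ 2.
    rewrite natr_mul_sum; apply: ler_sum => l _.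
    rewrite !mxE -real_normK ?num_real// ler_sqr ?nnegrE ?mulr_ge0 ?exprn_ge0 ?(ltW h0)//.
    apply: le_trans (appr _ (X2 l)); rewrite le_eqVlt; apply/orP; left; apply/eqP.
    by congr (`|_ - _|); apply: eq_bigr => k _; rewrite !mxE mulrC.
  have := le_trans le1 le2; rewrite mulrAC mulrC ler_pM2l ?ltr0n//.
have cn k : `|alpha k 0 - beta k| <= N * h ^+ Q.+1 / Num.sqrt tau.
  have Nh : 0 <= N * h ^+ Q.+1 by rewrite mulr_ge0// exprn_ge0// ltW.
  rewrite ler_pdivlMr ?sqrtr_gt0//.
  have h2 : (`|alpha k 0 - beta k| * Num.sqrt tau) ^+ 2 <= (N * h ^+ Q.+1) ^+ 2.
    rewrite exprMn sqr_sqrtr ?(ltW tau0)//.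
    apply: le_trans sq1; rewrite mulrC ler_wpM2l ?(ltW tau0)// real_normK ?num_real//.
    rewrite /sqnorm (bigD1 k)//= !mxE lerDl sumr_ge0// => l _; exact: sqr_ge0.
  by move: h2; rewrite ler_sqr// nnegrE mulr_ge0// sqrtr_ge0.
have mXt d : vmeasurable (fun z => Xt z d 0) by exact: vmeasurable_affine_trunc.
have mcc d : vmeasurable (fun z => cell_coord h i (Xt z) d 0).
  rewrite /vmeasurable (_ : (fun _ => _) = fun v => (h / 2)^-1 * (Xt (vec_of_seq D v) d 0 + - (h * ((i d)%:~R + 1 / 2)))).
    apply: rseq_measurableM; first exact: rseq_measurable_cst.
    by apply: rseq_measurableD; [exact: mXt|exact: rseq_measurable_cst].
  by apply/funext => v; rewrite cell_coordE.
have me (k : 'I_K) : vmeasurable (fun z => eta k (cell_coord h i (Xt z))) by exact: vmeasurable_pj.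
have be (k : 'I_K) z : `|eta k (cell_coord h i (Xt z))| <= B.
  have [] := hB k (cell_coord h i (Xt z)) (cell_coord h i (Xt z)) 0 (lexx _) (Xt2 z) (Xt2 z) => //.
  by move=> d; rewrite subrr normr0.
have my : vmeasurable (fun z => y (Xt z)) by apply: vmeasurable_continuous.
have ty := (hC _ Delta r My my (fun z => y1 _) r0).1.
have te (k : 'I_K) := (hC _ Delta r B (me k) (be k) r0).1.
rewrite -/Xt.
have -> : gaussE (fun z => y (Xt z) * hermite_mi iota Delta (truncv r z)) -
    \sum_k alpha k 0 * gaussE (fun z => eta k (cell_coord h i (Xt z)) * hermite_mi iota Delta (truncv r z)) =
  gaussE (fun z => (y (Xt z) - \sum_k alpha k 0 * eta k (cell_coord h i (Xt z))) * hermite_mi iota Delta (truncv r z)).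
  rewrite (eq_bigr (fun k : 'I_K => gaussE (fun z => alpha k 0 * (eta k (cell_coord h i (Xt z)) * hermite_mi iota Delta (truncv r z))))); last first.
    by move=> k _; rewrite gaussEZ.
  rewrite -(@gaussE_sum _ _ _ _ (fun k z => alpha k 0 * (eta k (cell_coord h i (Xt z)) * hermite_mi iota Delta (truncv r z)))); last first.
    by move=> k; apply: tameZ; exact: te.
  rewrite -gaussEB//; last by apply: tame_sum => k; apply: tameZ; exact: te.
  congr gaussE; apply/funext => z; rewrite mulrBl mulr_suml; congr (_ - _).
  by apply: eq_bigr => k _; rewrite mulrA.
have mg : vmeasurable (fun z => y (Xt z) - \sum_k alpha k 0 * eta k (cell_coord h i (Xt z))).
  apply: vmeasurableB => //; apply: rseq_measurable_sum => k.
  by apply: rseq_measurableM; [exact: rseq_measurable_cst|exact: me].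
have gB z : `|y (Xt z) - \sum_k alpha k 0 * eta k (cell_coord h i (Xt z))| <= N * (1 + T) * h ^+ Q.+1.
  (* The Taylor remainder, and the effect of the difference between fitted and Taylor
     coefficients. *)
  have -> : y (Xt z) - \sum_k alpha k 0 * eta k (cell_coord h i (Xt z)) =
    (y (Xt z) - \sum_k beta k * eta k (cell_coord h i (Xt z))) -
    \sum_k (alpha k 0 - beta k) * eta k (cell_coord h i (Xt z)).
    rewrite -addrA -opprD -big_split/=; congr (_ - _); apply: eq_bigr => k _; ring.
  apply: le_trans (ler_normB _ _) _.
  have a1 := appr _ (Xt2 z).
  have a2 : `|\sum_k (alpha k 0 - beta k) * eta k (cell_coord h i (Xt z))| <= K%:R * (N * h ^+ Q.+1 / Num.sqrt tau * B).
    apply: le_trans (ler_norm_sum _ _ _) _; rewrite natr_mul_sum.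
    by apply: ler_sum => k _; rewrite normrM ler_pM//; exact: be.
  apply: le_trans (lerD a1 a2) _; rewrite /T.
  by rewrite le_eqVlt; apply/orP; left; apply/eqP; ring.
apply: le_trans (hC _ Delta r _ mg gB r0).2 _.
by rewrite le_eqVlt; apply/orP; left; apply/eqP; ring.
Qed.

End LocalError.

(** * Scaling of Lebesgue measure and of the normal density *)

Section Scaling.
Context {R : realType}.
Local Notation mu := (@lebesgue_measure R).
Local Notation phi := (@normal_pdf R 0 1).

(** The image of the measure under x -> s x, multiplied by s, gives half-open intervals their
    length, and Lebesgue measure is the only measure that does. *)
Lemma lebesgue_measure_scale (s : R) (s0 : 0 < s) (A : set R) : measurable A ->
  mu A = (s%:E * mu ((fun x => s * x)%R @^-1` A))%E.
Proof.
move=> mA.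
have mf : measurable_fun setT ((fun x => s * x) : measurableTypeR R -> measurableTypeR R).
  exact: measurable_funM.
pose f : {mfun measurableTypeR R >-> measurableTypeR R} :=
  HB.pack ((fun x => s * x) : measurableTypeR R -> measurableTypeR R)
    (isMeasurableFun.Build _ _ _ _ _ mf).
rewrite (@lebesgue_measure_unique R (mscale (NngNum (ltW s0)) (pushforward mu f)))//.
move=> _ [[a b]] _ <-.
have pE : f @^-1` `]a, b]%classic = `](a / s), (b / s)]%classic.
  apply/seteqP; split => x /=; rewrite !in_itv/= ltr_pdivrMr// ler_pdivlMr//; by rewrite mulrC.
transitivity (s%:E * mu `](a / s)%R, (b / s)%R]%classic)%E; last by rewrite -pE.
rewrite !lebesgue_measure_itv/= !lte_fin ltr_pdivrMr// divfK ?gt_eqF//.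
case: ifP => _; last by rewrite mule0.
by rewrite -!EFinB -EFinM mulrBr mulrC divfK ?gt_eqF// mulrC divfK ?gt_eqF.
Qed.

Lemma ge0_integral_scale (s : R) (F : R -> \bar R) : 0 < s -> measurable_fun setT F ->
  (forall x, 0 <= F x)%E -> (\int[mu]_x F x = s%:E * \int[mu]_x F (s * x)%R)%E.
Proof.
move=> s0 mF F0.
have mf : measurable_fun setT ((fun x => s * x) : measurableTypeR R -> measurableTypeR R).
  exact: measurable_funM.
pose f : {mfun measurableTypeR R >-> measurableTypeR R} :=
  HB.pack ((fun x => s * x) : measurableTypeR R -> measurableTypeR R)
    (isMeasurableFun.Build _ _ _ _ _ mf).
pose pf : {measure set (measurableTypeR R) -> \bar R} := pushforward mu f.
transitivity (\int[mscale (NngNum (ltW s0)) (pf mf)]_x F x)%E.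
  by apply: eq_measure_integral => A mA _; exact: lebesgue_measure_scale.
rewrite ge0_integral_mscale//; congr (_ * _)%E.
by rewrite (@ge0_integral_pushforward _ _ _ _ _ f mf)//.
Qed.

Lemma integral_normal_scale (s : R) (G : R -> \bar R) : 0 < s -> measurable_fun setT G ->
  (forall x, 0 <= G x)%E ->
  (\int[mu]_x ((normal_pdf 0 s x)%:E * G x) = \int[mu]_z ((phi z)%:E * G (s * z)%R))%E.
Proof.
move=> s0 mG G0; have sn0 : s != 0 by rewrite gt_eqF.
have mp := measurable_normal_pdf 0 s.
rewrite (ge0_integral_scale s0); last 2 first.
- by apply: emeasurable_funM => //; exact/measurable_EFinP.
- by move=> x; rewrite mule_ge0// lee_fin normal_pdf_ge0.
rewrite -ge0_integralZl//; last 3 first.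
- apply: emeasurable_funM; last exact: (measurableT_comp mG).
  by apply/measurable_EFinP; exact: (measurableT_comp mp).
- by move=> x _; rewrite mule_ge0// lee_fin normal_pdf_ge0.
- by rewrite lee_fin ltW.
apply: eq_integral => z _; rewrite muleA -EFinM; congr (_%:E * _)%E.
rewrite normal_pdf01E normal_pdfE// /normal_fun subr0 mulrA; congr (_ * expR _).
  rewrite /normal_peak expr1n mul1r -[s ^+ 2 * pi *+ 2]mulrnAr sqrtrM ?sqr_ge0// sqrtr_sqr gtr0_norm//.
  by rewrite invfM mulrA divff// mul1r.
by rewrite exprMn -[_ *+ 2]mulr_natr; field.
Qed.

Variables (s : R) (s0 : 0 < s).
Local Notation p := (normal_pdf 0 s).

Let dp : density p. Proof. by split; [exact: measurable_normal_pdf|exact: normal_pdf_ge0]. Qed.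
Let d1 n : List.Forall density (nseq n (fun=> 1 : R)).
Proof. by elim: n => [|n IH]; constructor => //; split. Qed.
Let dphi n : List.Forall density (nseq n phi).
Proof. exact/light_density_density/light_density_nseq_normal. Qed.

Lemma iint_normal_scale n (G : seq R -> \bar R) : seq_measurable n G ->
  (forall v, 0 <= G v)%E ->
  iint (nseq n (fun=> 1)) (fun v => (\prod_(x <- v) p x)%:E * G v)%E =
  iint (nseq n phi) (fun v => G (map ( *%R s) v)).
Proof.
elim: n G => [|n IH] G mG G0 /=; first by rewrite big_nil mul1e.
have mGx x : seq_measurable n (fun v => G (x :: v)) by exact: seq_measurable_cons.
have mP : seq_measurable n (fun v : seq R => (\prod_(x <- v) p x)%:E).
  apply: (seq_measurable_eq (F := fun v => (\prod_(i < n) p (nth 0 v i))%:E)).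
    by move=> v sv; rewrite (big_nth 0) sv big_mkord.
  apply: rseq_measurable_EFin; apply: rseq_measurable_prod => i.
  by apply: rseq_measurable_comp; [exact: measurable_normal_pdf|exact: rseq_measurable_nth].
have P0 (v : seq R) : 0 <= \prod_(x <- v) p x by apply: prodr_ge0 => x _; exact: normal_pdf_ge0.
have step x : iint (nseq n (fun=> 1)) (fun v => (\prod_(u <- x :: v) p u)%:E * G (x :: v))%E =
    ((p x)%:E * iint (nseq n phi) (fun v => G (x :: map ( *%R s) v)))%E.
  rewrite -(IH (fun v => G (x :: v)))//.
  rewrite -iintZ//; last 3 first.
  - exact: normal_pdf_ge0.
  - move=> dX X c mc; rewrite size_nseq; apply: emeasurable_funM.
      exact: mP.
    exact: mGx.
  - by move=> v _; rewrite mule_ge0 ?lee_fin.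
  by apply: eq_iint => v _; rewrite big_cons EFinM muleA.
under eq_integral do rewrite mul1e step.
rewrite integral_normal_scale//; last first.
  by move=> x; apply: iint_ge0.
(* Here only the tail is rescaled; the first coordinate has been treated by
   [integral_normal_scale]. *)
have mH : seq_measurable n.+1 (fun v => G (head 0 v :: map ( *%R s) (behead v))).
  move=> dX X c mc.
  have mc' i : measurable_fun setT ((fun i => if i is j.+1 then (fun x => s * c j.+1 x) else c 0%N) i : X -> R).
    by case: i => [|i]; [exact: mc|apply: measurable_funM].
  have := mG _ X _ mc'; congr measurable_fun; apply/funext => x.
  rewrite !mkseq_consE /=; congr (G (_ :: _)).
  by rewrite /mkseq -map_comp.
have := @seq_measurable_iint1 R p (nseq n phi) _ (dphi n).
rewrite size_nseq => /(_ _ mH); exact.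
Qed.

End Scaling.

(** * The Gaussian envelope of the density and the chi-square tail *)

Section EnvelopeAndTail.
Context {R : realType} {D : nat}.
Local Notation phi := (@normal_pdf R 0 1).
Local Notation vec := (@vec_of_seq R D).
Variables (C1f C2f : R).
Hypotheses (C1f0 : 0 < C1f) (C2f0 : 0 < C2f).

(** [C1f] times the density of the centred normal law with covariance [C2f] times the identity. *)
Definition envelope (x : 'cV[R]_D) : R :=
  C1f / powR (2 * pi * C2f) (D%:R / 2) * expR (- (norm2 x ^+ 2) / (2 * C2f)).

Lemma envelopeE (v : seq R) : size v = D ->
  envelope (vec v) = C1f * \prod_(x <- v) normal_pdf 0 (Num.sqrt C2f) x.
Proof.
move=> sv; rewrite /envelope -mulrA; congr (_ * _).
have s0 : Num.sqrt C2f != 0 by rewrite gt_eqF// sqrtr_gt0.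
rewrite (big_nth 0) sv big_mkord.
rewrite (eq_bigr (fun i : 'I_D => (Num.sqrt (2 * pi * C2f))^-1 * expR (- (nth 0 v i ^+ 2) / (2 * C2f)))); last first.
  move=> i _; rewrite normal_pdfE// /normal_peak /normal_fun subr0 sqr_sqrtr ?(ltW C2f0)//.
  rewrite -[C2f * pi *+ 2]mulr_natl -[C2f *+ 2]mulr_natl; congr ((Num.sqrt _)^-1 * _); ring.
rewrite big_split/= prodr_const card_ord -expR_sum; congr (_ * expR _).
  have pp : 0 <= 2 * pi * C2f :> R by rewrite !mulr_ge0 ?pi_ge0// ltW.
  by rewrite exprVn; congr (_^-1); rewrite -powR12_sqrt// -powR_mulrn ?powR_ge0// -powRrM [2^-1 * _]mulrC.
rewrite norm2_sqr /sqnorm -mulr_suml -sumrN; congr (_ * _); apply: eq_bigr => i _.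
by rewrite mxE.
Qed.

Lemma lebD_envelope (g : 'cV[R]_D -> R) (B : R) : vmeasurable g ->
  (forall x, 0 <= g x <= B) ->
  lebD (fun x => (envelope x * g x)%:E) =
  (C1f * gaussE (fun z => g (Num.sqrt C2f *: z)))%:E.
Proof.
move=> mg gB; have s0 : 0 < Num.sqrt C2f by rewrite sqrtr_gt0.
set s := Num.sqrt C2f in s0 *.
rewrite /lebD; transitivity (iint (nseq D (fun=> 1)) (fun v =>
    (\prod_(x <- v) normal_pdf 0 s x)%:E * (C1f * g (vec v))%:E)%E).
  apply: eq_iint => v; rewrite size_nseq => sv; rewrite envelopeE// -EFinM.
  by congr EFin; ring.
rewrite iint_normal_scale//; last 2 first.
- apply: rseq_measurable_EFin; apply: rseq_measurableM => //; exact: rseq_measurable_cst.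
- by move=> v; rewrite lee_fin mulr_ge0 ?(ltW C1f0)//; have /andP[] := gB (vec v).
have E v : vec (map ( *%R s) v) = s *: vec v.
  apply/colP => d; rewrite !mxE; have [dv|dv] := ltnP d (size v); first by rewrite (nth_map 0).
  by rewrite !nth_default ?size_map// mulr0.
have mgs : vmeasurable (fun z => g (s *: z)).
  move=> dX X c mc; have mc' i : measurable_fun setT (fun x => s * c i x) by exact: measurable_funM.
  have := mg _ X _ mc'; congr measurable_fun; apply/funext => x; congr g.
  by apply/colP => d; rewrite !mxE !nth_mkseq.
have tg : vtame (fun z => C1f * g (s *: z)).
  apply: tameZ; apply: (@vtame_bound _ _ (fun z => g (s *: z)) 4^-1 B) => //.
    by apply: (@le_trans _ _ (g 0)); have /andP[] := gB 0.
  move=> z; have /andP[g0 g1] := gB (s *: z); rewrite ger0_norm//.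
  apply: le_trans g1 _; rewrite ler_peMr ?vweight_ge1 ?invr_ge0//.
  by apply: (@le_trans _ _ (g 0)); have /andP[] := gB 0.
transitivity (iint (nseq D phi) (fun v => (C1f * g (s *: vec v))%:E)).
  by apply: eq_iint => v _; rewrite E.
rewrite (@iint_rint _ _ (fun v => C1f * g (s *: vec v))) ?size_nseq//; last exact: light_density_nseq_normal.
rewrite -gaussEZ//; apply: (@vtame_bound _ _ _ 4^-1 B) => //.
  by apply: (@le_trans _ _ (g 0)); have /andP[] := gB 0.
move=> z; have /andP[g0 g1] := gB (s *: z); rewrite ger0_norm//.
apply: le_trans g1 _; rewrite ler_peMr ?vweight_ge1 ?invr_ge0//.
by apply: (@le_trans _ _ (g 0)); have /andP[] := gB 0.
Qed.

Definition tailE (q : R) : R := gaussE (fun z : 'cV[R]_D => ((q < norm2 z ^+ 2)%R : bool)%:R).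

Let mnorm : vmeasurable (fun z : 'cV[R]_D => norm2 z ^+ 2 : R).
Proof.
rewrite /vmeasurable (_ : (fun _ => _) = fun v => \sum_(d < D) (vec v) d 0 * (vec v) d 0).
  by apply: rseq_measurable_sum => d; apply: rseq_measurableM; exact: vmeasurable_coord.
by apply/funext => v; rewrite norm2_sqr; apply: eq_bigr => d _; rewrite expr2.
Qed.

Let indic_tame (P : 'cV[R]_D -> bool) : vmeasurable (fun z => (P z)%:R) -> vtame (fun z => (P z)%:R).
Proof.
move=> mP; apply: (@vtame_bound _ _ _ 4^-1 1) => // z.
rewrite mul1r ger0_norm//; apply: le_trans (vweight_ge1 _ _); first by case: (P z).
by rewrite invr_ge0.
Qed.

Let tle q : vtame (fun z : 'cV[R]_D => ((norm2 z ^+ 2 <= q)%R : bool)%:R).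
Proof.
apply: indic_tame; apply: rseq_measurable_le; [exact: mnorm|exact: rseq_measurable_cst].
Qed.

Let ltE q (z : 'cV[R]_D) : ((q < norm2 z ^+ 2)%R : bool)%:R = 1 - ((norm2 z ^+ 2 <= q)%R : bool)%:R :> R.
Proof. by rewrite ltNge; case: (_ <= _) => /=; rewrite ?subrr ?subr0. Qed.

Lemma tailE_compl q : tailE q = 1 - gaussE (fun z : 'cV[R]_D => ((norm2 z ^+ 2 <= q)%R : bool)%:R).
Proof.
have -> : tailE q = gaussE (fun z : 'cV[R]_D => 1 - ((norm2 z ^+ 2 <= q)%R : bool)%:R).
  by congr gaussE; apply/funext => z; exact: ltE.
by rewrite gaussEB//; [rewrite gaussE_rint rint_nseq_normal1|exact: tame_cst].
Qed.

Let ttail q : vtame (fun z : 'cV[R]_D => ((q < norm2 z ^+ 2)%R : bool)%:R).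
Proof.
have := tameB (tame_cst D 1) (tle q); congr tame; apply/funext => v; by rewrite ltE.
Qed.

Lemma gaussE_indic_cvg (Pn : nat -> 'cV[R]_D -> bool) (P : 'cV[R]_D -> bool) :
  (forall n, vmeasurable (fun z => (Pn n z)%:R)) ->
  (forall m n z, (m <= n)%N -> Pn m z -> Pn n z) ->
  (forall z, \forall n \near \oo, Pn n z = P z) ->
  gaussE (fun z => (Pn n z)%:R) @[n --> \oo] --> gaussE (fun z => (P z)%:R).
Proof.
move=> mP Pd PP; rewrite /gaussE; apply: fine_cvg.
rewrite fineK; last first.
  apply/fin_numPlt/andP; split.
    apply: (@lt_le_trans _ _ 0%E); first exact: ltNyr.
    by apply: iint_ge0; [exact/light_density_density/light_density_nseq_normal|move=> v _; rewrite lee_fin].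
  apply: (@le_lt_trans _ _ (iint (nseq D phi) (fun=> 1%:E))); last first.
    by rewrite (@iint_rint _ _ (fun=> 1)) ?ltry//; [exact: light_density_nseq_normal|exact: tame_cst].
  apply: le_iint; first exact/light_density_density/light_density_nseq_normal.
    by move=> v _; rewrite lee_fin.
  by move=> v _; rewrite lee_fin; case: (P _).
apply: iint_mono_cvg.
- exact/light_density_density/light_density_nseq_normal.
- by move=> n; rewrite size_nseq; apply: rseq_measurable_EFin; exact: mP.
- by move=> n v _; rewrite lee_fin.
- move=> v _ m n mn; rewrite lee_fin ler_nat.
  by case E : (Pn m _) => //; rewrite (Pd _ _ _ mn E).
- move=> v _; apply: cvg_near_cst; have := PP (vec v).
  by apply: filterS => n ->.
Qed.

Lemma tailE_le q q' : q <= q' -> tailE q' <= tailE q.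
Proof.
move=> qq; rewrite /tailE !gaussE_rint; apply: ler_rint; rewrite ?size_nseq.
- exact: light_density_nseq_normal.
- exact: ttail.
- exact: ttail.
- by move=> v _; rewrite ler_nat; case: ltP => // h; rewrite (le_lt_trans qq h).
Qed.

(** The quantile is an infimum, so two things have to be seen: the set is nonempty, because the tail
    tends to 0, and bounded below by 0, because the tail is 1 at negative arguments; and the tail
    bound passes to the infimum by right-continuity. *)
Lemma chi2q_tail (alpha : R) : 0 < alpha -> alpha < 1 ->
  0 <= chi2q D alpha /\ tailE (chi2q D alpha) <= alpha.
Proof.
move=> a0 a1; set S := [set q : R | 1 - alpha <= gaussE (fun z : 'cV[R]_D => ((norm2 z ^+ 2 <= q)%R : bool)%:R)].
have SE q : S q <-> tailE q <= alpha by rewrite tailE_compl /S/=; split; lra.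
have Slb : lbound S 0.
  move=> q /SE tq; rewrite leNgt; apply/negP => q0; move: tq; rewrite leNgt => /negP; apply.
  suff -> : tailE q = 1 by [].
  rewrite -(rint_nseq_normal1 D) /tailE gaussE_rint; congr rint; apply/funext => v.
  by rewrite (lt_le_trans q0)// sqr_ge0.
have S0 : S !=set0.
  have h : gaussE (fun z : 'cV[R]_D => ((norm2 z ^+ 2 <= n%:R)%R : bool)%:R) @[n --> \oo] -->
      gaussE (fun z : 'cV[R]_D => (true)%:R : R).
    apply: (gaussE_indic_cvg (Pn := fun n z => norm2 z ^+ 2 <= n%:R) (P := fun=> true)).
    - by move=> n; exact: (tle n%:R).1.
    - by move=> m n z mn /le_trans; apply; rewrite ler_nat.
    - move=> z; exists (Num.truncn (norm2 z ^+ 2)).+1 => // n /= zn.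
      by apply/idP; apply: le_trans (ltW (truncnS_gt _)) _; rewrite ler_nat.
  rewrite (_ : gaussE _ = 1) in h; last by rewrite gaussE_rint rint_nseq_normal1.
  have : \forall n \near \oo, 1 - alpha < gaussE (fun z : 'cV[R]_D => ((norm2 z ^+ 2 <= n%:R)%R : bool)%:R).
    by apply: (cvgr_gt _ h); rewrite ltrBlDr ltrDl.
  by case=> n _ /(_ n (leqnn n)) hn; exists n%:R; exact: ltW.
have hS : has_inf S by split => //; exists 0.
rewrite /chi2q -/S; split; first exact: lb_le_inf.
have h : tailE (inf S + n.+1%:R^-1) @[n --> \oo] --> tailE (inf S).
  apply: (gaussE_indic_cvg (Pn := fun n z => inf S + n.+1%:R^-1 < norm2 z ^+ 2)
    (P := fun z => inf S < norm2 z ^+ 2)).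
  - by move=> n; exact: (ttail _).1.
  - move=> m n z mn; apply: le_lt_trans; rewrite lerD2l lef_pV2 ?posrE ?ltr0n//.
    by rewrite ler_nat.
  - move=> z; have [zq|zq] := ltP (inf S) (norm2 z ^+ 2).
      have e0 : 0 < norm2 z ^+ 2 - inf S by rewrite subr_gt0.
      apply: filterS (near_infty_natSinv_lt (PosNum e0)) => n /= hn.
      by apply/idP; rewrite -ltrBrDl.
    exists 0%N => // n _; apply/negP/negP; rewrite -leNgt.
    by apply: le_trans zq _; rewrite lerDl.
rewrite -(cvg_lim _ h)//; apply: limr_le; first by apply/cvg_ex; exists (tailE (inf S)).
apply: nearW => n; have [e Se en] := inf_adherent (divr_gt0 ltr01 (ltr0Sn R n)) hS.
apply: (@le_trans _ _ (tailE e)); last exact/SE.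
by apply: tailE_le; rewrite -div1r ltW.
Qed.

End EnvelopeAndTail.

(** * Mean weight of the cubes with a bad design matrix *)

Section BadEvent.
Context {R : realType}.
Variables (D Q L : nat) (h : R) (I : seq ('I_D -> int)).
Hypothesis h0 : 0 < h.
Local Notation phi := (@normal_pdf R 0 1).
Local Notation K := (nK D Q).
Local Notation n := (size I).
Local Notation i0 := (fun=> 0 : int).

Definition sample_dens (i : 'I_D -> int) : seq (R -> R) := cell_dens h i ++ nseq D phi.

Definition sample_blocks : seq (seq (R -> R)) := flatten [seq nseq L (sample_dens i) | i <- I].

Definition cell_form (i : 'I_D -> int) (g : 'cV[R]_K) (w : seq R) : R :=
  (\sum_k g k 0 * pj (@jnth D Q k) (cell_coord h i (vec_of_seq D w))) ^+ 2.

Lemma light_sample_dens i : List.Forall light_density (sample_dens i).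
Proof.
apply/List.Forall_app; split; first exact: light_cell_dens.
exact: light_density_nseq_normal.
Qed.

Lemma size_sample_dens i : size (sample_dens i) = (D + D)%N.
Proof. by rewrite size_cat size_cell_dens size_nseq. Qed.

Lemma tame_exp_cell_form m i g s : 0 <= s -> tame m (fun w => expR (- (s * cell_form i g w))).
Proof.
move=> s0; split; last first.
  exists 1 => // w _; rewrite ger0_norm ?expR_ge0// mul1r.
  apply: (@le_trans _ _ 1); last by apply: gauss_weight_ge1; rewrite invr_ge0.
  by rewrite -[leRHS]expR0 ler_expR oppr_le0 mulr_ge0// sqr_ge0.
apply: (rseq_measurable_comp (h := fun x => expR (- (s * x ^+ 2)))).
  apply: measurableT_comp => //; apply: measurableT_comp => //.
  by apply: measurable_funM => //; exact: measurable_funX.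
apply: rseq_measurable_sum => k; apply: rseq_measurableM; first exact: rseq_measurable_cst.
apply: rseq_measurable_prod => d; apply: rseq_measurableM; first exact: rseq_measurable_cst.
apply: (rseq_measurable_comp (h := horner _)).
  by apply: continuous_measurable_fun; exact: continuous_horner.
rewrite (_ : (fun _ => _) = fun w => (h / 2)^-1 * (nth 0 w d + - (h * ((i d)%:~R + 1 / 2)))).
  apply: rseq_measurableM; first exact: rseq_measurable_cst.
  by apply: rseq_measurableD; [exact: rseq_measurable_nth|exact: rseq_measurable_cst].
by apply/funext => w; rewrite cell_coordE mxE.
Qed.

Lemma rint_sample_exp i g s : 0 <= s -> sqnorm g = 1 -> s * legendre_mass D Q <= 2 ->
  rint (sample_dens i) (fun w => expR (- (s * cell_form i g w))) <=
  expR (- (s - s ^+ 2 * legendre_mass D Q / 2)).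
Proof.
move=> s0 g1 sm; have [t le] := rint_cell_exp i h0 g1 s0 sm.
rewrite (@rint_cat_normal _ (cell_dens h i) D _ (fun w => expR (- (s * cell_form i g w)))).
- exact: le.
- exact: light_cell_dens.
- by rewrite size_cell_dens.
move=> v w; rewrite size_cell_dens => sv; congr (expR (- (s * (\sum_k _) ^+ 2))).
apply/funext => k; congr (_ * pj _ (cell_coord _ _ _)).
by apply/colP => d; rewrite !mxE nth_cat sv ltn_ord.
Qed.

(** The mean over all samples of the majorant used below: the L samples of cube k each contribute at
    most one Chernoff factor, and all other samples integrate to 1. *)
Lemma iblocks_exp_le (a0 E0 s : R) (w : 'I_n -> R) (net : seq 'cV[R]_K) :
  0 <= a0 -> 0 <= E0 -> 0 <= s -> s * legendre_mass D Q <= 2 -> (forall k, 0 <= w k) ->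
  (forall g, g \in net -> sqnorm g = 1) ->
  (iblocks sample_blocks (fun vs => (a0 + \sum_(k < n) w k * \sum_(g <- net)
     (E0 * \prod_(l < L) expR (- (s * cell_form (nth i0 I k) g (nth [::] vs (k * L + l)%N)))))%:E)
  <= (a0 + (\sum_k w k) * ((size net)%:R * E0 *
        expR (- (s - s ^+ 2 * legendre_mass D Q / 2)) ^+ L))%:E)%E.
Proof.
move=> a00 E00 s0 sm w0 n1.
set B := expR (- (s - _)).
(* [None] stands for the constant term [a0], with all factors 1; the term of (k, g) has the factor 1
   outside the L blocks of cube k. *)
pose T := option ('I_n * 'cV[R]_K).
pose ts : seq T := None :: [seq Some (k, g) | k <- index_enum 'I_n, g <- net].
pose c (t : T) : R := if t is Some (k, g) then w k * E0 else a0.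
pose f (t : T) (m : nat) (v : seq R) : R := if t is Some (k, g) then
  (if (m %/ L == k)%N then expR (- (s * cell_form (nth i0 I k) g v)) else 1) else 1.
have sz : size sample_blocks = (n * L)%N by rewrite size_flatten_nseq.
have lb : List.Forall (List.Forall light_density) sample_blocks.
  rewrite /sample_blocks; elim: (I) => [|i J IH] /=; first by constructor.
  apply/List.Forall_app; split => //.
  elim: L => [|L' IHL] /=; constructor => //; exact: light_sample_dens.
have tf t m : tame (size (nth [::] sample_blocks m)) (f t m).
  case: t => [[k g]|]; last exact: tame_cst.
  by rewrite /f; case: (_ == _); [exact: tame_exp_cell_form|exact: tame_cst].
have c0 t : 0 <= c t by case: t => [[k g]|] //=; rewrite mulr_ge0.
have f0 t m v : 0 <= f t m v.
  by case: t => [[k g]|] //=; case: ifP => // _; exact: expR_ge0.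
have E vs : a0 + \sum_(k < n) w k * \sum_(g <- net)
     (E0 * \prod_(l < L) expR (- (s * cell_form (nth i0 I k) g (nth [::] vs (k * L + l)%N)))) =
  \sum_(t <- ts) c t * \prod_(m < size sample_blocks) f t m (nth [::] vs m).
  rewrite big_cons /= [X in _ = _ * X + _]big1// mulr1; congr (_ + _).
  rewrite big_allpairs_dep/=; apply: eq_bigr => k _; rewrite mulr_sumr; apply: eq_bigr => g _.
  rewrite mulrA sz; congr (_ * _).
  by rewrite (prod_block L (fun m => expR (- (s * cell_form (nth i0 I k) g (nth [::] vs m)))) (ltn_ord k)).
rewrite (_ : (fun vs => _) = (fun vs => (\sum_(t <- ts) c t *
   \prod_(m < size sample_blocks) f t m (nth [::] vs m))%:E)); last by apply/funext => vs; rewrite E.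
rewrite iblocks_sum_prod// lee_fin big_cons /=.
have r1 i : rint (sample_dens i) (fun=> 1) = 1.
  rewrite (@rint_cat_normal _ (cell_dens h i) D _ (fun=> 1))//.
  - have := @rint_cell_prod R D h i h0 (fun=> 1) => -[_].
    rewrite (_ : (fun _ => \prod_(d < D) _) = fun=> 1); last first.
      by apply/funext => v; rewrite big1// => d _; rewrite hornerC.
    move=> ->; rewrite big1// => d _.
    transitivity (mean_itv (-1) 1 (('X : {poly R})^`())); first by rewrite derivX.
    by rewrite mean_itvE ?(lt_trans (ltrN10 _))// !hornerX divff// opprK.
  - exact: light_cell_dens.
  - exact: tame_cst.
have nb m : (m < n * L)%N -> nth [::] sample_blocks m = sample_dens (nth i0 I (m %/ L)).
  exact: nth_flatten_nseq.
rewrite big1 ?mulr1; last by move=> [m /= mm] _; rewrite nb ?r1 -?sz.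
rewrite lerD2l big_allpairs_dep/= mulr_suml; apply: ler_sum => k _.
apply: (@le_trans _ _ (\sum_(g <- net) w k * E0 * B ^+ L)); last first.
  rewrite big_const_seq count_predT iter_addr_0 -[leLHS]mulr_natl.
  by rewrite le_eqVlt; apply/orP; left; apply/eqP; ring.
rewrite big_seq [leRHS]big_seq; apply: ler_sum => g gn.
rewrite ler_wpM2l ?mulr_ge0// sz.
pose a (m : nat) := rint (sample_dens (nth i0 I k)) (fun v => expR (- (s * cell_form (nth i0 I k) g v))).
rewrite (eq_bigr (fun m : 'I_(n * L) => if (m %/ L == k)%N then a m else 1)); last first.
  move=> m _; rewrite nb//; case: (boolP (m %/ L == k)%N) => mk.
    by rewrite (eqP mk) /a; congr rint; apply/funext => v; rewrite /f mk.
  rewrite -[RHS](r1 (nth i0 I (m %/ L))); congr rint.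
  by apply/funext => v; rewrite /f (negbTE mk).
rewrite (@prod_block R n L k a (ltn_ord k)) prodr_const card_ord lerXn2r ?nnegrE ?expR_ge0//.
  apply: rint_ge0; first exact/light_density_density/light_sample_dens.
  by move=> v _; exact: expR_ge0.
apply: rint_sample_exp => //; exact: n1.
Qed.

Lemma blocks_supp_sample vs k l : blocks_supp sample_blocks vs -> (k < n)%N -> (l < L)%N ->
  cube h (nth i0 I k) (vec_of_seq D (nth [::] vs (k * L + l)%N)).
Proof.
move=> supp kn lL.
have mm : (k * L + l < n * L)%N.
  by apply: (@leq_trans (k.+1 * L)); [rewrite mulSn addnC ltn_add2r|rewrite leq_mul2r kn orbT].
have := all2_nth [::] [::] supp (n := (k * L + l)%N).
rewrite size_flatten_nseq => /(_ mm) /andP[/eqP sw hw].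
have L0 : (0 < L)%N by exact: leq_ltn_trans lL.
rewrite (nth_flatten_nseq _ _ i0)// divnMDl// (divn_small lL) addn0 in sw hw.
set w := nth [::] vs _ in sw hw *; rewrite size_sample_dens in sw.
have -> : vec_of_seq D w = vec_of_seq D (take D w).
  by apply/colP => d; rewrite !mxE nth_take.
apply: cell_dens_supp => //; first by rewrite size_takel// sw leq_addr.
have := size_cell_dens h (nth i0 I k); move: hw; rewrite /sample_dens.
move: (cell_dens _ _) => ds hw sds; rewrite -sds.
elim: ds w hw {sw mm sds} => [|d ds IH] [|x w] //= /andP[-> hw] /=; exact: IH.
Qed.

End BadEvent.

(** * Spectral norm, cubes and the size of an Euler step *)

Section Geometry.
Context {R : realType} {D : nat}.
Implicit Types (x u z : 'cV[R]_D) (i j : 'I_D -> int).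

Lemma norm2_ge0 x : 0 <= norm2 x. Proof. exact: sqrtr_ge0. Qed.

Lemma coord_le_norm2 x d : `|x d 0| <= norm2 x.
Proof.
rewrite -ler_sqr ?nnegrE ?norm2_ge0// norm2_sqr real_normK ?num_real//.
by rewrite /sqnorm (bigD1 d)//= lerDl sumr_ge0// => e _; exact: sqr_ge0.
Qed.

Lemma norm2_le_l1norm x : norm2 x <= l1norm x.
Proof.
rewrite -ler_sqr ?nnegrE ?norm2_ge0 ?l1norm_ge0// norm2_sqr expr2 {1}/l1norm mulr_suml.
apply: ler_sum => d _; rewrite -real_normK ?num_real// expr2 ler_wpM2l//.
by rewrite /l1norm (bigD1 d)//= lerDl sumr_ge0.
Qed.

Lemma norm2Z (k : R) x : norm2 (k *: x) = `|k| * norm2 x.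
Proof. by rewrite /norm2 -/(sqnorm _) -/(sqnorm x) sqnormZ sqrtrM ?sqr_ge0// sqrtr_sqr. Qed.

(** For D > 0 there is a unit vector, and [quad_le] bounds the set in question, so the supremum in
    [spec_norm] is not a default value. *)
Lemma spec_norm_le (S : 'M[R]_D) z : (0 < D)%N ->
  0 <= spec_norm S /\ norm2 (S *m z) <= spec_norm S * norm2 z.
Proof.
move=> D0; pose E := [set norm2 (S *m v) | v in [set v : 'cV[R]_D | norm2 v = 1]].
have [c c0 hc] := quad_le (S^T *m S).
have Eub : has_ubound E.
  exists (Num.sqrt c) => _ [v /= v1 <-]; rewrite /norm2 ler_wsqrtr// -/(sqnorm _) -quad_gram.
  by apply: le_trans (hc v) _; rewrite -norm2_sqr v1 expr1n mulr1.
have le v : norm2 v = 1 -> norm2 (S *m v) <= spec_norm S.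
  by move=> v1; apply: ub_le_sup => //; exists v.
split.
  pose e1 : 'cV[R]_D := delta_mx (Ordinal D0) 0.
  apply: le_trans (norm2_ge0 (S *m e1)) (le _ _).
  rewrite /norm2 (bigD1 (Ordinal D0))//= mxE !eqxx expr1n big1 ?addr0 ?sqrtr1// => d d0.
  by rewrite mxE (negbTE d0) expr0n.
have [->|z0] := eqVneq z 0.
  by rewrite mulmx0 -(scale0r (0 : 'cV[R]_D)) norm2Z normr0 !mul0r mulr0.
have nz : 0 < norm2 z.
  by rewrite /norm2 sqrtr_gt0 lt_neqAle eq_sym -/(sqnorm z) sqnorm_eq0 z0 sqnorm_ge0.
have /le : norm2 ((norm2 z)^-1 *: z) = 1.
  by rewrite norm2Z ger0_norm ?invr_ge0 ?norm2_ge0// mulVf// gt_eqF.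
by rewrite -scalemxAr norm2Z ger0_norm ?invr_ge0 ?norm2_ge0// mulrC ler_pdivrMr.
Qed.

Lemma spec_norm_linear_bound (S : 'M[R]_D) c : (0 < D)%N -> spec_norm S <= c -> linear_bound c S.
Proof.
move=> D0 Sc z d; have [s0 sz] := spec_norm_le S z D0.
apply: le_trans (coord_le_norm2 _ _) _; apply: le_trans sz _.
by apply: ler_pM => //; [exact: norm2_ge0|exact: norm2_le_l1norm].
Qed.

Lemma cube_inj (h : R) i j x : 0 < h -> cube h i x -> cube h j x -> i = j.
Proof.
move=> h0 ci cj; apply/funext => d.
have /andP[i1 i2] := ci d; have /andP[j1 j2] := cj d.
have a1 : (i d < j d + 1)%R.
  by rewrite -(ltr_int R) intrD1 -(ltr_pM2l h0); exact: lt_le_trans i1 j2.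
have a2 : (j d < i d + 1)%R.
  by rewrite -(ltr_int R) intrD1 -(ltr_pM2l h0); exact: lt_le_trans j1 i2.
by apply/eqP; rewrite eq_le -!ltzD1 a1 a2.
Qed.

Lemma Iseq_uniq (h r1 : R) : uniq (Iseq D h r1).
Proof.
rewrite /Iseq filter_uniq// map_inj_uniq ?enum_uniq// => k k' kk.
apply/ffunP => d; apply/val_inj; have := congr1 (fun f => f d) kk.
by move=> /= /addIr [].
Qed.

Lemma Iseq_cover (h r1 : R) x : 0 < h -> norm2 x <= r1 ->
  exists2 k, (k < size (Iseq D h r1))%N & cube h (nth (fun=> 0) (Iseq D h r1) k) x.
Proof.
(* The cubes are open on the left, hence the ceiling minus 1 and not the floor. *)
move=> h0 xr; pose i : 'I_D -> int := fun d => Num.ceil (x d 0 / h) - 1.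
have ci : cube h i x.
  move=> d; rewrite /i intrB subrK; apply/andP; split.
    rewrite mulrC -ltr_pdivlMr// ltrBlDr.
    by have := ceilB1_lt (x d 0 / h); rewrite intrB; lra.
  by rewrite mulrC -ler_pdivrMr// ceil_ge.
suff : i \in Iseq D h r1 by move=> /(nthP (fun=> 0))[k kn kE]; exists k => //; rewrite kE.
rewrite /Iseq mem_filter; apply/andP; split.
  by apply/asboolP; exists x.
set M := (Num.truncn (r1 / h)).+1.
have M1 : r1 / h < M%:R by exact: truncnS_gt.
have bnd d : - (M%:Z) <= i d /\ i d <= M%:Z.
  have /andP[i1 i2] := ci d; have := coord_le_norm2 x d; rewrite ler_norml => /andP[x1 x2].
  have MZ : (M%:Z)%:~R = M%:R :> R by [].
  have hM : r1 < h * M%:R by rewrite mulrC -ltr_pdivrMr.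
  split.
    rewrite -ltzD1 -(ltr_int R) intrD1 intrN -(ltr_pM2l h0) MZ.
    by apply: lt_le_trans i2; rewrite mulrN; lra.
  apply: ltW; rewrite -(ltr_int R) -(ltr_pM2l h0) MZ.
  by apply: lt_le_trans i1 _; lra.
pose k : {ffun 'I_D -> 'I_(M.*2.+1)} := [ffun d => inord (absz (i d + M%:Z)%R)].
apply/mapP; exists k; first by rewrite mem_enum.
apply/funext => d; have [b1 b2] := bnd d.
rewrite /k ffunE inordK; last by rewrite ltnS; lia.
by rewrite gez0_abs ?addrK//; lia.
Qed.

(** Only comparisons with [<=] occur on the right, the form for which [rseq_measurable_le] gives
    measurability. *)
Lemma indic_cubeE (h : R) i x : \1_(cube h i) x =
  \prod_(d < D) ((1 - ((x d 0 <= h * (i d)%:~R)%R : bool)%:R) *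
     ((x d 0 <= h * ((i d)%:~R + 1))%R : bool)%:R) :> R.
Proof.
rewrite indicE; have [xi|xi] := boolP (x \in cube h i).
  rewrite big1// => d _; have := set_mem xi d => /andP[h1 h2].
  by rewrite h2 leNgt h1 subr0 mul1r.
have [d hd] : exists d, ~~ (h * (i d)%:~R < x d 0 <= h * ((i d)%:~R + 1)).
  apply/existsP; apply: contraNT xi; rewrite negb_exists => /forallP hx.
  by apply/mem_set => d; have := hx d; rewrite negbK.
rewrite (bigD1 d)//=; move: hd; rewrite negb_and -leNgt => /orP[->|/negbTE ->].
  by rewrite subrr !mul0r.
by rewrite mulr0 mul0r.
Qed.

Lemma vmeasurable_indic_cube (h : R) i : vmeasurable (fun x => \1_(cube h i) x : R).
Proof.
rewrite /vmeasurable (_ : (fun _ => _) = fun v => \prod_(d < D)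
  ((1 + (-1) * ((vec_of_seq D v d 0 <= h * (i d)%:~R)%R : bool)%:R) *
     ((vec_of_seq D v d 0 <= h * ((i d)%:~R + 1))%R : bool)%:R)); last first.
  by apply/funext => v; rewrite indic_cubeE; apply: eq_bigr => d _; rewrite mulN1r.
apply: rseq_measurable_prod => d; apply: rseq_measurableM.
  apply: rseq_measurableD; first exact: rseq_measurable_cst.
  apply: rseq_measurableM; first exact: rseq_measurable_cst.
  by apply: rseq_measurable_le; [exact: vmeasurable_coord|exact: rseq_measurable_cst].
by apply: rseq_measurable_le; [exact: vmeasurable_coord|exact: rseq_measurable_cst].
Qed.

Lemma sum_indic_cube_le1 (h : R) (I : seq ('I_D -> int)) x : 0 < h -> uniq I ->
  \sum_(k < size I) (\1_(cube h (nth (fun=> 0) I k)) x : R) <= 1.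
Proof.
move=> h0 uI; have [[k xk]|nok] := pselect (exists k : 'I_(size I), x \in cube h (nth (fun=> 0) I k)).
  rewrite (bigD1 k)//= indicE xk big1 ?addr0// => j jk; rewrite indicE.
  case: (boolP (_ \in _)) => // xj; exfalso; move/eqP: jk; apply; apply/val_inj/eqP => /=.
  by rewrite -(nth_uniq (fun=> 0) (ltn_ord j) (ltn_ord k) uI); apply/eqP; exact: cube_inj (set_mem xj) (set_mem xk).
rewrite big1// => k _; rewrite indicE; case: (boolP (_ \in _)) => // xk.
by exfalso; apply: nok; exists k.
Qed.

Lemma euler_cell_coord (h : R) i (b : 'cV[R]_D -> 'cV[R]_D) (sigma : 'cV[R]_D -> 'M[R]_D)
    (c Delta r dl : R) u z : 0 < h -> 0 <= c -> 0 < Delta -> 0 <= r ->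
  (forall x d, `|b x d 0| <= c) -> (forall x, linear_bound c (sigma x)) ->
  (h / 2)^-1 * (Delta * c + Num.sqrt Delta * (c * (D%:R * r))) <= dl ->
  forall d, `|cell_coord h i (euler b sigma Delta u (truncv r z)) d 0 - cell_coord h i u d 0| <= dl.
Proof.
move=> h0 c0 D0 r0 bc sc dlh d; apply: le_trans dlh.
rewrite !cell_coordE -mulrBr normrM gtr0_norm ?invr_gt0 ?divr_gt0// ler_wpM2l ?invr_ge0 ?divr_ge0 ?(ltW h0)//.
rewrite opprB addrA subrK /euler.
have := sc u (truncv r z) d; set v := sigma u *m _ => vb.
have -> : (u + Delta *: b u + Num.sqrt Delta *: v) d 0 - u d 0 =
    Delta * b u d 0 + Num.sqrt Delta * v d 0 by rewrite !mxE; ring.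
apply: le_trans (ler_normD _ _) _; rewrite !normrM (gtr0_norm D0) (ger0_norm (sqrtr_ge0 _)).
apply: lerD; first by rewrite ler_wpM2l ?(ltW D0).
rewrite ler_wpM2l ?sqrtr_ge0//; apply: le_trans vb _; rewrite ler_wpM2l//.
apply: (@le_trans _ _ (\sum_(e < D) r)); last by rewrite sumr_const card_ord mulr_natl.
by apply: ler_sum => e _; exact: trunc_le.
Qed.

End Geometry.

(** * The mean squared error for one step size, with all constants given *)

Section MeanSquaredError.
Context {R : realType}.
Variables (D Q L : nat) (iota : 'I_D -> nat) (y f : 'cV[R]_D -> R)
  (b : 'cV[R]_D -> 'cV[R]_D) (sigma : 'cV[R]_D -> 'M[R]_D)
  (C1f C2f Delta tau gcube ccube c1t c2t g1t g2t : R).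
Local Notation phi := (@normal_pdf R 0 1).
Local Notation K := (nK D Q).
Local Notation h := (alg_h Delta gcube ccube).
Local Notation r2 := (alg_r2 Delta c2t g2t).
Local Notation I := (alg_I D C2f Delta gcube ccube c1t g1t).
Local Notation n := (size I).
Local Notation alpha0 := (c1t * powR Delta g1t).
Local Notation chi := (chi2q D alpha0).
Local Notation cell k := (alg_i C2f Delta gcube ccube c1t g1t k).
Local Notation Xs smp k l := (alg_X b sigma Delta c2t g2t smp k l).
Local Notation A smp k := (alg_A b sigma C2f L Q Delta gcube ccube c1t c2t g1t g2t smp k).
Local Notation alpha smp k :=
  (alg_alpha y b sigma C2f L Q Delta tau gcube ccube c1t c2t g1t g2t smp k).
Local Notation local_fit smp k x := (\sum_(kk < K) alpha smp k kk 0 *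
  gaussE (fun z : 'cV[R]_D => alg_eta Q Delta gcube ccube (cell k) kk
     (euler b sigma Delta x (truncv r2 z)) * hermite_mi iota Delta (truncv r2 z))).
Local Notation zhat smp x :=
  (alg_zhat y b sigma C2f L Q Delta iota tau gcube ccube c1t c2t g1t g2t smp x).
Local Notation tgt x := (target y b sigma Delta iota x).

(** [CT] bounds the target, [err] the error in a cube with a good design matrix, [dl] the move from
    U_l to X_l in cell coordinates; [net] with the threshold [tau'] detects bad matrices, and [s] is
    the Chernoff parameter. *)
Variables (CT err s tau' dl : R) (net : seq 'cV[R]_K).
Hypotheses (h0 : 0 < h) (C1f0 : 0 < C1f) (C2f0 : 0 < C2f).
Hypotheses (alpha_gt0 : 0 < alpha0) (alpha_lt1 : alpha0 < 1) (dl1 : dl <= 1).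
Hypotheses (s0 : 0 <= s) (sm : s * legendre_mass D Q <= 2).
Hypothesis f0 : forall x, 0 <= f x.
Hypothesis fenv : forall x, f x <= envelope C1f C2f x.
Hypothesis target_le : forall x, `|tgt x| <= CT.
Hypothesis perturbation : forall i u z d,
  `|cell_coord h i (euler b sigma Delta u (truncv r2 z)) d 0 - cell_coord h i u d 0| <= dl.
Hypothesis good_le : forall (smp : nat -> nat -> seq R) (k : nat) x, cube h (cell k) x ->
  (forall (l : 'I_L) d, `|cell_coord h (cell k) (Xs smp k l) d 0| <= 2) ->
  tau * L%:R <= smin_sq (A smp k) -> `|tgt x - local_fit smp k x| <= err.
Hypothesis net_unit : forall g, g \in net -> sqnorm g = 1.
Hypothesis net_bad : forall (Y U : 'I_L -> 'cV[R]_D),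
  (forall l d, `|U l d 0| <= 1) -> (forall l d, `|Y l d 0 - U l d 0| <= dl) ->
  smin_sq (\matrix_(l < L, k < K) pj (@jnth D Q k) (Y l)) < tau * L%:R ->
  exists2 g, g \in net & \sum_l (\sum_k g k 0 * pj (@jnth D Q k) (U l)) ^+ 2 <= tau' * L%:R.

(** Exponential Markov bound in place of the indicator of a bad design matrix: a term of the sum is
    at least 1 as soon as the empirical sum of its net vector is at most tau' L. *)
Definition bad_weight (smp : nat -> nat -> seq R) (k : nat) : R :=
  \sum_(g <- net) (expR (s * (tau' * L%:R)) *
    \prod_(l < L) expR (- (s * cell_form h (nth (fun=> 0) I k) g (smp k l)))).

Lemma bad_weight_ge0 smp k : 0 <= bad_weight smp k.
Proof.
apply: sumr_ge0 => g _; rewrite mulr_ge0 ?expR_ge0// prodr_ge0//.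
Qed.

(** The samples enter only through exponentials with one factor per sample, so that the mean over
    them can be computed. *)
Definition majorant smp x : R := err ^+ 2 +
  CT ^+ 2 * ((C2f * chi < norm2 x ^+ 2)%R : bool)%:R +
  \sum_(k < n) (CT ^+ 2 * bad_weight smp k) * \1_(cube h (nth (fun=> 0) I k)) x.

Lemma CT2_ge x : (tgt x) ^+ 2 <= CT ^+ 2.
Proof.
have CT0 : 0 <= CT by apply: le_trans (target_le 0).
by rewrite -[leLHS]real_normK ?num_real// ler_sqr ?nnegrE.
Qed.

Let chi_ge0 : 0 <= chi. Proof. by have [] := @chi2q_tail R D alpha0 alpha_gt0 alpha_lt1. Qed.

Lemma pointwise_error (smp : nat -> nat -> seq R) x :
  (forall k (l : 'I_L), (k < n)%N -> cube h (nth (fun=> 0) I k) (vec_of_seq D (smp k l))) ->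
  (tgt x - zhat smp x) ^+ 2 <= majorant smp x.
Proof.
move=> hU.
have e0 : 0 <= err ^+ 2 by exact: sqr_ge0.
have c0 : 0 <= CT ^+ 2 by exact: sqr_ge0.
have i0 k : 0 <= (CT ^+ 2 * bad_weight smp k) * (\1_(cube h (nth (fun=> 0) I k)) x : R).
  by apply: mulr_ge0; [apply: mulr_ge0 => //; exact: bad_weight_ge0|rewrite indicE].
have S0 : 0 <= \sum_(k < n) (CT ^+ 2 * bad_weight smp k) * (\1_(cube h (nth (fun=> 0) I k)) x : R).
  by apply: sumr_ge0 => k _; exact: i0.
have b0 : 0 <= CT ^+ 2 * ((C2f * chi < norm2 x ^+ 2)%R : bool)%:R by rewrite mulr_ge0.
have [[k xk]|nok] := pselect (exists k : 'I_n, cube h (nth (fun=> 0) I k) x).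
  have zE : zhat smp x = local_fit smp k x.
    rewrite /alg_zhat (bigD1 k)//= indicE mem_set// mul1r [X in _ + X]big1 ?addr0// => j jk.
    rewrite indicE; case: (boolP (_ \in _)) => [xj|_]; last by rewrite mul0r.
    exfalso; move/eqP: jk; apply; apply/val_inj/eqP => /=.
    rewrite -(nth_uniq (fun=> 0) (ltn_ord j) (ltn_ord k) (Iseq_uniq _ _)).
    by apply/eqP; exact: cube_inj h0 (set_mem xj) xk.
  have U1 (l : 'I_L) d : `|cell_coord h (cell k) (vec_of_seq D (smp k l)) d 0| <= 1.
    by have := cube_cell_coord (i := cell k) (hU k l (ltn_ord k)) d; rewrite -ler_norml.
  have XU (l : 'I_L) d : `|cell_coord h (cell k) (Xs smp k l) d 0 -
      cell_coord h (cell k) (vec_of_seq D (smp k l)) d 0| <= dl by exact: perturbation.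
  have [good|bad] := leP (tau * L%:R) (smin_sq (A smp k)).
    rewrite zE; have := good_le (smp := smp) (k := k) xk _ good.
    have X2 (l : 'I_L) d : `|cell_coord h (cell k) (Xs smp k l) d 0| <= 2.
      rewrite -(subrK (cell_coord h (cell k) (vec_of_seq D (smp k l)) d 0) (cell_coord h (cell k) (Xs smp k l) d 0)).
      by apply: le_trans (ler_normD _ _) (le_trans (lerD (XU l d) (U1 l d)) _); have := dl1; lra.
    move=> /(_ X2) ee; have : (tgt x - local_fit smp k x) ^+ 2 <= err ^+ 2.
      have err0 : 0 <= err by apply: le_trans ee.
      by rewrite -[leLHS]real_normK ?num_real// ler_sqr ?nnegrE.
    by rewrite /majorant; lra.
  have -> : zhat smp x = 0.
    rewrite zE big1// => kk _; rewrite /alg_alpha leNgt bad/= mxE mul0r//.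
  rewrite subr0; apply: le_trans (CT2_ge x) _.
  (* The term of the net vector that witnesses the failure is at least 1, and the others are
     nonnegative. *)
  have W1 : 1 <= bad_weight smp k.
    have [g gn gle] := net_bad (Y := fun l => cell_coord h (cell k) (Xs smp k l))
      (U := fun l => cell_coord h (cell k) (vec_of_seq D (smp k l))) U1 XU bad.
    rewrite /bad_weight (perm_big _ (perm_to_rem gn)) big_cons.
    rewrite -expR_sum -expRD -[leLHS]addr0 lerD//.
      rewrite -[leLHS]expR0 ler_expR sumrN subr_ge0 -mulr_sumr ler_wpM2l//.
    by rewrite sumr_ge0 => [|g' _]; rewrite ?mulr_ge0 ?expR_ge0// prodr_ge0.
  have : CT ^+ 2 <= \sum_(j < n) (CT ^+ 2 * bad_weight smp j) * (\1_(cube h (nth (fun=> 0) I j)) x : R).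
    rewrite (bigD1 k)//= indicE mem_set// mulr1 -[leLHS]addr0 lerD//.
      by rewrite ler_peMr.
    by apply: sumr_ge0 => j _; exact: i0.
  by rewrite /majorant; lra.
have -> : zhat smp x = 0.
  rewrite /alg_zhat big1// => k _; rewrite indicE; case: (boolP (_ \in _)) => [xj|_]; last by rewrite mul0r.
  by exfalso; apply: nok; exists k; exact: set_mem xj.
rewrite subr0; apply: le_trans (CT2_ge x) _.
(* The cubes of [I] cover the ball of radius r1, so a point in none of them lies outside it. *)
have far : C2f * chi < norm2 x ^+ 2.
  rewrite ltNge; apply/negP => xr; apply: nok.
  have [k kn kx] : exists2 k, (k < n)%N & cube h (nth (fun=> 0) I k) x.
    apply: Iseq_cover => //; rewrite -ler_sqr ?nnegrE ?norm2_ge0 ?sqrtr_ge0//.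
    by apply: le_trans xr _; rewrite [leRHS]sqr_sqrtr ?mulr_ge0 ?(ltW C2f0)//.
  by exists (Ordinal kn).
by rewrite /majorant far mulr1; lra.
Qed.

Lemma vmeasurable_far : vmeasurable (fun x : 'cV[R]_D => ((C2f * chi < norm2 x ^+ 2)%R : bool)%:R : R).
Proof.
rewrite /vmeasurable (_ : (fun _ => _) = fun v => 1 + (-1) *
   ((\sum_(d < D) (vec_of_seq D v d 0) * (vec_of_seq D v d 0) <= C2f * chi)%R : bool)%:R); last first.
  apply/funext => v; rewrite norm2_sqr /sqnorm ltNge mulN1r.
  rewrite (eq_bigr (fun d => vec_of_seq D v d 0 * vec_of_seq D v d 0)); last by move=> d _; rewrite expr2.
  by case: (_ <= _); rewrite /= ?subrr ?subr0.
apply: rseq_measurableD; first exact: rseq_measurable_cst.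
apply: rseq_measurableM; first exact: rseq_measurable_cst.
apply: rseq_measurable_le; last exact: rseq_measurable_cst.
by apply: rseq_measurable_sum => d; apply: rseq_measurableM; exact: vmeasurable_coord.
Qed.

Definition cell_mass (k : nat) : R :=
  gaussE (fun z : 'cV[R]_D => \1_(cube h (nth (fun=> 0) I k)) (Num.sqrt C2f *: z) : R).

Let indic_scaled (F : 'cV[R]_D -> R) : vmeasurable F -> (forall x, 0 <= F x <= 1) ->
  vtame (fun z => F (Num.sqrt C2f *: z)).
Proof.
move=> mF F01; apply: (@vtame_bound _ _ (fun z => F (Num.sqrt C2f *: z)) 4^-1 1) => //.
  move=> dX Y c mc; have mc' i : measurable_fun setT (fun x => Num.sqrt C2f * c i x) by exact: measurable_funM.
  have := mF _ Y _ mc'; congr measurable_fun; apply/funext => x; congr F.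
  by apply/colP => d; rewrite !mxE !nth_mkseq.
move=> z; have /andP[F0 F1] := F01 (Num.sqrt C2f *: z); rewrite ger0_norm// mul1r.
by apply: le_trans F1 _; rewrite vweight_ge1// invr_ge0.
Qed.

Let tcube k : vtame (fun z => \1_(cube h (nth (fun=> 0) I k)) (Num.sqrt C2f *: z) : R).
Proof.
apply: indic_scaled; first exact: vmeasurable_indic_cube.
by move=> x; rewrite indicE; case: (_ \in _); rewrite ?ler01 ?lexx.
Qed.

Lemma cell_mass_ge0 k : 0 <= cell_mass k.
Proof.
rewrite /cell_mass gaussE_rint; apply: rint_ge0.
  exact/light_density_density/light_density_nseq_normal.
by move=> v _; rewrite indicE.
Qed.

(** The cubes are disjoint. Weighting by these masses is what keeps the number of cubes out of the
    final bound. *)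
Lemma sum_cell_mass_le1 : \sum_(k < n) cell_mass k <= 1.
Proof.
rewrite /cell_mass -(@gaussE_sum _ _ _ _ (fun (k : 'I_n) z => \1_(cube h (nth (fun=> 0) I k)) (Num.sqrt C2f *: z) : R)); last first.
  by move=> k; exact: tcube.
rewrite -(rint_nseq_normal1 (R := R) D) gaussE_rint; apply: ler_rint; rewrite ?size_nseq.
- exact: light_density_nseq_normal.
- by apply: tame_sum => k; exact: tcube.
- exact: tame_cst.
- by move=> v _; apply: sum_indic_cube_le1 => //; exact: Iseq_uniq.
Qed.

Lemma gaussE_majorant smp :
  gaussE (fun z => majorant smp (Num.sqrt C2f *: z)) <=
  err ^+ 2 + CT ^+ 2 * alpha0 + \sum_(k < n) (CT ^+ 2 * bad_weight smp k) * cell_mass k.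
Proof.
have tfar : vtame (fun z : 'cV[R]_D => ((C2f * chi < norm2 (Num.sqrt C2f *: z) ^+ 2)%R : bool)%:R : R).
  apply: (indic_scaled vmeasurable_far) => x.
  by case: (_ < _); rewrite ?ler01 ?lexx.
have ts : vtame (fun z => \sum_(k < n) (CT ^+ 2 * bad_weight smp k) *
    (\1_(cube h (nth (fun=> 0) I k)) (Num.sqrt C2f *: z) : R)).
  by apply: tame_sum => k; apply: tameZ; exact: tcube.
have tc : vtame (fun _ : 'cV[R]_D => err ^+ 2) by exact: (@tame_cst R D).
have tf2 : vtame (fun z : 'cV[R]_D => CT ^+ 2 * ((C2f * chi < norm2 (Num.sqrt C2f *: z) ^+ 2)%R : bool)%:R).
  exact: tameZ.
rewrite /majorant gaussED//; last exact: tameD.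
rewrite gaussED// gaussEZ//.
rewrite (@gaussE_sum _ _ _ _ (fun (k : 'I_n) z => (CT ^+ 2 * bad_weight smp k) *
    (\1_(cube h (nth (fun=> 0) I k)) (Num.sqrt C2f *: z) : R))); last first.
  by move=> k; apply: tameZ; exact: tcube.
apply: lerD; last first.
  by apply: ler_sum => k _; rewrite gaussEZ//; exact: tcube.
apply: lerD.
  have -> : (fun _ : 'cV[R]_D => err ^+ 2) = fun=> err ^+ 2 * 1 by rewrite mulr1.
  rewrite gaussEZ; last exact: (@tame_cst R D).
  by rewrite gaussE_rint rint_nseq_normal1 mulr1.
rewrite ler_wpM2l ?sqr_ge0//.
have [_ tail] := @chi2q_tail R D alpha0 alpha_gt0 alpha_lt1.
apply: le_trans tail; rewrite le_eqVlt; apply/orP; left; apply/eqP.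
rewrite /tailE; congr gaussE; apply/funext => z.
rewrite norm2Z exprMn real_normK ?num_real// sqr_sqrtr ?(ltW C2f0)//.
by rewrite ltr_pM2l.
Qed.

Lemma majorant_bounded smp : vmeasurable (majorant smp) /\
  forall x, 0 <= majorant smp x <= err ^+ 2 + CT ^+ 2 + \sum_(k < n) CT ^+ 2 * bad_weight smp k.
Proof.
have w0 k : 0 <= CT ^+ 2 * bad_weight smp k by rewrite mulr_ge0 ?sqr_ge0 ?bad_weight_ge0.
split.
  apply: rseq_measurableD.
    apply: rseq_measurableD; first exact: rseq_measurable_cst.
    by apply: rseq_measurableM; [exact: rseq_measurable_cst|exact: vmeasurable_far].
  apply: rseq_measurable_sum => k.
  by apply: rseq_measurableM; [exact: rseq_measurable_cst|exact: vmeasurable_indic_cube].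
move=> x; apply/andP; split.
  apply: addr_ge0; last by apply: sumr_ge0 => k _; apply: mulr_ge0 => //; rewrite indicE.
  by apply: addr_ge0; [exact: sqr_ge0|apply: mulr_ge0 => //; exact: sqr_ge0].
rewrite /majorant; apply: lerD.
  rewrite lerD2l ler_piMr ?sqr_ge0//; by case: (_ < _).
by apply: ler_sum => k _; rewrite ler_piMr// indicE; case: (_ \in _).
Qed.

(** For fixed samples the integral over x is bounded first, by the envelope and the Gaussian mean of
    the majorant; what remains is a sum of weights [w k] times [bad_weight], to which
    [iblocks_exp_le] applies. *)
Lemma alg_mse_le :
  (alg_mse y b sigma C2f L Q Delta iota tau gcube ccube c1t c2t g1t g2t f <=
   (C1f * (err ^+ 2 + CT ^+ 2 * alpha0 + CT ^+ 2 * ((size net)%:R * expR (s * (tau' * L%:R)) *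
      expR (- (s - s ^+ 2 * legendre_mass D Q / 2)) ^+ L)))%:E)%E.
Proof.
pose w (k : 'I_n) := C1f * CT ^+ 2 * cell_mass k.
pose a0 := C1f * (err ^+ 2 + CT ^+ 2 * alpha0).
have w0 k : 0 <= w k.
  by apply: mulr_ge0 (cell_mass_ge0 k); apply: mulr_ge0; [exact: ltW|exact: sqr_ge0].
have a00 : 0 <= a0.
  apply: mulr_ge0; first exact: ltW.
  by apply: addr_ge0; [exact: sqr_ge0|apply: mulr_ge0; [exact: sqr_ge0|exact: ltW]].
have E00 : 0 <= expR (s * (tau' * L%:R)) by exact: expR_ge0.
have main := @iblocks_exp_le R D Q L h I h0 a0 _ s w net a00 E00 s0 sm w0 net_unit.
have d1 : List.Forall density (nseq D (fun=> 1 : R)).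
  by elim: (D) => [|m IH]; constructor => //; split.
have light : List.Forall (List.Forall density) (sample_blocks L h I).
  rewrite /sample_blocks; elim: (I) => [|i J IH] /=; first by constructor.
  apply/List.Forall_app; split => //.
  elim: (L) => [|L' IHL] /=; constructor => //.
  exact/light_density_density/light_sample_dens.
apply: le_trans (le_trans _ main) _; last first.
  rewrite lee_fin /a0 [leRHS]mulrDr lerD2l /w -mulr_sumr.
  set T := _ * expR _ ^+ L; have T0 : 0 <= T.
    by rewrite /T mulr_ge0 ?exprn_ge0 ?expR_ge0// mulr_ge0 ?expR_ge0.
  have := sum_cell_mass_le1; set S := \sum_(k < n) _ => S1.
  have : 0 <= C1f * CT ^+ 2 * T.
    by apply: mulr_ge0 => //; apply: mulr_ge0; [exact: ltW|exact: sqr_ge0].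
  by rewrite -mulrA => h1; rewrite -[leRHS]mulr1 -mulrA mulrC; nra.
rewrite /alg_mse; apply: le_iblocks => //.
  move=> vs; apply: iint_ge0 => // v _; rewrite lee_fin mulr_ge0 ?sqr_ge0//.
move=> vs supp; pose smp k l := nth [::] vs (k * L + l)%N.
have hU k (l : 'I_L) : (k < n)%N -> cube h (nth (fun=> 0) I k) (vec_of_seq D (smp k l)).
  by move=> kn; exact: blocks_supp_sample supp kn (ltn_ord l).
have [mm mb] := majorant_bounded smp.
apply: (@le_trans _ _ (lebD (fun x => (envelope C1f C2f x * majorant smp x)%:E))).
  apply: le_iint => // v _; rewrite lee_fin.
    by rewrite mulr_ge0 ?sqr_ge0.
  rewrite mulrC; apply: ler_pM => //; [exact: sqr_ge0|exact: pointwise_error].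
rewrite (lebD_envelope C1f0 C2f0 mm mb) lee_fin.
apply: le_trans (ler_wpM2l (ltW C1f0) (gaussE_majorant smp)) _.
rewrite mulrDr -/a0 lerD2l mulr_sumr; apply: ler_sum => k _.
by rewrite /w /bad_weight le_eqVlt; apply/orP; left; apply/eqP; ring.
Qed.

End MeanSquaredError.

(** * Behaviour of the parameters as the step size tends to 0 *)

Section SmallStep.
Context {R : realType}.
Implicit Types (x c d eta gam g Delta : R).

Lemma near_powR_le eta d : 0 < eta -> 0 < d -> \forall x \near 0^'+, powR x eta <= d.
Proof.
move=> eta0 d0; near=> x.
have xd : x <= powR d eta^-1 by near: x; apply: nbhs_right_le; exact: powR_gt0.
have -> : d = powR (powR d eta^-1) eta by rewrite -powRrM mulVf ?gt_eqF// powRr1 ?ltW.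
by apply: ge0_ler_powR; rewrite ?nnegrE ?powR_ge0// ltW.
Unshelve. all: by end_near. Qed.

Lemma near_ln_ge1 : \forall x \near (0 : R)^'+, 1 <= ln x^-1.
Proof.
near=> x.
have xe : x <= expR (-1) by near: x; apply: nbhs_right_le; exact: expR_gt0.
rewrite lnV ?posrE// lerNr -[leRHS](expRK (-1)) ler_ln ?posrE ?expR_gt0//.
Unshelve. all: by end_near. Qed.

Lemma near_truncation_level c2t g : 0 < c2t -> 0 < g ->
  \forall x \near 0^'+, 1 <= c2t * powR x (- g) * ln x^-1.
Proof.
move=> c0 g0; near=> x.
have l1 : 1 <= ln x^-1 by near: x; exact: near_ln_ge1.
have xc : powR x g <= c2t by near: x; exact: near_powR_le.
rewrite -[leLHS]mulr1; apply: ler_pM => //.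
by rewrite powRN ler_pdivlMr ?powR_gt0// mul1r.
Unshelve. all: by end_near. Qed.

Lemma alg_r2_sqr Delta c2t g : 1 <= c2t * powR Delta (- g) * ln Delta^-1 ->
  alg_r2 Delta c2t g ^+ 2 = 2 * ln (c2t * powR Delta (- g) * ln Delta^-1).
Proof. by move=> Y1; rewrite sqr_sqrtr// mulr_ge0// ln_ge0. Qed.

(** With Y the argument of the logarithm in r2, exp(-r2^2/6) is Y^(-1/3). This turns Delta^(-3k/2)
    into Delta^(k/2), and the logarithmic factor of Y, being at least 1, contributes at most 1. *)
Lemma expR_alg_r2_le Delta c2t (k : R) : 0 < c2t -> 0 < Delta -> 1 <= ln Delta^-1 ->
  1 <= c2t * powR Delta (- (3 / 2 * k)) * ln Delta^-1 ->
  expR (- (alg_r2 Delta c2t (3 / 2 * k) ^+ 2 / 6)) <= powR c2t (- 3^-1) * powR Delta (k / 2).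
Proof.
move=> c0 D0 l1 Y1; rewrite alg_r2_sqr//; set Y := c2t * _ * ln _ in Y1 *.
have Y0 : 0 < Y by exact: lt_le_trans ltr01 Y1.
have -> : - (2 * ln Y / 6) = ln Y * - 3^-1 by field.
rewrite expRM lnK ?posrE// /Y.
have P0 : 0 <= c2t * powR Delta (- (3 / 2 * k)) by rewrite mulr_ge0 ?powR_ge0 ?ltW.
rewrite powRM ?(le_trans ler01 l1)//.
rewrite powRM ?powR_ge0 ?(ltW c0)// -powRrM.
have -> : - (3 / 2 * k) * - 3^-1 = k / 2 by field.
rewrite ler_piMr ?mulr_ge0 ?powR_ge0// powRN invf_le1 ?powR_gt0 ?(lt_le_trans ltr01 l1)//.
have i3 : 0 <= 3^-1 :> R by rewrite invr_ge0.
have := ge0_ler_powR i3 _ _ l1; rewrite !nnegrE powR1 => -> //.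
exact: le_trans ler01 l1.
Qed.

(** The truncation level grows like the square root of a logarithm, slower than any negative power;
    ln u < u for u = Delta^(-eta) makes this explicit. *)
Lemma alg_r2_le c2t g eta : 0 < c2t -> 0 <= g -> 0 < eta -> exists2 C, 0 <= C &
  forall Delta, 0 < Delta -> 1 <= ln Delta^-1 -> 1 <= c2t * powR Delta (- g) * ln Delta^-1 ->
  alg_r2 Delta c2t g <= C * powR Delta (- (eta / 2)).
Proof.
move=> c0 g0 eta0; pose C1 := 2 * (`|ln c2t| + (g + 1) / eta).
exists (Num.sqrt C1) => [|Delta D0 l1 Y1]; first exact: sqrtr_ge0.
have e0 : 0 < powR Delta (- (eta / 2)) by exact: powR_gt0.
have C10 : 0 <= C1 by rewrite mulr_ge0// addr_ge0// divr_ge0 ?addr_ge0// ltW.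
rewrite -ler_sqr ?nnegrE ?sqrtr_ge0 ?mulr_ge0 ?sqrtr_ge0 ?(ltW e0)//.
rewrite alg_r2_sqr// exprMn sqr_sqrtr// -powR_mulrn ?(ltW e0)// -powRrM.
have -> : - (eta / 2) * 2 = - eta by field.
set l := ln Delta^-1 in l1 Y1 *; have l0 : 0 < l by exact: (lt_le_trans ltr01 l1).
have lN : ln Delta = - l by rewrite /l lnV ?posrE// opprK.
have ll : ln l <= l by exact/ltW/ln_sublinear.
have Pl : l <= powR Delta (- eta) / eta.
  rewrite ler_pdivlMr// mulrC; have : ln (powR Delta (- eta)) < powR Delta (- eta).
    by apply: ln_sublinear; exact: powR_gt0.
  by rewrite ln_powR lN mulrNN => /ltW.
have P1 : 1 <= powR Delta (- eta).
  rewrite -ler_ln ?posrE ?powR_gt0// ln1 ln_powR lN mulrNN mulr_ge0// ltW//.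
rewrite !lnM ?posrE ?powR_gt0 ?mulr_gt0 ?powR_gt0// ln_powR lN mulrNN.
have c1 : ln c2t <= `|ln c2t| * powR Delta (- eta).
  by apply: le_trans (ler_norm _) _; rewrite ler_peMr.
have hyp1 : (g + 1) * l <= (g + 1) * (powR Delta (- eta) / eta) by rewrite ler_wpM2l ?addr_ge0.
have -> : C1 * powR Delta (- eta) =
    2 * (`|ln c2t| * powR Delta (- eta) + (g + 1) * (powR Delta (- eta) / eta)).
  by rewrite /C1; field; rewrite gt_eqF.
move: hyp1 c1; move: (powR _ _ / eta) => u; move: (_ * powR _ _) => v; move: (ln c2t) => w.
lra.
Qed.

(** In units of h an Euler step has size Delta^(1/2 - gcube) r2. Half of the exponent eta = 1/2 -
    gcube absorbs the growth of r2, and the other half makes the product small. *)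
Lemma near_perturbation (ccube gcube c2t g c : R) (D : nat) dl :
  0 < ccube -> gcube < 2^-1 -> 0 < c2t -> 0 < g -> 0 <= c -> 0 < dl ->
  \forall Delta \near 0^'+, (alg_h Delta gcube ccube / 2)^-1 *
    (Delta * c + Num.sqrt Delta * (c * (D%:R * alg_r2 Delta c2t g))) <= dl.
Proof.
move=> cc0 g12 c0 g0 c1 dl0; pose eta := 2^-1 - gcube.
have eta0 : 0 < eta by rewrite subr_gt0.
have [C C0 hC] := alg_r2_le c0 (ltW g0) eta0.
pose M := 2 / ccube * (c * (1 + D%:R * C)).
have M0 : 0 <= M by rewrite mulr_ge0 ?divr_ge0 ?(ltW cc0)// mulr_ge0// addr_ge0// mulr_ge0.
near=> x.
have x0 : 0 < x by near: x; exact: nbhs_right_gt.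
have x1 : x <= 1 by near: x; exact: nbhs_right_le.
have l1 : 1 <= ln x^-1 by near: x; exact: near_ln_ge1.
have Y1 : 1 <= c2t * powR x (- g) * ln x^-1 by near: x; exact: near_truncation_level.
have xe : powR x (eta / 2) <= dl / (M + 1).
  by near: x; apply: near_powR_le; rewrite divr_gt0// ltr_wpDl.
have r2 := hC _ x0 l1 Y1; set r := alg_r2 _ _ _ in r2 *.
have P1 : 1 <= powR x (- (eta / 2)).
  rewrite -ler_ln ?posrE ?powR_gt0// ln1 ln_powR mulNr -mulrN -lnV ?posrE//.
  by rewrite mulr_ge0 ?divr_ge0 ?(ltW eta0)// (le_trans ler01).
have xs : x <= Num.sqrt x.
  have s1 : Num.sqrt x <= 1 by rewrite -sqrtr1 ler_wsqrtr.
  by rewrite -[leLHS]sqr_sqrtr ?(ltW x0)// expr2 ler_piMl// ltW.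
set P := powR x (- (eta / 2)) in r2 P1.
have step : x * c + Num.sqrt x * (c * (D%:R * r)) <= Num.sqrt x * (c * (1 + D%:R * C)) * P.
  have h1 : x * c <= Num.sqrt x * c * P.
    apply: le_trans (ler_wpM2r c1 xs) _; rewrite ler_peMr// mulr_ge0// ltW.
  have h2 : Num.sqrt x * (c * (D%:R * r)) <= Num.sqrt x * (c * (D%:R * (C * P))).
    by rewrite !ler_wpM2l// ltW.
  by apply: le_trans (lerD h1 h2) _; rewrite le_eqVlt; apply/orP; left; apply/eqP; ring.
have h0 : 0 < alg_h x gcube ccube by rewrite mulr_gt0// powR_gt0.
apply: le_trans (ler_wpM2l _ step) _; first by rewrite invr_ge0 divr_ge0// ltW.
have -> : (alg_h x gcube ccube / 2)^-1 * (Num.sqrt x * (c * (1 + D%:R * C)) * P) =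
    M * powR x (eta / 2).
  have -> : powR x (eta / 2) = (powR x gcube)^-1 * Num.sqrt x * P.
    rewrite -powR12_sqrt ?(ltW x0)// -powRN -!powRD; last 2 first.
    - by rewrite (gt_eqF x0) implybT.
    - by rewrite (gt_eqF x0) implybT.
    by congr powR; rewrite /eta; field.
  rewrite /M /alg_h; have := powR_gt0 gcube x0; move: (powR x gcube) => G G0.
  by field; rewrite !gt_eqF.
apply: le_trans (ler_wpM2l M0 xe) _.
rewrite mulrA ler_pdivrMr ?ltr_wpDl//; nra.
Unshelve. all: by end_near. Qed.

Lemma sample_size_gt (t : R) : 0 < t -> (0 < `|Num.ceil t|)%N /\ t <= (`|Num.ceil t|)%N%:R.
Proof.
move=> t0; have c0 : 0 < Num.ceil t by rewrite ceil_gt0.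
split; first by rewrite absz_gt0 gt_eqF.
by apply: le_trans (ceil_ge t) _; rewrite natr_absz gtr0_norm.
Qed.

(** L is logarithmic in 1/Delta with factor rho c1p, so exp(-k L) is at most a power of Delta / c2p
    with exponent rho c1p k >= rho. *)
Lemma failure_prob_le (rho : nat) (c1p c2p k Delta : R) (L : nat) :
  0 <= k -> 1 <= c1p * k -> 0 < c2p -> 0 < Delta -> Delta <= c2p ->
  rho%:R * c1p * ln (c2p * Delta^-1) <= L%:R ->
  expR (- (k * L%:R)) <= (Delta / c2p) ^+ rho.
Proof.
move=> k0 ck c0 D0 Dc hL.
have l0 : 0 <= ln (c2p * Delta^-1) by rewrite ln_ge0// ler_pdivlMr// mul1r.
have q0 : 0 < Delta / c2p by rewrite divr_gt0.
rewrite -[Delta / c2p]lnK ?posrE// -expRM_natl ler_expR.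
have -> : Delta / c2p = (c2p * Delta^-1)^-1 by rewrite invfM invrK mulrC.
rewrite lnV ?posrE ?divr_gt0// mulrN lerN2.
apply: le_trans (ler_wpM2l k0 hL).
have -> : k * (rho%:R * c1p * ln (c2p * Delta^-1)) = (rho%:R * ln (c2p * Delta^-1)) * (c1p * k) by ring.
by rewrite ler_peMr// mulr_ge0.
Qed.

(* The slack between [tau] and [1 - sqrt (cstar / c1p)] leaves a factor [49 / 48] after an eighth
   of [1 - tau] is spent on the discretisation of the unit sphere. *)
Lemma sample_rate_ge1 (m c1p tau : R) : 0 < m -> 0 < c1p ->
  tau < 1 - Num.sqrt ((2 / 3 + 8 / 3 * m) / c1p) ->
  1 <= c1p * ((1 - (tau + (1 - tau) / 8)) ^+ 2 / (2 * m)).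
Proof.
move=> mgt c0 ht; have m0 := ltW mgt; set v := _ / c1p in ht.
have v0 : 0 <= v by rewrite divr_ge0 ?(ltW c0)//; lra.
have s0 := sqrtr_ge0 v.
have : v <= (1 - tau) ^+ 2.
  by rewrite -[leLHS]sqr_sqrtr// ler_sqr ?nnegrE//; lra.
rewrite ler_pdivrMr// => h; rewrite mulrA ler_pdivlMr ?mulr_gt0// mul1r.
nra.
Qed.

End SmallStep.

(** * Choice of the constants and conclusion *)

Lemma near_right0_ex (R : realType) (P : R -> Prop) : (\forall x \near 0^'+, P x) ->
  exists2 e : R, 0 < e & forall x, 0 < x -> x <= e -> P x.
Proof.
move=> /nbhs_ballP[e /= e0 eP]; exists (e / 2) => [|x x0 xe]; first by rewrite divr_gt0.
by apply: eP => //=; rewrite /ball/= sub0r normrN gtr0_norm//; lra.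
Qed.

Lemma legendre_mass_gt0 (R : realType) (D Q : nat) : 0 < legendre_mass (R := R) D Q.
Proof.
rewrite legendre_massE (bigD1 (Ordinal (@nK_gt0 D Q)))//= ltr_pwDl//.
  by apply: prodr_gt0 => d _; rewrite ltr0n addn1.
by apply: sumr_ge0 => k _; apply: prodr_ge0.
Qed.

(** Truncation and regression error are both of order Delta^((|iota| + rho)/2) before the Hermite
    weight: the first by the value of [g2], the second because [g] times Q + 1 is this exponent. *)
Lemma good_cell_error (R : realType) (D rho Q : nat) (iota : 'I_D -> nat) (ccube c2t tau My : R) :
  0 < ccube -> 0 < c2t -> 0 < tau -> 0 <= My -> exists2 C, 0 <= C &
  forall (y : 'cV[R]_D -> R) b sigma (C2f : R) L (Delta c1t g1t : R) smp k x,
  let g := (rho + mi_norm iota)%:R / (2 * Q.+1%:R) in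
  let g2 := 3 / 2 * (mi_norm iota + rho)%:R in
  let i := alg_i C2f Delta g ccube c1t g1t k in
  CbM Q.+1 My y -> 0 < Delta -> 1 <= ln Delta^-1 ->
  1 <= c2t * powR Delta (- g2) * ln Delta^-1 -> (0 < L)%N ->
  (forall (l : 'I_L) d, `|cell_coord (alg_h Delta g ccube) i
     (alg_X b sigma Delta c2t g2 smp k l) d 0| <= 2) ->
  (forall z d, `|cell_coord (alg_h Delta g ccube) i
     (euler b sigma Delta x (truncv (alg_r2 Delta c2t g2) z)) d 0| <= 2) ->
  tau * L%:R <= smin_sq (alg_A b sigma C2f L Q Delta g ccube c1t c2t g1t g2 smp k) ->
  `|target y b sigma Delta iota x - \sum_(kk < nK D Q)
     alg_alpha y b sigma C2f L Q Delta tau g ccube c1t c2t g1t g2 smp k kk 0 *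
     gaussE (fun z => alg_eta Q Delta g ccube i kk
        (euler b sigma Delta x (truncv (alg_r2 Delta c2t g2) z)) *
        hermite_mi iota Delta (truncv (alg_r2 Delta c2t g2) z))| <=
  C * powR Delta (rho%:R / 2).
Proof.
move=> cc0 c0 tau0 My0; set q := mi_norm iota.
have [Ct Ct0 hCt] := @trunc_error R D iota My My0.
have [Cr Cr0 hCr] := @regression_error R D Q iota My tau My0 tau0.
exists (Ct * powR c2t (- 3^-1) + Cr * ccube ^+ Q.+1).
  by rewrite addr_ge0// mulr_ge0 ?powR_ge0// exprn_ge0// ltW.
move=> y b sigma C2f L Delta c1t g1t smp k x g g2 i hy D0 l1 Y1 L0 X2 Z2 good.
have h0 : 0 < alg_h Delta g ccube by rewrite mulr_gt0// powR_gt0.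
have r0 : 0 <= alg_r2 Delta c2t g2 by exact: sqrtr_ge0.
have [cy yM] := CbM_bounded hy.
have e1 := hCt y (x + Delta *: b x) (sigma x) Delta _ cy yM D0 r0.
have e2 := hCr y _ i (x + Delta *: b x) (sigma x) Delta _ L _ hy h0 D0 r0 L0 X2 Z2 good.
rewrite /alg_alpha good.
apply: le_trans (le_trans (ler_distD _ _ _) (lerD e1 e2)) _.
have PN : powR Delta (- (q%:R / 2)) * powR Delta ((q + rho)%:R / 2) = powR Delta (rho%:R / 2).
  by rewrite -powRD ?(gt_eqF D0) ?implybT// natrD; congr powR; field.
have hQ : alg_h Delta g ccube ^+ Q.+1 = ccube ^+ Q.+1 * powR Delta ((q + rho)%:R / 2).
  rewrite exprMn -[in LHS](powR_mulrn _ (powR_ge0 _ _)) -powRrM; congr (_ * powR _ _).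
  have N0 : Q.+1%:R != 0 :> R by rewrite pnatr_eq0.
  by rewrite /g addnC; move: (Q.+1%:R) N0 => N N0; field.
rewrite -/q hQ mulrDl; apply: lerD.
  apply: le_trans (ler_wpM2l _ (expR_alg_r2_le c0 D0 l1 Y1)) _.
    by rewrite mulr_ge0 ?powR_ge0.
  by rewrite -PN le_eqVlt; apply/orP; left; apply/eqP; ring.
by rewrite -PN le_eqVlt; apply/orP; left; apply/eqP; ring.
Qed.

Theorem theorem3p1 (R : realType) (D rho : nat) (iota : 'I_D -> nat) (Q : nat)
  (ccube c1t c2t c1p c2p tau C1f C2f Cbs My : R) :
  (0 < D)%N -> (0 < rho)%N -> (mi_norm iota + rho <= Q)%N ->
  0 < ccube -> 0 < c1t -> 0 < c2t -> 0 < c2p -> cstar D Q < c1p ->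
  0 < tau -> tau < 1 - Num.sqrt (cstar D Q / c1p) ->
  0 < C1f -> 0 < C2f ->
  exists C Delta0 : R, 0 < C /\ 0 < Delta0 /\
  forall (f : 'cV[R]_D -> R) (b : 'cV[R]_D -> 'cV[R]_D)
         (sigma : 'cV[R]_D -> 'M[R]_D) (y : 'cV[R]_D -> R),
    (* mu_1 has Lebesgue density f with the Gaussian-type bound *)
    (forall x, 0 <= f x) -> borel_measurable f ->
    lebD (fun x => (f x)%:E) = 1%E ->
    (forall x, f x <= C1f / powR (2 * pi * C2f) (D%:R / 2)
                      * expR (- (norm2 x ^+ 2) / (2 * C2f))) ->
    (* b, sigma measurable and bounded *)
    borel_measurable b -> borel_measurable sigma ->
    (forall u, norm2 (b u) + spec_norm (sigma u) <= Cbs) ->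
    (* y in C_b^{Q+1} with C_b^{Q+1}-norm at most My *)
    CbM Q.+1 My y ->
    forall Delta : R, 0 < Delta -> Delta <= Delta0 ->
    (alg_mse y b sigma C2f
       `|Num.ceil (rho%:R * c1p * ln (c2p * Delta^-1))|%N   (* L *)
       Q Delta iota tau
       ((rho + mi_norm iota)%:R / (2 * (Q.+1)%:R))           (* gamma_cube *)
       ccube c1t c2t
       rho%:R                                                (* gamma_1,trunc *)
       (3 / 2 * (mi_norm iota + rho)%:R)                     (* gamma_2,trunc *)
       f
     <= (C * powR (ln (Delta^-1)) (D%:R / 2) * Delta ^+ rho)%:E)%E.
Proof.
move=> D0 rho0 qQ cc0 c1t0 c2t0 c2p0 hc1p tau0 htau C1f0 C2f0.
have m0 := @legendre_mass_gt0 R D Q; set m := legendre_mass D Q in m0.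
have cstarE : cstar D Q = 2 / 3 + 8 / 3 * m by [].
have c1p0 : 0 < c1p by apply: lt_trans hc1p; rewrite cstarE; lra.
rewrite cstarE in htau.
have rate := sample_rate_ge1 m0 c1p0 htau.
have tau1 : tau < 1 by have := sqrtr_ge0 ((2 / 3 + 8 / 3 * m) / c1p); lra.
(* [My] and [Cbs] are fixed before the functions that they bound. If one of them is negative there
   are no such functions, and any constants do. *)
have [My0|Mylt] := leP 0 My; last first.
  exists 1, 1; do 2 split => //; move=> f b sigma y _ _ _ _ _ _ _ hy.
  by have [_ /(_ 0) yM] := CbM_bounded hy; have := le_lt_trans (le_trans (normr_ge0 _) yM) Mylt; rewrite ltxx.
have [Cb0|Cblt] := leP 0 Cbs; last first.
  exists 1, 1; do 2 split => //; move=> f b sigma y _ _ _ _ _ _ bs hy.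
  have [s0 _] := spec_norm_le (sigma 0) 0 D0.
  by have := bs 0; have := norm2_ge0 (b 0); lra.
set q := mi_norm iota in qQ *.
have qQ1 : (q <= Q.+1)%N by rewrite ltnW// ltnS (leq_trans (leq_addr _ _) qQ).
set tau' := tau + (1 - tau) / 8 in rate.
have [|net [dl1 dl10 [nu nb]]] := @small_singular_value R D Q tau tau'; first by rewrite /tau'; lra.
pose dl := Num.min 1 dl1.
have dl_le1 : dl <= 1 by rewrite ge_min lexx.
have dl2 : dl + 1 <= 2 by lra.
have dl0 : 0 < dl by rewrite lt_min ltr01.
have [CT CT0 hCT] := @target_bound R D iota My Cbs My0 Cb0.
have [Ce Ce0 hCe] := @good_cell_error R D rho Q iota ccube c2t tau My cc0 c2t0 tau0 My0.
(* [s] minimises s tau' - s + s^2 m / 2, and the minimum is -k. *)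
pose k := (1 - tau') ^+ 2 / (2 * m).
pose s := (1 - tau') / m.
have c2p2 : c2p / 2 <= c2p by lra.
have tau'0 : 0 <= tau' by rewrite /tau'; lra.
have tau'1 : tau' < 1 by rewrite /tau'; lra.
have s0 : 0 <= s by rewrite divr_ge0 ?(ltW m0)// subr_ge0 ltW.
have sm : s * m = 1 - tau' by rewrite /s mulfVK ?gt_eqF.
have sm2 : s * m <= 2 by rewrite sm; lra.
pose g2 := 3 / 2 * (q + rho)%:R : R.
have g20 : 0 < g2 by rewrite mulr_gt0 ?divr_gt0// ltr0n addn_gt0 rho0 orbT.
pose g := (rho + q)%:R / (2 * Q.+1%:R) : R.
have g12 : g < 2^-1.
  rewrite /g invfM mulrA ltr_pdivrMr ?ltr0n// mulrC ltr_pM2l ?invr_gt0// ltr_nat ltnS addnC//.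
(* The third condition makes the level of the chi-square quantile at most 1/2, and the fourth makes
   the logarithm in the number of samples positive, so that L > 0. *)
have [e e0 He] : exists2 e : R, 0 < e & forall Delta, 0 < Delta -> Delta <= e ->
  [/\ 1 <= ln Delta^-1, 1 <= c2t * powR Delta (- g2) * ln Delta^-1,
      powR Delta rho%:R <= (2 * c1t)^-1, Delta <= c2p / 2 &
      (alg_h Delta g ccube / 2)^-1 *
        (Delta * Cbs + Num.sqrt Delta * (Cbs * (D%:R * alg_r2 Delta c2t g2))) <= dl].
  apply: near_right0_ex; near=> x; split; near: x.
  - exact: near_ln_ge1.
  - exact: near_truncation_level.
  - by apply: near_powR_le; rewrite ?ltr0n// invr_gt0 mulr_gt0.
  - by apply: nbhs_right_le; rewrite divr_gt0.
  - exact: near_perturbation.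
pose C := C1f * (Ce ^+ 2 + CT ^+ 2 * c1t + CT ^+ 2 * ((size net)%:R * c2p^-1 ^+ rho)).
have C0 : 0 <= C.
  apply: mulr_ge0; first exact: ltW.
  by rewrite !addr_ge0 ?sqr_ge0// mulr_ge0 ?sqr_ge0 ?(ltW c1t0)// mulr_ge0// exprn_ge0// invr_ge0 ltW.
(* [C] may be 0, and the constant has to be positive. *)
exists (C + 1), e; split; first by rewrite ltr_wpDl.
split=> // f b sigma y f0 _ _ fenv _ _ bs hy Delta Delta0 De.
have [l1 Y1 a1 Dc pert] := He _ Delta0 De.
have t0 : 0 < rho%:R * c1p * ln (c2p * Delta^-1).
  rewrite !mulr_gt0 ?ltr0n// ln_gt0// ltr_pdivlMr// mul1r; lra.
have [] := sample_size_gt t0; move: `|Num.ceil _|%N => L L0 tL.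
have sb u : spec_norm (sigma u) <= Cbs by have := bs u; have := norm2_ge0 (b u); lra.
have bb u d : `|b u d 0| <= Cbs.
  apply: le_trans (coord_le_norm2 _ _) _; have [sp0 _] := spec_norm_le (sigma u) 0 D0.
  by have := bs u; lra.
have h0 : 0 < alg_h Delta g ccube by rewrite mulr_gt0// powR_gt0.
have near_cell i u z d :
  `|cell_coord (alg_h Delta g ccube) i (euler b sigma Delta u (truncv (alg_r2 Delta c2t g2) z)) d 0 -
    cell_coord (alg_h Delta g ccube) i u d 0| <= dl.
  have r0 : 0 <= alg_r2 Delta c2t g2 by exact: sqrtr_ge0.
  apply: (@euler_cell_coord R D _ i b sigma Cbs Delta _ dl u z h0 Cb0 Delta0 r0 bb _ pert d).
  by move=> x; exact: spec_norm_linear_bound.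
have err_le := hCe y b sigma C2f L Delta c1t rho%:R _ _ _ hy Delta0 l1 Y1 L0.
have mse := @alg_mse_le R D Q L iota y f b sigma C1f C2f Delta tau g ccube c1t c2t rho%:R g2
  CT (Ce * powR Delta (rho%:R / 2)) s tau' dl net h0 C1f0 C2f0.
apply: le_trans (mse _ _ dl_le1 s0 _ f0 fenv _ near_cell _ nu _) _.
- by rewrite mulr_gt0// powR_gt0.
- apply: le_lt_trans (ler_wpM2l (ltW c1t0) a1) _.
  have -> : c1t * (2 * c1t)^-1 = 2^-1 by field; rewrite gt_eqF.
  by rewrite invf_lt1// ltr1n.
- exact: sm2.
- move=> x; have hq : CbM q My y by exact: CbMW qQ1 hy.
  exact: (hCT y (x + Delta *: b x) (sigma x) Delta hq (spec_norm_linear_bound D0 (sb x)) Delta0).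
- move=> smp i x xi X2 good; apply: err_le => // z d.
  have x1 : `|cell_coord (alg_h Delta g ccube) (alg_i C2f Delta g ccube c1t rho%:R i) x d 0| <= 1.
    by rewrite ler_norml; exact: cube_cell_coord.
  rewrite -(subrK (cell_coord (alg_h Delta g ccube) (alg_i C2f Delta g ccube c1t rho%:R i) x d 0)
    (cell_coord _ _ _ d 0)).
  by apply: le_trans (ler_normD _ _) (le_trans (lerD (near_cell _ _ _ _) x1) dl2).
- move=> Y U U1 YU; apply: nb => // l d.
  by apply: le_trans (YU l d) _; rewrite ge_min lexx orbT.
have k0 : 0 <= k by rewrite divr_ge0 ?sqr_ge0// mulr_ge0// ltW.
have fail : expR (s * (tau' * L%:R)) * expR (- (s - s ^+ 2 * m / 2)) ^+ L <= (Delta / c2p) ^+ rho.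
  have Dc' : Delta <= c2p by exact: le_trans Dc c2p2.
  apply: le_trans (failure_prob_le k0 rate c2p0 Delta0 Dc' tL).
  rewrite -expRM_natl -expRD ler_expR /k /s.
  by rewrite le_eqVlt; apply/orP; left; apply/eqP; field; rewrite gt_eqF.
rewrite lee_fin -/m powR_mulrn ?(ltW Delta0)// exprMn.
rewrite -(powR_mulrn 2 (powR_ge0 _ _)) -powRrM divfK ?pnatr_eq0// powR_mulrn ?(ltW Delta0)//.
have Dr : 0 <= Delta ^+ rho by rewrite exprn_ge0// ltW.
(* For such Delta the logarithm is at least 1, so the bound C Delta^rho may be multiplied by its
   power. *)
have lD : 1 <= powR (ln Delta^-1) (D%:R / 2).
  by rewrite -[leLHS](powRr0 (ln Delta^-1)) ler_powR// divr_ge0.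
apply: (@le_trans _ _ (C * Delta ^+ rho)).
  have hT := ler_wpM2l (ler0n R (size net)) fail.
  apply: le_trans (ler_wpM2l (ltW C1f0) (lerD (lexx _) (ler_wpM2l (sqr_ge0 CT) _))) _.
    by rewrite -mulrA; exact: hT.
  by rewrite expr_div_n /C exprVn le_eqVlt; apply/orP; left; apply/eqP; ring.
rewrite -mulrA; apply: ler_pM => //; first by rewrite lerDl.
by rewrite -[leLHS]mul1r ler_wpM2r.
Unshelve. all: by end_near. Qed.
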